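(* Let $\mathbf{V}$ be a pseudovariety of semigroups, and let $\mathbf{H} = \mathbf{V} \cap \mathbf{G}$, where $\mathbf{G}$ is the class of all finite groups. The following are equivalent. (1) The pseudovariety $\mathbf{V}$ affords efficient compression. (2) The pseudovariety $\mathbf{V}$ contains neither $\mathbf{LRB}$, $\mathbf{RRB}$, nor $\mathbf{T}$. (3) The pseudovariety $\mathbf{V}$ satisfies the following for every $2 \leq w \leq \infty$: $$C^{w+3}_{\mathbf{V}}(N) \in \mathcal{O}(C^w_{\mathbf{H}}(N) + \log N) \quad\text{and}\quad C^{w+2}_{\mathbf{V}}(N) \in \mathcal{O}(C^w_{\mathbf{H}}(N) \cdot \log N).$$ In particular (in case (3)), $\mathbf{V}$ admits straight-line programs of length $\mathcal{O}(\log^2 N)$, i.e., $C^\infty_{\mathbf{V}}(N) \in \mathcal{O}(\log^2 N)$.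
   Context: A pseudovariety (of semigroups) is a class of finite semigroups closed under finite direct products, subsemigroups, and homomorphic images. $\mathbf{LRB}$ is the class of all finite semigroups satisfying the identities $x^2 = x$, $xyx = xy$; $\mathbf{RRB}$ is the class of all finite semigroups satisfying $x^2 = x$, $xyx = yx$; $\mathbf{T}$ is the class of all finite semigroups with a zero element $0$ in which $x^2 = 0$ and $xyx = 0$ for all elements $x,y$. ''$\mathbf{V}$ contains $\mathbf{W}$'' means $\mathbf{W} \subseteq \mathbf{V}$. Straight-line programs. Let $S$ be a finite semigroup and $\Sigma \subseteq S$. A straight-line program over $\Sigma$ is a finite sequence of instructions executed in order and operating on registers $r_1, r_2, \dots$, each able to store one element of $S$. Each instruction is either $r_k \gets s$ for some $s \in \Sigma$, or $r_k \gets r_i \cdot r_j$, where $i,j,k$ need not be distinct and $r_i, r_j$ must have been assigned by previous instructions. Its length is the number of its instructions, its width is the number of registers it operates on. It computes $t \in S$ if upon completion some register contains $t$. For $2 \leq w \leq \infty$, $c^w_S(t;\Sigma)$ denotes the minimal length of a straight-line program over $\Sigma$ of width at most $w$ computing $t$. Put $C^w_S = \max\{c^w_S(t;\Sigma) : \Sigma \subseteq S,\ t \in \langle \Sigma \rangle\}$, where $\langle\Sigma\rangle$ is the subsemigroup generated by $\Sigma$, and $C^w_{\mathbf{V}}(N) = \max\{C^w_S : S \in \mathbf{V}, |S| \leq N\}$. Asymptotics are for $N \to \infty$, and $\infty + c = \infty$. $\mathbf{V}$ affords efficient compression if $C^\infty_{\mathbf{V}}(N) \in \mathcal{O}(\log^k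 N)$ for some $k \in \mathbb{N}$. *)

(* Defs.v *)
From HB Require Import structures.
From mathcomp Require Import all_boot all_order all_algebra.
From mathcomp Require Import all_classical all_reals all_analysis.

Set Implicit Arguments.
Unset Strict Implicit.
Unset Printing Implicit Defensive.

Import Order.TTheory GRing.Theory Num.Theory.
Import numFieldNormedType.Exports.

Local Open Scope classical_set_scope.

(* As for [semigroupType], the empty carrier is allowed.  A pseudovariety in the
   sense below contains the trivial semigroup and hence the empty one, so it is an
   ordinary pseudovariety of nonempty semigroups together with the empty one, to
   which the maxima below assign 0. *)
#[short(type="finSemigroupType")]
HB.structure Definition FinSemigroup := {S of Semigroup S & Finite S}.

Section DirectProduct.
Variables (I : finType) (S : I -> finSemigroupType).

Definition prod_mul (x y : {dffun forall i, S i}) : {dffun forall i, S i} :=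
  [ffun i => (x i * y i)%g].

Lemma prod_mulA : associative prod_mul.
Proof. by move=> x y z; apply/ffunP => i; rewrite !ffunE mulgA. Qed.

HB.instance Definition _ := isSemigroup.Build {dffun forall i, S i} prod_mulA.
End DirectProduct.

Definition direct_product (I : finType) (S : I -> finSemigroupType) :
  finSemigroupType := {dffun forall i, S i}.

Section Classes.
Implicit Types (S T : finSemigroupType) (V W : finSemigroupType -> Prop).

(* The case of an empty index type puts the trivial semigroup into V, and
   surjective (or injective) morphisms give closure under isomorphism. *)
Record pseudovariety V : Prop := Pseudovariety {
  pv_product : forall (I : finType) (S : I -> finSemigroupType),
    (forall i, V (S i)) -> V (direct_product S);
  pv_sub : forall S T (f : {multiplicative S -> T}),
    injective f -> V T -> V S;
  pv_image : forall S T (f : {multiplicative S -> T}),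
    (forall y, exists x, f x = y) -> V S -> V T
}.

Definition contains V W := forall S, W S -> V S.

Definition LRB S : Prop :=
  (forall x : S, x * x = x)%g /\ (forall x y : S, x * y * x = x * y)%g.

Definition RRB S : Prop :=
  (forall x : S, x * x = x)%g /\ (forall x y : S, x * y * x = y * x)%g.

Definition is_zero S (z : S) : Prop := forall x : S, (z * x = z /\ x * z = z)%g.

Definition Tnil S : Prop :=
  exists z : S, [/\ is_zero z, (forall x : S, x * x = z)%g
                  & (forall x y : S, x * y * x = z)%g].

Definition is_group S : Prop :=
  exists e : S, (forall x : S, e * x = x /\ x * e = x)%g /\
                (forall x : S, exists y : S, x * y = e /\ y * x = e)%g.

Definition groups_of V S : Prop := V S /\ is_group S.

End Classes.

(* Least and greatest element of a set of naturals; 0 if there is none.  In the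
   uses below (with at least two registers) they exist whenever the set is
   nonempty: an element of <<Sigma>> is a product of at most |S| generators, and
   two registers suffice to multiply these out. *)
Definition nat_min (A : set nat) : nat := xget 0 (A `&` lbound A).
Definition nat_max (A : set nat) : nat := xget 0 (A `&` ubound A).

Section StraightLinePrograms.
Variable S : finSemigroupType.

Inductive instr :=
  | Const (k : nat) (s : S)    (* r_k <- s *)
  | Mul (k i j : nat).        (* r_k <- r_i * r_j *)

Definition slp := seq instr.

(* [None] marks a register that has not been assigned. *)
Definition state := nat -> option S.

Definition assign (r : state) (k : nat) (s : S) : state :=
  fun n => if n == k then Some s else r n.

(* Fails on reading an unassigned register. *)
Definition exec_instr (r : state) (c : instr) : option state :=
  match c with
  | Const k s => Some (assign r k s)
  | Mul k i j =>
      if (r i, r j) is (Some a, Some b) then Some (assign r k (a * b)%g)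
      else None
  end.

Definition exec (p : slp) : option state :=
  foldl (fun r c => obind (exec_instr^~ c) r) (Some (fun=> None)) p.

Definition slp_over (Sigma : {set S}) (p : slp) : bool :=
  all (fun c => if c is Const _ s then s \in Sigma else true) p.

Definition registers (c : instr) : seq nat :=
  match c with Const k _ => [:: k] | Mul k i j => [:: k; i; j] end.

Definition slp_width (p : slp) : nat :=
  size (undup (flatten (map registers p))).

Definition computes (p : slp) (t : S) : Prop :=
  exists r : state, exec p = Some r /\ exists k, r k = Some t.

End StraightLinePrograms.

(* Widths in {0, 1, ..., oo}, with [None] standing for oo. *)
Definition width := option nat.

Definition leq_width (n : nat) (w : width) : bool :=
  if w is Some m then n <= m else true.

Definition add_width (w : width) (c : nat) : width := omap (addn^~ c) w.

Definition subsemigroup_gen (S : finSemigroupType) (Sigma : {set S}) : {set S} :=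
  (\bigcap_(A : {set S} |
     (Sigma \subset A) && [forall x in A, forall y in A, (x * y)%g \in A]) A)%SET.

Definition slp_cost (w : width) (S : finSemigroupType) (Sigma : {set S}) (t : S)
    : nat :=
  nat_min [set size p | p in [set p : slp S |
    [/\ slp_over Sigma p, leq_width (slp_width p) w & computes p t]]].

Definition CS (w : width) (S : finSemigroupType) : nat :=
  \max_(Sigma : {set S}) \max_(t in subsemigroup_gen Sigma) slp_cost w Sigma t.

Definition CV (w : width) (V : finSemigroupType -> Prop) (N : nat) : nat :=
  nat_max [set n | exists S : finSemigroupType,
                     [/\ V S, #|S| <= N & n = CS w S]].

Section Asymptotics.
Local Open Scope ring_scope.
Variable R : realType.

Definition logR (N : nat) : R := ln N%:R.

Definition CVR (w : width) (V : finSemigroupType -> Prop) (N : nat) : R :=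
  (CV w V N)%:R.

Definition in_bigO (f g : nat -> R) : Prop := (f : nat -> R^o) =O_\oo (g : nat -> R^o).

Definition efficient_compression (V : finSemigroupType -> Prop) : Prop :=
  exists k : nat, in_bigO (CVR None V) (fun N => logR N ^+ k).

Definition compression_bounds (V : finSemigroupType -> Prop) : Prop :=
  forall w : width, leq_width 2 w ->
    in_bigO (CVR (add_width w 3) V)
            (fun N => CVR w (groups_of V) N + logR N) /\
    in_bigO (CVR (add_width w 2) V)
            (fun N => CVR w (groups_of V) N * logR N).

End Asymptotics.

(* Main.v *)
Require Import Defs.
From HB Require Import structures.
From mathcomp Require Import all_boot all_order all_algebra.
From mathcomp Require Import all_classical all_reals all_analysis.
From mathcomp Require Import zify ring lra.

Set Implicit Arguments.
Unset Strict Implicit.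
Unset Printing Implicit Defensive.

Import Order.TTheory GRing.Theory Num.Theory.
Import numFieldNormedType.Exports.

(** Each of the three forbidden classes contains semigroups with about [n ^ 2] elements,
    built from the intervals of a chain of length [n], in which one element is a product
    of [n] generators and of no fewer: every generator covers one step of the chain,
    and a product covers at most what its factors cover ([many_generators]).  A program
    must then load all [n] generators, so the cost is at least about the square root
    of [N] ([compression_lower_bound]), which no power of [log N] bounds.

    Conversely, suppose that [V] contains none of them.  Call a tuple of elements
    free if its product has no second expression by its entries.  Free tuples of all lengths
    would give T ([contains_Tnil]), so for some [m] no [m]-tuple in a member of [V] is free.
    By [no_Tnil] this happens in one of two uniform ways.

    - [V] satisfies a permutation identity.  Then letters commute inside long contexts
      ([commute_in_context]), so the middle part of a long product is a product of powers.
      In a minimal one all sub-multisets have distinct values ([minimal_multiset]), whence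
      the sum of the logarithms of the exponents is at most [log (N + 1)], and repeated
      squaring computes the product in [O(log N)] steps with three registers.

    - Every product of [m] elements can be lengthened.  Applied in powers of [S], this
      makes every element between two idempotents a group element
      ([local_group_element]), so that the elements dividing a given idempotent are closed
      under products ([dividesM]).  As LRB and RRB are not contained in [V], an element
      containing an idempotent acts on the L-classes and on the R-classes of any D-class
      below it by a constant map ([right_block], [left_block]).  A long product [t] is
      therefore [p * x * q], with [p] and [q] of bounded length and [x] in the maximal
      subgroup at an idempotent [g], and Schreier's rewriting expresses [x] by the elements
      [g * b * g] with [b] a word of length [m] or [m + 1] ([through_group],
      [short_form_exists]).  Here [g] is a power of a product of at most [log (N + 1)]
      letters ([small_support]).  Keep [g] in one extra register and the current letter
      in another: then a program over the elements [g * b * g] is simulated with a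
      constant number of instructions for each of its own ([simulation]).

    In both cases the cost at width [w + 2] is [O(C^w_H(N) + log N)], from which the two
    bounds follow because [C^w_H(N)] and [log N] are bounded away from zero.  For groups,
    the doubling cubes of Babai and Szemeredi give [O(log ^ 2 N)] ([group_slp]). *)

(** * Words and powers in a semigroup with an adjoined identity *)

(** The identity is adjoined even to a monoid, so that [x != 1] says that [x] lies
    in [S]. *)
Definition adjone (S : finSemigroupType) : predArgType := option S.

HB.instance Definition _ (S : finSemigroupType) := Finite.copy (adjone S) (option S).

Section AdjoinOne.
Variable S : finSemigroupType.
Local Open Scope group_scope.

Definition adj_mul (x y : adjone S) : adjone S :=
  match x, y with
  | Some a, Some b => Some (a * b)
  | None, _ => y
  | _, None => x
  end.

Lemma adj_mulA : associative adj_mul.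
Proof. by case=> [x|] [y|] [z|] //=; rewrite mulgA. Qed.

Lemma adj_mul1 : left_id None adj_mul. Proof. by case. Qed.
Lemma adj_1mul : right_id None adj_mul. Proof. by case. Qed.

HB.instance Definition _ := isMonoid.Build (adjone S) adj_mulA adj_mul1 adj_1mul.

Definition inj1 (x : S) : adjone S := Some x.

Lemma inj1M x y : inj1 (x * y) = inj1 x * inj1 y. Proof. by []. Qed.

Lemma inj1_inj : injective inj1. Proof. by move=> x y []. Qed.

Lemma adjone_mul_eq1 (x y : adjone S) : (x * y == 1) = (x == 1) && (y == 1).
Proof. by case: x y => [x|] [y|]. Qed.

Lemma adjone_neq1 (x : adjone S) : x != 1 -> exists a, x = inj1 a.
Proof. by case: x => [a|] // _; exists a. Qed.

Lemma card_adjone : #|adjone S| = #|S|.+1. Proof. exact: card_option. Qed.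

Section Eval.
Variables (I : Type) (s : I -> S).

Definition ev (w : seq I) : adjone S := \prod_(i <- w) inj1 (s i).

Lemma ev_nil : ev [::] = 1. Proof. exact: big_nil. Qed.
Lemma ev_cons a w : ev (a :: w) = inj1 (s a) * ev w. Proof. exact: big_cons. Qed.
Lemma ev_seq1 a : ev [:: a] = inj1 (s a). Proof. exact: big_seq1. Qed.
Lemma ev_cat u w : ev (u ++ w) = ev u * ev w. Proof. exact: big_cat. Qed.
Lemma ev_rcons w a : ev (rcons w a) = ev w * inj1 (s a).
Proof. by rewrite -cats1 ev_cat ev_seq1. Qed.

Lemma ev_eq1 w : (ev w == 1) = nilp w.
Proof. by case: w => [|a w]; rewrite ?ev_nil ?eqxx // ev_cons adjone_mul_eq1. Qed.

Lemma ev_flatten_nseq k w : ev (flatten (nseq k w)) = ev w ^+ k.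
Proof.
elim: k => [|k IH] /=; first by rewrite ev_nil.
by rewrite ev_cat IH expgS.
Qed.

End Eval.

Lemma ev_map (I J : Type) (h : J -> I) (s : I -> S) w : ev s (map h w) = ev (s \o h) w.
Proof. by rewrite /ev big_map. Qed.

Lemma eq_ev (I : Type) (s s' : I -> S) w : s =1 s' -> ev s w = ev s' w.
Proof. by move=> e; apply: eq_bigr => i _; rewrite e. Qed.

Lemma eq_in_ev (I : eqType) (s s' : I -> S) (w : seq I) :
  {in w, s =1 s'} -> ev s w = ev s' w.
Proof. by move=> e; rewrite /ev !big_seq; apply: eq_bigr => i iw; rewrite e. Qed.

Lemma ev_id_map (I : Type) (s : I -> S) w : ev id (map s w) = ev s w.
Proof. by rewrite ev_map. Qed.

End AdjoinOne.

Lemma omap_ev (S T : finSemigroupType) (f : S -> T) (I : Type) (s : I -> S) w :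
  {morph f : x y / (x * y)%g} -> omap f (ev s w) = ev (f \o s) w.
Proof.
move=> fM; elim: w => [|a w IH]; first by rewrite !ev_nil.
by rewrite !ev_cons -IH; case: (ev s w) => //= b; rewrite fM.
Qed.

Lemma repeated_value (T : eqType) n (h : 'I_n -> T) : ~~ injectiveb h ->
  exists i j : 'I_n, i < j /\ h i = h j.
Proof.
move=> /injectivePn [i [j ij hij]]; case: (ltngtP i j) => l; first by exists i, j.
  by exists j, i.
by rewrite (val_inj l) eqxx in ij.
Qed.

Section FiniteMonoid.
Variable S : finSemigroupType.
Local Open Scope group_scope.
Notation M := (adjone S).
Implicit Types x y e f g : M.

Lemma idempotent_power x : exists2 k, (0 < k <= #|M|)%N & x ^+ k * x ^+ k = x ^+ k.
Proof.
pose h (i : 'I_(#|M|).+1) := x ^+ i.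
have /repeated_value [i [j [lij hij]]] : ~~ injectiveb h.
  by apply/negP => /injectiveP /leq_card; rewrite card_ord ltnn.
have jM : (j <= #|M|)%N by rewrite -ltnS.
pose p := (j - i)%N.
have p0 : (0 < p)%N by rewrite /p; lia.
have per r q : (i <= r)%N -> x ^+ (r + q * p) = x ^+ r.
  move=> ir; elim: q => [|q IH]; first by rewrite addn0.
  have -> : (r + q.+1 * p = (r - i + q * p) + j)%N by rewrite /p; nia.
  rewrite expgnDr -/(h j) -hij /h -expgnDr.
  by have -> : (r - i + q * p + i = r + q * p)%N by lia.
case: (posnP i) => i0.
  exists p; first by rewrite p0 /p; lia.
  by rewrite -expgnDr -{2}(mul1n p) per // i0.
(* the multiple of the period [p] in the interval from [i] to [j - 1] *)
have [q /andP[iq qj]] : exists q, (i <= q * p < j)%N.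
  exists ((i + p.-1) %/ p)%N.
  have := leq_divM (i + p.-1) p; have := ltn_ceil (i + p.-1) p0.
  rewrite mulSn; set k := (_ %/ p * p)%N; rewrite /p; lia.
exists (q * p)%N; first by lia.
by rewrite -expgnDr per.
Qed.

(** A multiple of every [k <= #|M|], hence of some exponent giving an idempotent power;
    doubling keeps its predecessor positive, so that [omV x] is a positive power of [x]. *)
Definition wexp : nat := ((#|M|) `!).*2.

Definition om x := x ^+ wexp.
Definition omV x := x ^+ wexp.-1.

Lemma wexp_gt1 : (1 < wexp)%N.
Proof. by rewrite /wexp -muln2; have := fact_gt0 #|M|; lia. Qed.

Lemma idem_exp e k : e * e = e -> (0 < k)%N -> e ^+ k = e.
Proof.
move=> ee; case: k => // k _; elim: k => [|k IH]; first exact: expg1.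
by rewrite expgS IH.
Qed.

Lemma om_idem x : om x * om x = om x.
Proof.
have [k /andP[k0 kM] xk] := idempotent_power x.
have /dvdnP [q wq] : k %| wexp.
  by rewrite /wexp -muln2 dvdn_mulr // dvdn_fact // k0.
have xw : om x = x ^+ k.
  rewrite /om wq mulnC expgnA (idem_exp xk) //.
  by move: wexp_gt1; rewrite wq; case: (posnP q) => [->|//]; rewrite mul0n.
by rewrite xw.
Qed.

Lemma omVl x : omV x * x = om x.
Proof. by rewrite /omV -expgSr prednK // ltnW // wexp_gt1. Qed.

Lemma omVr x : x * omV x = om x.
Proof. by rewrite /omV -expgS prednK // ltnW // wexp_gt1. Qed.

Lemma om_id e : e * e = e -> om e = e.
Proof. by move=> ee; rewrite /om idem_exp // ltnW // wexp_gt1. Qed.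

Lemma om_comm x : om x * x = x * om x.
Proof. by rewrite /om -expgS -expgSr. Qed.

Lemma exp_eq1 x k : (0 < k)%N -> (x ^+ k == 1) = (x == 1).
Proof.
case: k => // k _; elim: k => [|k IH]; first by rewrite expg1.
by rewrite expgS adjone_mul_eq1 IH andbb.
Qed.

Lemma om_neq1 x : x != 1 -> om x != 1.
Proof. by rewrite exp_eq1 // ltnW // wexp_gt1. Qed.

Lemma pump x a b k : x = a * x * b -> x = a ^+ k * x * b ^+ k.
Proof.
move=> E; elim: k => [|k IH]; first by rewrite !expg0 mul1g mulg1.
by rewrite {1}E {1}IH expgS expgSr !mulgA.
Qed.

Lemma pumpl x a b : x = a * x * b -> om a * x = x.
Proof.
by move=> /(@pump x a b wexp) E; rewrite {1}E !mulgA -/(om a) om_idem -E.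
Qed.

Lemma pumpr x a b : x = a * x * b -> x * om b = x.
Proof.
by move=> /(@pump x a b wexp) E; rewrite {1}E -!mulgA -/(om b) om_idem !mulgA -E.
Qed.

End FiniteMonoid.

(** * Division in a pseudovariety *)

Section SubSemigroup.
Variables (T : finSemigroupType) (P : {pred T}).
Hypothesis PM : forall x y, P x -> P y -> P (x * y)%g.

Definition subsg of (forall x y, P x -> P y -> P (x * y)%g) : predArgType := {x : T | P x}.
Local Notation U := (subsg PM).

HB.instance Definition _ := SubFinite.copy U {x : T | P x}.

Definition subsg_mul (x y : U) : U := Sub (val x * val y)%g (PM (valP x) (valP y)).

Lemma subsg_mulA : associative subsg_mul.
Proof. by move=> x y z; apply: val_inj; rewrite /= mulgA. Qed.

HB.instance Definition _ := isSemigroup.Build U subsg_mulA.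

Definition subsg_incl (x : U) : T := val x.

Lemma subsg_inclM : {morph subsg_incl : x y / (x * y)%g}. Proof. by []. Qed.

HB.instance Definition _ := isMultiplicative.Build U T subsg_incl subsg_inclM.

Definition subsemigroup : finSemigroupType := U.
Definition subsg_emb : {multiplicative subsemigroup -> T} := subsg_incl.

Lemma subsg_emb_inj : injective subsg_emb. Proof. exact: val_inj. Qed.

Lemma card_subsemigroup : #|subsemigroup| <= #|T|.
Proof. exact: leq_card subsg_emb_inj. Qed.

End SubSemigroup.

(** The relation [r] exhibits [S] as the image of a subsemigroup of [T]. *)
Lemma pv_division V (hV : pseudovariety V) (T S : finSemigroupType) (r : T -> S -> Prop) :
  V T ->
  (forall x y a b, r x a -> r y b -> r (x * y)%g (a * b)%g) ->
  (forall a, exists x, r x a) ->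
  (forall x a b, r x a -> r x b -> a = b) ->
  V S.
Proof.
move=> VT rM rT rF.
pose P (x : T) := `[< exists a, r x a >].
have PM x y : P x -> P y -> P (x * y)%g.
  by move=> /asboolP [a xa] /asboolP [b yb]; apply/asboolP; exists (a * b)%g; apply: rM.
pose U := subsemigroup PM.
have ex (x : U) : exists a, r (val x) a by case: x => x Px; apply/asboolP.
have [f fP] := choice ex.
have fM : {morph f : x y / (x * y)%g}.
  move=> x y; have H := rF _ _ _ (fP (x * y)%g); apply: H; apply: (rM _ _ _ _ (fP x) (fP y)).
pose F : {multiplicative U -> S} := HB.pack f (isMultiplicative.Build _ _ f fM).
apply: (pv_image hV (f := F)); last first.
  by apply: (pv_sub hV (f := subsg_emb PM)) => //; apply: subsg_emb_inj.
move=> a; have [x xa] := rT a.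
have Px : P x by apply/asboolP; exists a.
by exists (Sub x Px); exact: (rF _ _ _ (fP (Sub x Px)) xa).
Qed.

(** Words over [S] act on every factor of a product; letting them range over
    all words relates the product to [S] itself. *)
Lemma pv_words V (hV : pseudovariety V) (S : finSemigroupType) (I : finType)
    (F : I -> finSemigroupType) (h : forall i, S -> F i) :
  (forall i, V (F i)) ->
  (forall u v : seq S, (forall i, ev (h i) u = ev (h i) v) -> ev id u = ev id v) ->
  V S.
Proof.
move=> VF sep.
pose hh (a : S) : direct_product F := [ffun i => h i a].
have proj u p i : ev hh u = Some p -> ev (h i) u = Some (p i).
  move=> E; have := @omap_ev (direct_product F) (F i) (fun p => p i) S hh u.
  rewrite E /= => ->; last by move=> x y; rewrite ffunE.
  by apply: eq_ev => a /=; rewrite ffunE.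
pose r (p : direct_product F) (a : S) := exists u, ev hh u = Some p /\ ev id u = Some a.
apply: (pv_division hV (T := direct_product F) (r := r)).
- exact: pv_product.
- move=> x y a b [u [ux ua]] [v [vy vb]]; exists (u ++ v).
  by rewrite !ev_cat ux ua vy vb.
- by move=> a; exists (hh a), [:: a]; rewrite !ev_seq1.
- move=> x a b [u [ux ua]] [v [vx vb]].
  suff : Some a = Some b by case.
  by rewrite -ua -vb; apply: sep => i; rewrite (proj u x) // (proj v x).
Qed.

(** * Left and right regular bands *)

(** A two-element left zero band with an adjoined identity [None]. *)
Definition lz1 : predArgType := option bool.
HB.instance Definition _ := Finite.copy lz1 (option bool).
Definition lz1_mul (x y : lz1) : lz1 := if x is Some _ then x else y.
Lemma lz1_mulA : associative lz1_mul. Proof. by move=> [x|] [y|] [z|]. Qed.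
HB.instance Definition _ := isSemigroup.Build lz1 lz1_mulA.

(** A two-element right zero band with an adjoined identity [None]. *)
Definition rz1 : predArgType := option bool.
HB.instance Definition _ := Finite.copy rz1 (option bool).
Definition rz1_mul (x y : rz1) : rz1 := if y is Some _ then y else x.
Lemma rz1_mulA : associative rz1_mul. Proof. by move=> [x|] [y|] [z|]. Qed.
HB.instance Definition _ := isSemigroup.Build rz1 rz1_mulA.

Section FirstOccurrences.
Variables (T : eqType) (M : Type) (op : M -> M -> M) (one : M) (s : T -> M).
Hypotheses (opA : associative op) (op1 : left_id one op) (opx1 : right_id one op).
Hypothesis opabs : forall x y, op (op x y) x = op x y.
Let pr u := foldr (fun a m => op (s a) m) one u.

Lemma absorb_filter a x u : op x (s a) = x ->
  op x (pr u) = op x (pr [seq c <- u | c != a]).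
Proof.
elim: u x => [|c u IH] x xa //=; case: eqP => [->|_] /=.
  by rewrite opA xa IH.
rewrite !opA; apply: IH.
by rewrite -xa -!opA (opA (s a) (s c)) opabs.
Qed.

(** A product in which repetitions are absorbed to the left is determined by
    the order of first occurrences, and hence by its images under all maps of
    the letters to a left zero band with identity. *)
Lemma first_occurrences u v :
  (forall f : T -> option bool, ohead (pmap f u) = ohead (pmap f v)) -> pr u = pr v.
Proof.
have [n] := ubnP (size u); elim: n u v => // n IH [|a u] [|b v] //= un H.
- by have := H (fun=> Some true).
- by have := H (fun=> Some true).
have ab : b = a.
  by have := H (fun c => Some (c == a)); rewrite /= eqxx => -[]; case: eqP.
subst b.
have aa : op (s a) (s a) = s a by have := opabs (s a) one; rewrite opx1.
rewrite (absorb_filter u aa) (absorb_filter v aa); congr op; apply: IH.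
  by rewrite size_filter; apply: leq_ltn_trans (count_size _ _) _; lia.
move=> f; have := H (fun c => if c == a then None else f c).
have E w : pmap (fun c => if c == a then None else f c) w =
           pmap f [seq c <- w | c != a].
  by elim: w => //= c w ->; case: eqP.
by rewrite /= eqxx !E.
Qed.

End FirstOccurrences.

Lemma ev_lz1 (T : Type) (f : T -> lz1) u :
  ev f u = if nilp u then None else Some (ohead (pmap f u)).
Proof.
elim: u => [|a u IH]; first by rewrite ev_nil.
rewrite ev_cons IH /=; case: (f a) => [b|]; case: u {IH} => [|c u] //=.
Qed.

Lemma ev_rz1 (T : Type) (f : T -> rz1) u :
  ev f (rev u) = if nilp u then None else Some (ohead (pmap f u)).
Proof.
elim: u => [|a u IH]; first by rewrite ev_nil.
rewrite rev_cons ev_rcons IH /=; case: (f a) => [b|]; case: u {IH} => [|c u] //=.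
Qed.

(** The operation of [first_occurrences] is multiplication here, and its opposite in
    [contains_RRB]. *)
Lemma contains_LRB V (hV : pseudovariety V) : V lz1 -> contains V LRB.
Proof.
move=> VL S [idS absS].
apply: (pv_words hV (I := {ffun S -> option bool}) (F := fun=> lz1) (h := fun f a => f a)) => //.
move=> u v H.
have Hf (f : S -> option bool) : ohead (pmap f u) = ohead (pmap f v).
  have := H (finfun f); rewrite !(eq_ev (s' := f : S -> lz1)) => [|a|a]; try by rewrite ffunE.
  by rewrite !ev_lz1; case: u {H} => [|a u]; case: v => [|b v] //= [].
have E w : ev id w = foldr (fun a m => (inj1 a * m)%g) (1%g : adjone S) w.
  by elim: w => [|a w IH]; rewrite ?ev_nil // ev_cons IH.
rewrite !E; apply: (first_occurrences (op := *%g)) => //.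
- exact: mulgA.
- exact: mulg1.
- move=> [x|] [y|] //=; first by rewrite -!inj1M absS.
  by rewrite mulg1 -[Some x]/(inj1 x) -inj1M idS.
Qed.

Lemma contains_RRB V (hV : pseudovariety V) : V rz1 -> contains V RRB.
Proof.
move=> VR S [idS absS].
apply: (pv_words hV (I := {ffun S -> option bool}) (F := fun=> rz1) (h := fun f a => f a)) => //.
move=> u v; rewrite -(revK u) -(revK v); move: (rev u) (rev v) => {}u {}v H.
have Hf (f : S -> option bool) : ohead (pmap f u) = ohead (pmap f v).
  have := H (finfun f); rewrite !(eq_ev (s' := f : S -> rz1)) => [|a|a]; try by rewrite ffunE.
  by rewrite !ev_rz1; case: u {H} => [|a u]; case: v => [|b v] //= [].
have E w : ev id (rev w) = foldr (fun a m => (m * inj1 a)%g) (1%g : adjone S) w.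
  by elim: w => [|a w IH]; rewrite ?ev_nil // rev_cons ev_rcons IH.
rewrite !E.
apply: (first_occurrences (op := fun x y => (y * x)%g)) => //.
- by move=> x y z /=; rewrite mulgA.
- move=> [x|] [y|] //=; first by rewrite mulgA -!inj1M absS.
  by rewrite mul1g -[Some x]/(inj1 x) -inj1M idS.
Qed.

(** * Nilpotent semigroups and free tuples *)

Definition free_tuple (S : finSemigroupType) (s : nat -> S) (n : nat) :=
  forall v, all (ltn^~ n) v -> ev s v = ev s (iota 0 n) -> v = iota 0 n.

Lemma Tnil_not_uniq (S : finSemigroupType) (z : S) :
  is_zero z -> (forall x : S, x * x = z)%g -> (forall x y : S, x * y * x = z)%g ->
  forall u : seq S, ~~ uniq u -> ev id u = inj1 z.
Proof.
move=> z0 xx xyx.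
have z0l (x : adjone S) : (inj1 z * x)%g = inj1 z.
  by case: x => [x|] //; rewrite -[Some x]/(inj1 x) -inj1M; case: (z0 x) => ->.
elim=> [|a u IH] //=; rewrite negb_and negbK; case: (boolP (a \in u)) => [au _|_ /= nu].
  case/splitPr: au => w1 w2; rewrite ev_cons ev_cat ev_cons !mulgA.
  suff -> : (inj1 a * ev id w1 * inj1 a)%g = inj1 z by rewrite z0l.
  case: (ev id w1) => [b|]; first by rewrite -[Some b]/(inj1 b) -!inj1M xyx.
  by rewrite mulg1 -inj1M xx.
by rewrite ev_cons IH //= -inj1M; case: (z0 a) => _ ->.
Qed.

Lemma ev_subst (S : finSemigroupType) (I J : Type) (s : I -> S) (h : J -> seq I) (s' : J -> S) w :
  (forall j, inj1 (s' j) = ev s (h j)) -> ev s' w = ev s (flatten (map h w)).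
Proof.
move=> E; elim: w => [|a w IH]; first by rewrite !ev_nil.
by rewrite ev_cons E IH /= ev_cat.
Qed.

(** A repetition-free word [u] over a nilpotent semigroup is detected in a
    semigroup with a free tuple as long as [u]: its letters go to the tuple, and
    all other letters to [s 0 * s 0], which freeness keeps apart. *)
Lemma contains_Tnil V (hV : pseudovariety V) :
  (forall n, exists2 S, V S & exists s : nat -> S, free_tuple s n.+1) ->
  contains V Tnil.
Proof.
move=> FV Q [z [z0 xx xyx]].
have ex n : exists St : {S : finSemigroupType & nat -> S},
    V (projT1 St) /\ free_tuple (projT2 St) n.+1.
  by have [S VS [s fs]] := FV n; exists (existT _ S s).
have [F FP] := choice ex.
pose n := #|Q|; pose I : finType := {bseq n of Q}.
pose sz (b : I) := (size b).-1.
pose h (b : I) (q : Q) : projT1 (F (sz b)) :=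
  if q \in (b : seq Q) then projT2 (F (sz b)) (index q b)
  else (projT2 (F (sz b)) 0%N * projT2 (F (sz b)) 0%N)%g.
apply: (pv_words hV (h := h)) => [b|]; first by case: (FP (sz b)).
have key (u v : seq Q) : uniq u -> (forall b, ev (h b) u = ev (h b) v) -> v = u.
  case: u => [|q0 u0] uu H.
    have := H [bseq]; rewrite ev_nil => /esym /eqP; rewrite ev_eq1; by case: (v).
  set u := q0 :: u0 in uu H *.
  have un : (size u <= n)%N by rewrite -(card_uniqP uu) max_card.
  pose b : I := Bseq un; have [_ fr] := FP (sz b).
  set s := projT2 (F (sz b)) in fr.
  pose g q := if q \in u then [:: index q u] else [:: 0%N; 0%N].
  have hg q : inj1 (h b q) = ev s (g q).
    rewrite /h /g; case: ifP => _; first by rewrite ev_seq1.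
    by rewrite ev_cons ev_seq1.
  have szb : (sz b).+1 = size u by [].
  have im w : {subset w <= u} -> flatten (map g w) = map (index^~ u) w.
    elim: w => //= a w IH sub; rewrite IH; last by move=> c cw; apply: sub; rewrite inE cw orbT.
    by rewrite /g sub // mem_head.
  have iu : flatten (map g u) = iota 0 (sz b).+1.
    rewrite im // szb; apply: (@eq_from_nth _ 0%N); rewrite size_map ?size_iota // => i iu.
    by rewrite (nth_map q0) // nth_iota // index_uniq.
  have gv : flatten (map g v) = iota 0 (sz b).+1.
    apply: fr.
      apply/allP => i /flatten_mapP [q qv]; rewrite /g szb.
      case: ifP => [qu|_]; first by rewrite inE => /eqP ->; apply: etrans (index_mem q u) qu.
      by rewrite !inE orbb => /eqP ->.
    by rewrite -iu -!(ev_subst _ hg) H.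
  have vu : {subset v <= u}.
    move=> q qv; apply/negPn/negP => qu.
    have : uniq (flatten (map g v)) by rewrite gv iota_uniq.
    case/splitPr: qv => v1 v2; rewrite map_cat flatten_cat /= cat_uniq => /and3P [_ _].
    by rewrite /g (negbTE qu) /= ?inE.
  move: gv; rewrite -iu !im // => E.
  have /(congr1 (map (nth q0 u))) := E.
  have back w : {subset w <= u} -> map (nth q0 u) (map (index^~ u) w) = w.
    by move=> sub; rewrite -map_comp map_id_in // => q qw /=; rewrite nth_index ?sub.
  by rewrite !back.
move=> u v H.
case: (boolP (uniq u)) => uu; first by rewrite (key u v).
case: (boolP (uniq v)) => uv; first by rewrite (key v u).
by rewrite !(Tnil_not_uniq z0 xx xyx).
Qed.

Definition permutation_identity V n (w : seq nat) :=
  forall (S : finSemigroupType) (s : nat -> S), V S -> ev s w = ev s (iota 0 n).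

Definition lengthening V n :=
  forall (S : finSemigroupType) (s : nat -> S), V S ->
    exists v, [/\ all (ltn^~ n) v, (n < size v)%N & ev s v = ev s (iota 0 n)].

(** No tuple of length [n.+1] is free, so every product of that many elements has
    a second expression.  There are finitely many short ones: if none of them
    works throughout [V], a product of counterexamples has only long ones; if one
    does work, then either it is a permutation of the letters, or it lacks some
    letter, which can then be squared. *)
Lemma no_Tnil V (hV : pseudovariety V) : ~ contains V Tnil ->
  exists n, lengthening V n.+1 \/
    exists w, [/\ perm_eq w (iota 0 n.+1), w <> iota 0 n.+1 & permutation_identity V n.+1 w].
Proof.
move=> nT.
have [n Hn] : exists n, forall S, V S -> forall s : nat -> S, ~ free_tuple s n.+1.
  apply: contrapT => H; apply: nT; apply: contains_Tnil => // n.
  apply: contrapT => H'; apply: H; exists n => S VS s fs.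
  by apply: H'; exists S => //; exists s.
exists n; move: n.+1 Hn => m Hn.
case: (pselect (lengthening V m)) => [|nA]; [by left | right].
have [[S0 s0] /= [V0 H0]] : exists St : {S : finSemigroupType & nat -> S},
    V (projT1 St) /\ forall v, all (ltn^~ m) v -> (m < size v)%N ->
      ev (projT2 St) v <> ev (projT2 St) (iota 0 m).
  apply: contrapT => H; apply: nA => S s VS; apply: contrapT => H'; apply: H.
  by exists (existT _ S s); split=> // v av mv E; apply: H'; exists v.
have [v [vm av vi vV]] : exists v, [/\ (size v <= m)%N, all (ltn^~ m) v,
    v <> iota 0 m & permutation_identity V m v].
  (* one counterexample for every short word, and [S0] for all long ones *)
  apply: contrapT => H.
  have ex (b : {bseq m of 'I_m}) : exists St : {S : finSemigroupType & nat -> S},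
    V (projT1 St) /\ (map val b <> iota 0 m ->
      ev (projT2 St) (map val b) <> ev (projT2 St) (iota 0 m)).
    case: (pselect (map val b = iota 0 m)) => [E|nE]; first by exists (existT _ S0 s0).
    apply: contrapT => H'; apply: H; exists (map val b); split=> //.
    - by rewrite size_map size_bseq.
    - by apply/allP => i /mapP [j _ ->] /=.
    move=> S s VS; apply: contrapT => E; apply: H'.
    by exists (existT _ S s).
  have [F FP] := choice ex.
  pose G (i : option {bseq m of 'I_m}) : finSemigroupType :=
    if i is Some b then projT1 (F b) else S0.
  pose t : nat -> direct_product G :=
    fun k => [ffun i => if i is Some b as o return G o then projT2 (F b) k else s0 k].
  have VG : V (direct_product G).
    by apply: (pv_product hV) => -[b|] //=; case: (FP b).
  apply: (Hn _ VG t) => w aw E.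
  have proj i : ev (fun k => t k i) w = ev (fun k => t k i) (iota 0 m).
    have PM : {morph (fun p : direct_product G => p i) : x y / (x * y)%g}.
      by move=> x y; rewrite ffunE.
    by have := congr1 (omap (fun p : direct_product G => p i)) E; rewrite !omap_ev.
  case: (leqP (size w) m) => wm; last first.
    exfalso; apply: (H0 w aw wm); have := proj None.
    by rewrite !(eq_ev (s' := s0)) // => k; rewrite ffunE.
  have [x xw] : exists x : seq 'I_m, map val x = w.
    exists (pmap insub w); rewrite pmap_filter; last exact: insubK.
    apply/all_filterP/allP => i /(allP aw) im.
    by rewrite insubT.
  have xm : (size x <= m)%N by rewrite -(size_map val) xw.
  apply: contrapT => wi; have [_] := FP (Bseq xm); rewrite /= xw => /(_ wi); apply.
  have := proj (Some (Bseq xm)).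
  by rewrite !(eq_ev (s' := projT2 (F (Bseq xm)))) // => k; rewrite ffunE.
exists v; split=> //; apply: contrapT => np.
have [i im iv] : exists2 i, (i < m)%N & i \notin v.
  apply: contrapT => H; apply: np.
  have sub : {subset iota 0 m <= v}.
    move=> i; rewrite mem_iota /= add0n => im.
    by apply/negPn/negP => iv; apply: H; exists i.
  have uv : uniq v by apply: (leq_size_uniq (iota_uniq 0 m) sub); rewrite size_iota.
  rewrite perm_sym; apply: uniq_perm => [||i]; [exact: iota_uniq | by [] |].
  apply/idP/idP; first exact: sub.
  by move/(allP av); rewrite mem_iota.
(* squaring the letter [i], absent from [v], does not change the value of [v] *)
apply: nA => S s VS.
pose h j := if j == i then [:: i; i] else [:: j].
pose s' j := if j == i then (s i * s i)%g else s j.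
have E j : inj1 (s' j) = ev s (h j).
  by rewrite /s' /h; case: eqP => _; rewrite ?ev_seq1 // ev_cons ev_seq1.
exists (flatten (map h (iota 0 m))); split.
- apply/allP => j /flatten_mapP [k]; rewrite mem_iota /h => km.
  by case: eqP => _; rewrite !inE ?orbb => /eqP ->.
- have sz l : size (flatten (map h l)) = (size l + count_mem i l)%N.
    elim: l => //= j l IH; rewrite size_cat IH /h eq_sym; case: eqP => _ /=; lia.
  by rewrite sz size_iota count_uniq_mem ?iota_uniq // mem_iota im addn1.
- rewrite -(ev_subst _ E) -(vV S s' VS) -(vV S s VS).
  by apply: eq_in_ev => j jv; rewrite /s'; case: eqP => // ji; rewrite ji (negbTE iv) in jv.
Qed.

(** * Consequences of lengthening for a single semigroup *)

Lemma notuniq_split (T : eqType) (v : seq T) : ~~ uniq v ->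
  exists j v1 v2 v3, v = v1 ++ j :: v2 ++ j :: v3.
Proof.
elim: v => //= a v IH; rewrite negb_and negbK; case: (boolP (a \in v)) => [av _|_ /= /IH].
  by case/splitPr: av => v2 v3; exists a, [::], v2, v3.
by case=> j [v1 [v2 [v3 ->]]]; exists j, (a :: v1), v2, v3.
Qed.

Section GroupElements.
Variables (V : finSemigroupType -> Prop) (hV : pseudovariety V) (n : nat).
Hypothesis hn : lengthening V n.+1.
Variables (S : finSemigroupType) (VS : V S).
Local Open Scope group_scope.

(** The tuples [e, .., e, x, f, .., f] with [x] in each possible position all
    have product [x].  Lengthening them simultaneously repeats some letter, and
    the coordinate in which that letter is [x] has [x] twice. *)
Lemma repeated_factor (x e f : S) : e * e = e -> f * f = f -> e * x = x -> x * f = x ->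
  exists a c u, all (mem [:: e; x; f]) u /\
    inj1 x = a * inj1 x * ev id u * inj1 x * c.
Proof.
move=> ee ff ex xf.
pose t : nat -> direct_product (fun _ : 'I_n.+1 => S) :=
  fun j => [ffun i : 'I_n.+1 => if (j < i)%N then e else if j == i then x else f].
have VP : V (direct_product (fun _ : 'I_n.+1 => S)) by apply: (pv_product hV).
have [v [av vn E]] := hn t VP.
pose c (i : nat) j := if (j < i)%N then e else if j == i then x else f.
have proj (i : 'I_n.+1) : ev (c i) v = ev (c i) (iota 0 n.+1).
  have PM : {morph (fun p : direct_product (fun _ : 'I_n.+1 => S) => p i) : x y / x * y}.
    by move=> y z; rewrite ffunE.
  have := congr1 (omap (fun p : direct_product (fun _ : 'I_n.+1 => S) => p i)) E.
  by rewrite !omap_ev // !(eq_ev (s' := c i)) // => k; rewrite /= ffunE.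
have /notuniq_split [j [v1 [v2 [v3 vE]]]] : ~~ uniq v.
  apply/negP => uv; have := uniq_leq_size (s2 := iota 0 n.+1) uv.
  rewrite size_iota => H; have /H : {subset v <= iota 0 n.+1}.
    by move=> i /(allP av); rewrite mem_iota.
  by rewrite leqNgt vn.
have jn : (j < n.+1)%N by apply: (allP av); rewrite vE mem_cat mem_head orbT.
have cx : ev (c j) (iota 0 n.+1) = inj1 x.
  have -> : n.+1 = (j + (1 + (n - j)))%N by lia.
  rewrite iotaD ev_cat add0n /= ev_cons {2}/c ltnn eqxx.
  have -> : ev (c j) (iota j.+1 (n - j)) = ev (fun=> f) (iota j.+1 (n - j)).
    apply: eq_in_ev => k; rewrite mem_iota /c => ?.
    by case: ltnP => ?; [lia | case: eqP => //; lia].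
  have -> : ev (c j) (iota 0 j) = ev (fun=> e) (iota 0 j).
    by apply: eq_in_ev => k; rewrite mem_iota /c add0n /= => ->.
  have absl w : ev (fun=> e) w * inj1 x = inj1 x.
    elim: w => [|k w IH]; first by rewrite ev_nil mul1g.
    by rewrite ev_cons -mulgA IH -inj1M ex.
  have absr w : inj1 x * ev (fun=> f) w = inj1 x.
    elim: w => [|k w IH]; first by rewrite ev_nil mulg1.
    by rewrite ev_cons mulgA -inj1M xf IH.
  by rewrite absr absl.
have cj : c j j = x by rewrite /c ltnn eqxx.
exists (ev (c j) v1), (ev (c j) v3), (map (c j) v2); split.
  apply/allP => b /mapP [k _ ->]; rewrite /c !inE.
  by case: ifP => _; [rewrite eqxx | case: ifP => _; rewrite eqxx !orbT].
have := proj (Ordinal jn); rewrite cx vE ev_cat ev_cons ev_cat ev_cons /= cj => {1}<-.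
by rewrite ev_id_map !mulgA.
Qed.

(** First [x] is shown to be regular.  The idempotents [x * m] and [m * x] of its
    own D-class then take the place of [e] and [f], and with them the factor between
    the two occurrences of [x] produces a square of [x]. *)
Lemma local_group_element (x e f : adjone S) : e != 1 -> f != 1 ->
  e * e = e -> f * f = f -> e * x = x -> x * f = x -> om x * x = x.
Proof.
move=> e1 f1 ee ff ex xf.
have x1 : x != 1 by rewrite -ex adjone_mul_eq1 (negbTE e1).
have [m xmx] : exists m, x = x * m * x.
  have [[e' Ee] [f' Ef] [x' Ex]] := And3 (adjone_neq1 e1) (adjone_neq1 f1) (adjone_neq1 x1).
  have [||||a [c [u [_ E]]]] := @repeated_factor x' e' f'.
  - by apply: inj1_inj; rewrite inj1M -Ee.
  - by apply: inj1_inj; rewrite inj1M -Ef.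
  - by apply: inj1_inj; rewrite inj1M -Ee -Ex.
  - by apply: inj1_inj; rewrite inj1M -Ef -Ex.
  rewrite -Ex in E; set b := ev id u in E.
  have E1 : x = a * x * (b * x * c) by rewrite {1}E !mulgA.
  have E2 : x = (x * (omV (b * x * c) * b)) * x * c.
    by rewrite -{1}(pumpr E1) -omVl !mulgA.
  exists (omV (b * x * c) * b * omV (x * (omV (b * x * c) * b))).
  by rewrite -{1}(pumpl E2) -omVr !mulgA.
have [a [c [u [au E]]]] : exists a c u, all (fun y => (inj1 y == x * m) || (inj1 y == x)
    || (inj1 y == m * x)) u /\ x = a * x * ev id u * x * c.
  have /adjone_neq1 [e' Ee] : x * m != 1 by rewrite adjone_mul_eq1 (negbTE x1).
  have /adjone_neq1 [f' Ef] : m * x != 1 by rewrite adjone_mul_eq1 (negbTE x1) andbF.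
  have [x' Ex] := adjone_neq1 x1.
  have [||||a [c [u [au E]]]] := @repeated_factor x' e' f'.
  - by apply: inj1_inj; rewrite inj1M -Ee !mulgA -xmx.
  - by apply: inj1_inj; rewrite inj1M -Ef !mulgA -(mulgA m x m) -(mulgA m) -xmx.
  - by apply: inj1_inj; rewrite inj1M -Ee -Ex -xmx.
  - by apply: inj1_inj; rewrite inj1M -Ef -Ex mulgA -xmx.
  exists a, c, u; rewrite -Ex in E; split=> //; apply: sub_all au => y.
  by rewrite !inE Ee Ef Ex => /or3P [] /eqP ->; rewrite eqxx ?orbT.
have [xu|[d xu]] : x * ev id u = x \/ exists d, x * ev id u = x * x * d.
  elim/last_ind: u au {E} => [|u y IH]; first by rewrite ev_nil mulg1; left.
  rewrite all_rcons ev_rcons mulgA => /andP [yE /IH [->|[d ->]]]; last first.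
    by right; exists (d * inj1 y); rewrite !mulgA.
  case/orP: yE => [/orP [] /eqP ->|/eqP ->].
  - by right; exists m; rewrite mulgA.
  - by right; exists 1; rewrite mulg1.
  - by left; rewrite mulgA -xmx.
- have E1 : x = a * x * (x * c) by rewrite {1}E -(mulgA a) xu !mulgA.
  have E2 : x = x * x * (c * omV (x * c)) by rewrite -{1}(pumpr E1) -omVr !mulgA.
  exact: pumpl E2.
- have E1 : x = a * x * (x * d * x * c) by rewrite {1}E -(mulgA a) xu !mulgA.
  have E2 : x = x * x * (d * x * c * omV (x * d * x * c)).
    by rewrite -{1}(pumpr E1) -omVr !mulgA.
  exact: pumpl E2.
Qed.

End GroupElements.

Section LocalBands.
Variables (V : finSemigroupType -> Prop) (hV : pseudovariety V).
Variables (S : finSemigroupType) (VS : V S).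
Local Open Scope group_scope.

(** Distinct [a] and [b] would form, together with [e], a copy of [rz1] in the local
    monoid at [e]. *)
Lemma no_local_right_zero (e a b : adjone S) : ~ contains V RRB -> e != 1 ->
  e * e = e -> e * a = a -> a * e = a -> e * b = b -> b * e = b ->
  a * b = b -> b * a = a -> a = b.
Proof.
move=> nR e1 ee ea ae eb be ab ba; apply: contrapT => nab; apply: nR.
apply: contains_RRB => //.
have aa : a * a = a by rewrite -{2}ba mulgA ab ba.
have bb : b * b = b by rewrite -{2}ab mulgA ba ab.
have ea' : e <> a by move=> E; apply: nab; rewrite -{1}ba -E be.
have eb' : e <> b by move=> E; apply: nab; rewrite -ab -E ae.
pose r (x : S) (p : rz1) := inj1 x = if p is Some c then if c then a else b else e.
apply: (pv_division hV (T := S) (r := r)) => //.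
- by move=> x y [[]|] [[]|]; rewrite /r inj1M => -> ->.
- have a1 : a != 1 by rewrite -ea adjone_mul_eq1 (negbTE e1).
  have b1 : b != 1 by rewrite -eb adjone_mul_eq1 (negbTE e1).
  case=> [[]|]; rewrite /r.
  + by have [x] := adjone_neq1 a1; exists x.
  + by have [x] := adjone_neq1 b1; exists x.
  + by have [x] := adjone_neq1 e1; exists x.
- move=> x [[]|] [[]|] //; rewrite /r => -> // E; exfalso;
  by [apply: nab | apply: ea' | apply: eb'].
Qed.

Lemma no_local_left_zero (e a b : adjone S) : ~ contains V LRB -> e != 1 ->
  e * e = e -> e * a = a -> a * e = a -> e * b = b -> b * e = b ->
  a * b = a -> b * a = b -> a = b.
Proof.
move=> nL e1 ee ea ae eb be ab ba; apply: contrapT => nab; apply: nL.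
apply: contains_LRB => //.
have aa : a * a = a by rewrite -{1}ab -mulgA ba ab.
have bb : b * b = b by rewrite -{1}ba -mulgA ab ba.
have ea' : e <> a by move=> E; apply: nab; rewrite -ab -E eb.
have eb' : e <> b by move=> E; apply: nab; rewrite -ba -E ea.
pose r (x : S) (p : lz1) := inj1 x = if p is Some c then if c then a else b else e.
apply: (pv_division hV (T := S) (r := r)) => //.
- by move=> x y [[]|] [[]|]; rewrite /r inj1M => -> ->.
- have a1 : a != 1 by rewrite -ea adjone_mul_eq1 (negbTE e1).
  have b1 : b != 1 by rewrite -eb adjone_mul_eq1 (negbTE e1).
  case=> [[]|]; rewrite /r.
  + by have [x] := adjone_neq1 a1; exists x.
  + by have [x] := adjone_neq1 b1; exists x.
  + by have [x] := adjone_neq1 e1; exists x.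
- move=> x [[]|] [[]|] //; rewrite /r => -> // E; exfalso;
  by [apply: nab | apply: ea' | apply: eb'].
Qed.

End LocalBands.

(** * Divisibility and maximal subgroups *)

Inductive generated (T : semigroupType) (P : T -> Prop) : T -> Prop :=
  | generated_base x : P x -> generated P x
  | generated_mul x y : generated P x -> generated P y -> generated P (x * y)%g.

Lemma generated_exp (S : finSemigroupType) (P : adjone S -> Prop) x k :
  (0 < k)%N -> generated P x -> generated P (x ^+ k)%g.
Proof.
case: k => // k _ gx; elim: k => [|k IH]; first by rewrite expg1.
by rewrite expgS; apply: generated_mul.
Qed.


Section Divides.
Variable S : finSemigroupType.
Local Open Scope group_scope.
Notation M := (adjone S).
Implicit Types x y z e f g : M.

(** Divisibility in [S] with an adjoined identity: [f] lies J-below [x]. *)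
Definition divides x f := exists a b, f = a * x * b.

Lemma divides_refl x : divides x x.
Proof. by exists 1, 1; rewrite mul1g mulg1. Qed.

Lemma divides_trans x y z : divides x y -> divides y z -> divides x z.
Proof.
move=> [a [b ->]] [c [d ->]]; exists (c * a), (b * d).
by rewrite !mulgA.
Qed.

Lemma divides_mulr x y : divides x (x * y).
Proof. by exists 1, y; rewrite mul1g. Qed.

Lemma divides_mull x y : divides y (x * y).
Proof. by exists x, 1; rewrite mulg1. Qed.

Lemma divides_exp x k : (0 < k)%N -> divides x (x ^+ k).
Proof. by case: k => // k _; rewrite expgS; apply: divides_mulr. Qed.

Lemma divides_om x : divides x (om x).
Proof. by apply: divides_exp; rewrite ltnW // wexp_gt1. Qed.

Lemma divides1 x f : divides x f -> f = 1 -> x = 1.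
Proof.
move=> [a [b ->]] /eqP; rewrite !adjone_mul_eq1.
by case/andP => /andP [_ /eqP].
Qed.

Lemma divides_ev (w : seq S) a : a \in w -> divides (inj1 a) (ev id w).
Proof.
case/splitPr => u v; rewrite ev_cat ev_cons.
by exists (ev id u), (ev id v); rewrite !mulgA.
Qed.

Lemma om_exp x : exists2 k, (1 < k <= 2 * #|M|)%N & om x = x ^+ k.
Proof.
have [k /andP [k0 kM] xk] := idempotent_power x.
exists (2 * k)%N; first by lia.
rewrite mulnC expgnA expg2 xk.
have ox : om (x ^+ k) = x ^+ k by apply: om_id.
by rewrite -ox /om expgnAC -/(om x) (idem_exp (om_idem x)).
Qed.

End Divides.

Section LocalStructure.
Variable S : finSemigroupType.
Local Open Scope group_scope.
Notation M := (adjone S).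
Implicit Types x y z e f g : M.
Hypothesis hF : forall x e f, e != 1 -> f != 1 ->
  e * e = e -> f * f = f -> e * x = x -> x * f = x -> om x * x = x.
Hypothesis hR : forall e a b, e != 1 -> e * e = e ->
  e * a = a -> a * e = a -> e * b = b -> b * e = b -> a * b = b -> b * a = a -> a = b.
Hypothesis hL : forall e a b, e != 1 -> e * e = e ->
  e * a = a -> a * e = a -> e * b = b -> b * e = b -> a * b = a -> b * a = b -> a = b.

(** If [f = a * x * b = c * y * d], then [y * d * f * a * x] lies between the
    idempotents [y * d * f * c] and [b * f * a * x], so that it is a group element;
    hence its square, which contains [x * y], still divides [f]. *)
Lemma dividesM x y f : f != 1 -> f * f = f -> divides x f -> divides y f -> divides (x * y) f.
Proof.
move=> f1 ff [a [b E1]] [c [d E2]].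
have fR t : f * (f * t) = f * t by rewrite mulgA ff.
have axb t : a * (x * (b * t)) = f * t by rewrite E1 -!mulgA.
have cyd t : c * (y * (d * t)) = f * t by rewrite E2 -!mulgA.
pose q := y * (d * (f * (a * x))).
have qq : om q * q = q.
  apply: (hF (e := y * (d * (f * c))) (f := b * (f * (a * x)))).
  - by rewrite !adjone_mul_eq1 (negbTE f1) !andbF.
  - by rewrite !adjone_mul_eq1 (negbTE f1) !andbF.
  - by rewrite -!mulgA cyd !fR.
  - by rewrite -!mulgA axb !fR.
  - by rewrite /q -!mulgA cyd !fR.
  - by rewrite /q -!mulgA axb !fR.
have fE : f = c * q * b.
  have bE : a * (x * b) = f by rewrite E1 !mulgA.
  by rewrite /q -!mulgA bE cyd !ff.
exists (c * (omV q * (y * (d * (f * a))))), (d * (f * (a * (x * b)))).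
have qE : q = omV q * q * q by rewrite omVl qq.
by rewrite {1}fE {1}qE; move: (omV q) => w; rewrite /q -!mulgA.
Qed.

Lemma dividesX x f k : f != 1 -> f * f = f -> divides x f -> divides (x ^+ k) f.
Proof.
move=> f1 ff xf; elim: k => [|k IH]; first by exists f, 1; rewrite !mulg1.
by rewrite expgS; apply: dividesM.
Qed.

Lemma ev_divides (w : seq S) f : f != 1 -> f * f = f ->
  (forall a, a \in w -> divides (inj1 a) f) -> divides (ev id w) f.
Proof.
move=> f1 ff; elim: w => [|a w IH] H; first by rewrite ev_nil; exists f, 1; rewrite !mulg1.
rewrite ev_cons; apply: dividesM => //; first by apply: H; rewrite mem_head.
by apply: IH => b bw; apply: H; rewrite inE bw orbT.
Qed.

Section MaximalSubgroup.
Variable g : M.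
Hypotheses (g1 : g != 1) (gg : g * g = g).

(** For [b] dividing [g], the inverse of [g * b * g] in the maximal subgroup at [g]. *)
Definition gi b := omV (g * b * g).

(** The idempotent [om (g * b * g)] is below [g] and J-equivalent to it, hence equal
    to it by finiteness. *)
Lemma om_gbg b : divides b g -> om (g * b * g) = g.
Proof.
move=> bg; set x := g * b * g; set c := om x.
have gx : g * x = x by rewrite /x !mulgA gg.
have xg : x * g = x by rewrite /x -!mulgA gg.
have gc : g * c = c by rewrite /c -omVr mulgA gx.
have cg : c * g = c by rewrite /c -omVl -mulgA xg.
have cc : c * c = c by rewrite /c om_idem.
have [u [v E]] : divides c g.
  apply: dividesX => //; apply: dividesM => //; last exact: divides_refl.
  by apply: dividesM => //; apply: divides_refl.
have E1 : g = u * g * (c * v) by rewrite -(mulgA u) (mulgA g) gc mulgA.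
have gcv : c * om (c * v) = om (c * v) by rewrite -omVr -!mulgA (mulgA c c) cc.
have E2 : g = om (c * v) by rewrite -{1}(pumpr E1) -gcv mulgA gc.
by rewrite -cg E2 gcv.
Qed.

Lemma giE b : g * gi b = gi b /\ gi b * g = gi b.
Proof.
rewrite /gi /omV; have := @wexp_gt1 S; case: wexp => [|[|k]] //= _.
split; first by rewrite expgS !mulgA gg.
by rewrite expgSr -!mulgA gg.
Qed.

Lemma gil b : divides b g -> gi b * (g * b * g) = g.
Proof. by move=> bg; rewrite /gi omVl om_gbg. Qed.

Lemma gir b : divides b g -> (g * b * g) * gi b = g.
Proof. by move=> bg; rewrite /gi omVr om_gbg. Qed.

Lemma gil' b t : divides b g -> gi b * (g * (b * (g * t))) = g * t.
Proof. by move=> bg; rewrite -[in RHS](gil bg) -!mulgA. Qed.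

Lemma gir' b t : divides b g -> g * (b * (g * (gi b * t))) = g * t.
Proof. by move=> bg; rewrite -[in RHS](gir bg) -!mulgA. Qed.

(** The idempotents [e * gi e * e] and [e * gi (z * e) * (g * z * e)] of the local monoid at
    [e] form a right zero band, so they coincide; the latter is a right identity of
    [g * z * e]. *)
Lemma right_idempotent z e : e != 1 -> e * e = e -> divides e g -> divides z g ->
  g * z * e = g * z * e * g * gi e * g * e.
Proof.
move=> e1 ee eg zg.
have zeg : divides (z * e) g by apply: dividesM.
have [I1 I2] := giE e; have [J1 J2] := giE (z * e).
have eR t : e * (e * t) = e * t by rewrite mulgA ee.
have gR t : g * (g * t) = g * t by rewrite mulgA gg.
have I1R t : g * (gi e * t) = gi e * t by rewrite mulgA I1.
have I2R t : gi e * (g * t) = gi e * t by rewrite mulgA I2.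
have J1R t : g * (gi (z * e) * t) = gi (z * e) * t by rewrite mulgA J1.
have J2R t : gi (z * e) * (g * t) = gi (z * e) * t by rewrite mulgA J2.
have Il t : gi e * (e * (gi e * t)) = gi e * t.
  by rewrite -{1}I2 -{2}I1 -!mulgA gil' // I1R.
have Jl t : gi (z * e) * (z * (e * (gi e * t))) = gi e * t.
  have := gil' (gi e * t) zeg; rewrite -!mulgA !I1R => {2}<-.
  by rewrite J2R.
have IJ t : gi e * (e * (gi (z * e) * t)) = gi (z * e) * t.
  have := gil' (gi (z * e) * t) eg; rewrite !J1R => {2}<-.
  by rewrite I2R.
have E : e * gi e * e = e * gi (z * e) * (g * z * e).
  apply: (hR (e := e)) => //.
  - by rewrite -!mulgA eR.
  - by rewrite -!mulgA ee.
  - by rewrite -!mulgA eR.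
  - by rewrite -!mulgA ee.
  - by rewrite -!mulgA eR IJ.
  - by rewrite -!mulgA eR J2R Jl.
have -> : g * z * e * g * gi e * g * e = g * z * e * (e * gi e * e).
  by rewrite -!mulgA eR I1R I2R.
rewrite E -!mulgA eR.
by have := gir' (g * (z * e)) zeg; rewrite -!mulgA J1R => ->; rewrite gR.
Qed.

Lemma left_idempotent z e : e != 1 -> e * e = e -> divides e g -> divides z g ->
  e * z * g = e * g * gi e * g * e * z * g.
Proof.
move=> e1 ee eg zg.
have ezg : divides (e * z) g by apply: dividesM.
have [I1 I2] := giE e; have [J1 J2] := giE (e * z).
have eR t : e * (e * t) = e * t by rewrite mulgA ee.
have gR t : g * (g * t) = g * t by rewrite mulgA gg.
have I1R t : g * (gi e * t) = gi e * t by rewrite mulgA I1.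
have I2R t : gi e * (g * t) = gi e * t by rewrite mulgA I2.
have J1R t : g * (gi (e * z) * t) = gi (e * z) * t by rewrite mulgA J1.
have J2R t : gi (e * z) * (g * t) = gi (e * z) * t by rewrite mulgA J2.
have Jr t : gi e * (e * (z * (gi (e * z) * t))) = gi e * t.
  have := gir' t ezg; rewrite -!mulgA J1R => E.
  by rewrite -{1}I2 -mulgA E I2R.
have JI t : gi (e * z) * (e * (gi e * t)) = gi (e * z) * t.
  have := gir' t eg; rewrite I1R => E.
  by rewrite -{1}J2 -mulgA E J2R.
have E : e * gi e * e = e * z * g * gi (e * z) * e.
  apply: (hL (e := e)) => //.
  - by rewrite -!mulgA eR.
  - by rewrite -!mulgA ee.
  - by rewrite -!mulgA eR.
  - by rewrite -!mulgA ee.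
  - by rewrite -!mulgA eR J1R Jr.
  - by rewrite -!mulgA eR JI.
have -> : e * g * gi e * g * e * z * g = e * gi e * e * (e * z * g).
  by rewrite -!mulgA eR I1R I2R.
rewrite E -!mulgA eR J1R.
by have := gil ezg; rewrite -!mulgA J2R => ->.
Qed.

Definition blocklike b := exists p e q, [/\ b = p * e * q, e != 1 & e * e = e].

(** An element [b] containing an idempotent and dividing [g] moves all L-classes in the
    D-class of [g] into a single one, so that [g * y * b] and [g * b] are related by an
    element of the maximal subgroup at [g]. *)
Lemma right_block b y : blocklike b -> divides b g -> divides y g ->
  g * y * b = (g * y * b * g) * gi b * (g * b).
Proof.
move=> [p [e [q [bE e1 ee]]]] bg yg.
have eg : divides e g by apply: divides_trans bg; rewrite bE; exists p, q.
have pg : divides p g.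
  by apply: divides_trans bg; rewrite bE -mulgA; apply: divides_mulr.
have ypg : divides (y * p) g by apply: dividesM.
have peg : divides (p * e) g by apply: dividesM.
have Eb : g * b = (g * (p * e) * g) * (gi e * g * e * q).
  have := right_idempotent e1 ee eg pg; move/(congr1 (fun t => t * q)).
  by rewrite bE !mulgA.
have Ey : g * y * b = (g * (y * p * e) * g) * (gi e * g * e * q).
  have := right_idempotent e1 ee eg ypg; move/(congr1 (fun t => t * q)).
  by rewrite bE !mulgA.
have [I1 I2] := giE e.
have geq : gi e * g * e * q = gi (p * e) * (g * b).
  by rewrite Eb mulgA gil // !mulgA I1.
pose A := g * (y * p * e) * g * gi (p * e).
have EA : g * y * b = A * (g * b) by rewrite Ey geq /A !mulgA.
have gA : A * g = A by rewrite /A -mulgA (proj2 (giE _)).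
have AE : A = g * y * b * g * gi b.
  by rewrite EA -[LHS]gA -[X in A * X = _](gir bg) !mulgA.
by rewrite {1}EA AE.
Qed.

Lemma left_block b y : blocklike b -> divides b g -> divides y g ->
  b * y * g = (b * g) * gi b * (g * b * y * g).
Proof.
move=> [p [e [q [bE e1 ee]]]] bg yg.
have eg : divides e g by apply: divides_trans bg; rewrite bE; exists p, q.
have qg : divides q g.
  by apply: divides_trans bg; rewrite bE; apply: divides_mull.
have qyg : divides (q * y) g by apply: dividesM.
have eqg : divides (e * q) g by apply: dividesM.
have Eb : b * g = (p * (e * g * gi e)) * (g * (e * q) * g).
  have := left_idempotent e1 ee eg qg; move/(congr1 (fun t => p * t)).
  by rewrite bE !mulgA.
have Ey : b * y * g = (p * (e * g * gi e)) * (g * (e * (q * y)) * g).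
  have := left_idempotent e1 ee eg qyg; move/(congr1 (fun t => p * t)).
  by rewrite bE !mulgA.
have [I1 I2] := giE e.
have peg : p * (e * g * gi e) = b * g * gi (e * q).
  by rewrite Eb -(mulgA (p * _)) gir // -!mulgA I2.
pose A := gi (e * q) * (g * (e * (q * y)) * g).
have EA : b * y * g = (b * g) * A by rewrite Ey peg /A !mulgA.
have gA : g * A = A by rewrite /A mulgA (proj1 (giE _)).
have AE : A = gi b * (g * b * y * g).
  rewrite -(mulgA g b y) -(mulgA g) EA.
  by rewrite -[LHS]gA -[X in X * A = _](gil bg) !mulgA.
by rewrite {1}EA AE !mulgA.
Qed.

Section Schreier.
Variables (L : seq S) (n : nat).
Hypothesis HL : forall a, a \in L -> divides (inj1 a) g.
Hypothesis Hn : forall w, all (mem L) w -> size w = n -> blocklike (ev id w).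

(** Schreier generators of the group generated by the [g * u * g], [u] a long word. *)
Definition sandwich x := exists b,
  [/\ all (mem L) b, (n <= size b <= n.+1)%N & x = g * ev id b * g].

Lemma ev_L_divides w : all (mem L) w -> divides (ev id w) g.
Proof. by move=> /allP Lw; apply: ev_divides => // a /Lw /HL. Qed.

(** Schreier's rewriting: after the first [n] letters, each further letter [a]
    contributes the factor [gi b * (g * b * a * g)], where [b] are the [n] letters
    preceding it; inverses in a finite group are powers. *)
Lemma sandwich_word u : all (mem L) u -> (n <= size u)%N ->
  generated sandwich (g * ev id u * g).
Proof.
elim/last_ind: u => [|u a IH]; first by move=> _ n0; apply: generated_base; exists [::]; rewrite n0.
move=> Lu; rewrite size_rcons => nu.
case: (leqP (size u) n) => un.
  by apply: generated_base; exists (rcons u a); rewrite size_rcons nu.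
move: Lu; rewrite all_rcons => /andP [La Lu].
pose y := take (size u - n) u; pose b := drop (size u - n) u.
have yb : u = y ++ b by rewrite cat_take_drop.
have /andP [Ly Lb] : all (mem L) y && all (mem L) b by rewrite -all_cat -yb.
have sb : size b = n by rewrite size_drop subKn // ltnW.
have bg := ev_L_divides Lb.
have E := right_block (Hn Lb sb) bg (ev_L_divides Ly).
have -> : g * ev id (rcons u a) * g =
    (g * ev id u * g) * gi (ev id b) * (g * ev id (rcons b a) * g).
  by have := congr1 (fun t => t * inj1 a * g) E; rewrite !ev_rcons yb ev_cat !mulgA.
apply: generated_mul; first apply: generated_mul.
- by apply: IH => //; apply: ltnW.
- apply: generated_exp; first by have := @wexp_gt1 S; lia.
  by apply: generated_base; exists b; rewrite sb leqnn leqnSn.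
- apply: generated_base; exists (rcons b a).
  by rewrite all_rcons La Lb size_rcons sb leqnn leqnSn.
Qed.

(** The first [n] letters [b1] of [y1] determine the R-class, and the last [n] letters
    [b2] of [y2] the L-class, of the product; what remains is an element of the
    maximal subgroup at [g]. *)
Lemma through_group (y1 y2 : seq S) : all (mem L) y1 -> all (mem L) y2 ->
  (n <= size y1)%N -> (n <= size y2)%N ->
  exists b1 b2 x, [/\ all (mem L) b1, all (mem L) b2, size b1 = n, size b2 = n &
    generated sandwich x /\ ev id y1 * g * ev id y2 = ev id b1 * x * ev id b2].
Proof.
move=> L1 L2 n1 n2.
pose b1 := take n y1; pose r1 := drop n y1.
pose r2 := take (size y2 - n) y2; pose b2 := drop (size y2 - n) y2.
have E1 : y1 = b1 ++ r1 by rewrite cat_take_drop.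
have E2 : y2 = r2 ++ b2 by rewrite cat_take_drop.
have /andP [Lb1 Lr1] : all (mem L) b1 && all (mem L) r1 by rewrite -all_cat -E1.
have /andP [Lr2 Lb2] : all (mem L) r2 && all (mem L) b2 by rewrite -all_cat -E2.
have s1 : size b1 = n by rewrite size_take_min; lia.
have s2 : size b2 = n by rewrite size_drop subKn.
have gen_gi b : all (mem L) b -> size b = n -> generated sandwich (gi (ev id b)).
  move=> Lb sb; apply: generated_exp; first by have := @wexp_gt1 S; lia.
  by apply: generated_base; exists b; rewrite sb leqnn leqnSn.
exists b1, b2, (gi (ev id b1) * (g * ev id y1 * g) * ((g * ev id y2 * g) * gi (ev id b2))).
split=> //; split.
  by apply: generated_mul; apply: generated_mul; try exact: gen_gi; apply: sandwich_word.
have l := left_block (Hn Lb1 s1) (ev_L_divides Lb1) (ev_L_divides Lr1).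
have r := right_block (Hn Lb2 s2) (ev_L_divides Lb2) (ev_L_divides Lr2).
have l' : ev id y1 * g = ev id b1 * gi (ev id b1) * (g * ev id y1 * g).
  rewrite E1 ev_cat l -(mulgA (ev id b1) g) (proj1 (giE _)).
  by rewrite !mulgA.
have r' : g * ev id y2 = g * ev id y2 * g * gi (ev id b2) * ev id b2.
  have := r; rewrite -(mulgA g) -ev_cat -E2 => {1}->.
  by rewrite mulgA -(mulgA _ (gi _) g) (proj2 (giE _)).
have -> : ev id y1 * g * ev id y2 = (ev id y1 * g) * (g * ev id y2).
  by rewrite -!mulgA (mulgA g g) gg.
by rewrite l' [X in _ * X = _]r' !mulgA.
Qed.

End Schreier.

End MaximalSubgroup.
End LocalStructure.

(** * Idempotent factors of words *)

Section WordDecomposition.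
Variables (S : finSemigroupType) (m : nat).
Local Open Scope group_scope.
Notation M := (adjone S).
Implicit Types p q e w u : seq S.
Hypothesis hF : forall x e f : M, e != 1 -> f != 1 ->
  e * e = e -> f * f = f -> e * x = x -> x * f = x -> om x * x = x.
Hypothesis hlen : forall w, size w = m ->
  exists w', [/\ {subset w' <= w}, (m < size w')%N & ev id w' = ev id w].

Lemma long_word k w : size w = m ->
  exists w', [/\ {subset w' <= w}, (k <= size w')%N & ev id w' = ev id w].
Proof.
move=> wm; elim: k => [|k [u [uw ku E]]]; first by exists w; split.
case: (ltnP k (size u)) => [ku'|uk]; first by exists u.
have [um|um] := leqP m (size u); last first.
  have [v [vw vm E']] := hlen wm; exists v; split=> //; lia.
have [v [vu vm E']] := hlen (size_takel um).
exists (v ++ drop m u); split.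
- move=> a; rewrite mem_cat => /orP [/vu/mem_take|/mem_drop]; exact: uw.
- rewrite size_cat size_drop; lia.
- by rewrite ev_cat E' -ev_cat cat_take_drop.
Qed.

Definition idem_word e := e <> [::] /\ ev id e * ev id e = ev id e.

Lemma idem_word_neq1 e : idem_word e -> ev id e != 1.
Proof. by case=> ne _; rewrite ev_eq1; case: e ne. Qed.

Lemma om_word w : w <> [::] -> idem_word (flatten (nseq (wexp S) w)).
Proof.
move=> nw; split; last by rewrite ev_flatten_nseq -/(om _) om_idem.
have := @wexp_gt1 S; case: (wexp S) => // k _ /=.
by case: w nw.
Qed.

Lemma subset_flatten_nseq k w : {subset flatten (nseq k w) <= w}.
Proof. by elim: k => //= k IH a; rewrite mem_cat => /orP [|/IH]. Qed.

(** Two prefixes of a long word have the same value; what lies between them, and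
    hence its idempotent power, can be inserted at that place. *)
Lemma idem_factor w : (#|M| <= size w)%N -> exists p e q,
  [/\ idem_word e, {subset p ++ e ++ q <= w} & ev id w = ev id (p ++ e ++ q)].
Proof.
move=> wM; pose h (i : 'I_(size w).+1) := ev id (take i w).
have /repeated_value [i [j [lij hij]]] : ~~ injectiveb h.
  by apply/negP => /injectiveP /leq_card; rewrite card_ord ltnNge wM.
have jw : (j <= size w)%N by rewrite -ltnS.
pose u := take (j - i) (drop i w).
have E : take j w = take i w ++ u.
  by rewrite -[LHS](cat_take_drop i) take_takel ?(ltnW lij) // /u take_drop subnK // ltnW.
have un : u <> [::].
  by move/(congr1 size); rewrite size_take size_drop /=; case: ifP; lia.
have H : ev id (take i w) = ev id (take i w) * om (ev id u).
  have H : ev id (take i w) = 1 * ev id (take i w) * ev id u.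
    by rewrite mul1g -ev_cat -E.
  by rewrite (pumpr H).
exists (take i w), (flatten (nseq (wexp S) u)), (drop i w); split.
- exact: om_word.
- move=> a; rewrite !mem_cat => /or3P [/mem_take|/subset_flatten_nseq/mem_take/mem_drop|/mem_drop] //.
- by rewrite !ev_cat ev_flatten_nseq -/(om _) mulgA -H -ev_cat cat_take_drop.
Qed.

Lemma block_split w : size w = m -> exists p e q,
  [/\ idem_word e, {subset p ++ e ++ q <= w} & ev id w = ev id (p ++ e ++ q)].
Proof.
move=> /(long_word #|M|) [w' [w'w /idem_factor [p [e [q [ie sub E]]]] Ew]].
exists p, e, q; split=> //; last by rewrite -Ew.
by move=> a /sub /w'w.
Qed.

(** Elements of lower J-classes have more divisors, so the size of this set measures how
    low [f] is. *)
Definition divisors_of (f : M) := [set x : M | `[< divides x f >]].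

Definition all_divide u (f : M) := forall a, a \in u -> divides (inj1 a) f.

Lemma split_suffix p (f : M) : exists p0 p1, [/\ p = p0 ++ p1, all_divide p1 f &
  p0 = [::] \/ exists p0' a, p0 = rcons p0' a /\ ~ divides (inj1 a) f].
Proof.
elim/last_ind: p => [|p a [p0 [p1 [E d1 H]]]]; first by exists [::], [::]; split=> //; left.
case: (pselect (divides (inj1 a) f)) => [af|naf]; last first.
  by exists (rcons p a), [::]; rewrite cats0; split=> //; right; exists p, a.
exists p0, (rcons p1 a); rewrite E rcons_cat; split=> // b.
by rewrite mem_rcons inE => /orP [/eqP -> //|/d1].
Qed.

Lemma split_prefix q (f : M) : exists q1 q0, [/\ q = q1 ++ q0, all_divide q1 f &
  q0 = [::] \/ exists q0' a, q0 = a :: q0' /\ ~ divides (inj1 a) f].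
Proof.
elim: q => [|a q [q1 [q0 [E d1 H]]]]; first by exists [::], [::]; split=> //; left.
case: (pselect (divides (inj1 a) f)) => [af|naf]; last first.
  by exists [::], (a :: q); split=> //; right; exists q, a.
exists (a :: q1), q0; rewrite E; split=> // b.
by rewrite inE => /orP [/eqP -> //|/d1].
Qed.

Lemma divisors_proper (f h : M) x : divides f h -> divides x h -> ~ divides x f ->
  (#|divisors_of f| < #|divisors_of h|)%N.
Proof.
move=> fh xh nxf; apply: proper_card; apply/properP; split.
  by apply/fintype.subsetP => y; rewrite !finset.in_set => /asboolP yf; apply/asboolP; apply: divides_trans yf fh.
by exists x; rewrite finset.in_set; apply/asboolP.
Qed.

(** The idempotent factor is chosen with as many divisors as possible.  If the part of
    the word up to the last letter not dividing it were longer than [m], its first [m]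
    letters would contain an idempotent [e'], and the product [H] from [e'] up to [e]
    would be a group element divisible by [e] and by that letter. *)
Lemma outer_decomposition (A : seq S) p e q : idem_word e -> {subset p ++ e ++ q <= A} ->
  exists p0 p1 f q1 q0, [/\ idem_word f, {subset p0 ++ p1 ++ f ++ q1 ++ q0 <= A},
    all_divide (p1 ++ q1) (ev id f), (size p0 <= m)%N /\ (size q0 <= m)%N &
    ev id (p ++ e ++ q) = ev id (p0 ++ p1 ++ f ++ q1 ++ q0)].
Proof.
have [k] := ubnP (#|M| - #|divisors_of (ev id e)|); elim: k p e q => // k IH p e q kb ie sub.
have [p0 [p1 [Ep d1 Hp]]] := split_suffix p (ev id e).
have [q1 [q0 [Eq d2 Hq]]] := split_prefix q (ev id e).
have bound (f h : M) : (#|divisors_of f| < #|divisors_of h|)%N ->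
    (#|M| - #|divisors_of h| < #|M| - #|divisors_of f|)%N.
  by move=> fh; apply: ltn_sub2l (fh); apply: leq_trans fh (max_card _).
have [e1 ee] := (idem_word_neq1 ie, proj2 ie).
have [p0m|p0m] := leqP (size p0) m; last first.
  case: Hp => [p00|[p0' [a [p0E na]]]]; first by rewrite p00 in p0m.
  have mp0' : (m <= size p0')%N by move: p0m; rewrite p0E size_rcons.
  have [p' [e' [q' [ie' sub' E']]]] := block_split (size_takel mp0').
  pose H := e' ++ q' ++ drop m p0' ++ a :: p1 ++ e.
  have HN : H <> [::] by rewrite /H; case: (e') ie' => // -[].
  have group : om (ev id H) * ev id H = ev id H.
    apply: (hF (e := ev id e') (f := ev id e)) => //; try exact: idem_word_neq1.
    - by case: ie'.
    - by rewrite /H ev_cat mulgA (proj2 ie').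
    - by rewrite /H !(ev_cat, ev_cons) -!mulgA ee.
  have Esame : ev id (p ++ e ++ q) = ev id ((p' ++ H) ++ flatten (nseq (wexp S) H) ++ q).
    rewrite [in RHS]ev_cat (ev_cat _ p') [in RHS]ev_cat ev_flatten_nseq -/(om _).
    rewrite !mulgA -(mulgA (ev id p')) -om_comm group.
    rewrite Ep p0E -(cat_take_drop m p0') cat_rcons /H !(ev_cat, ev_cons) E' !ev_cat !mulgA.
    by [].
  have subH : {subset (p' ++ H) ++ flatten (nseq (wexp S) H) ++ q <= A}.
    have H1 : {subset p' ++ H <= A}.
      move=> b bH; apply: sub; rewrite mem_cat Ep p0E.
      have : b \in (p' ++ e' ++ q') ++ drop m p0' ++ a :: p1 ++ e.
        by move: bH; rewrite /H -!catA.
      rewrite mem_cat => /orP [/sub' /mem_take bp|].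
        by rewrite mem_cat mem_rcons inE bp orbT.
      rewrite mem_cat => /orP [/mem_drop bp|]; first by rewrite mem_cat mem_rcons inE bp orbT.
      by rewrite inE !mem_cat mem_rcons inE => /or3P [->|->|->]; rewrite ?orbT.
    move=> b; rewrite mem_cat => /orP [/H1 //|]; rewrite mem_cat => /orP [|bq].
      by move/subset_flatten_nseq => bH; apply: H1; rewrite mem_cat bH orbT.
    by apply: sub; rewrite !mem_cat bq !orbT.
  have [|f0 [f1 [f [g1 [g0 [? ? ? ? E2]]]]]] := IH (p' ++ H) (flatten (nseq (wexp S) H)) q _ (om_word HN) subH.
    apply: leq_trans (bound _ _ _) kb.
    rewrite ev_flatten_nseq -/(om _); apply: (divisors_proper (x := inj1 a)) => //.
      apply: divides_trans (divides_om _).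
      by rewrite /H !(ev_cat, ev_cons) !mulgA; apply: divides_mull.
    apply: divides_trans (divides_om _).
    by apply: divides_ev; rewrite /H !(mem_cat, inE) eqxx !orbT.
  by exists f0, f1, f, g1, g0; split=> //; rewrite Esame.
have [q0m|q0m] := leqP (size q0) m; last first.
  case: Hq => [q00|[q0' [a [q0E na]]]]; first by rewrite q00 in q0m.
  have mq0' : (m <= size q0')%N by move: q0m; rewrite q0E.
  have sz : size (drop (size q0' - m) q0') = m by rewrite size_drop subKn.
  have [p' [e' [q' [ie' sub' E']]]] := block_split sz.
  pose H := e ++ q1 ++ a :: take (size q0' - m) q0' ++ p' ++ e'.
  have HN : H <> [::] by rewrite /H; case: (e) ie => // -[].
  have group : om (ev id H) * ev id H = ev id H.
    apply: (hF (e := ev id e) (f := ev id e')) => //; try exact: idem_word_neq1.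
    - by case: ie'.
    - by rewrite /H ev_cat mulgA ee.
    - by rewrite /H !(ev_cat, ev_cons) -!mulgA (proj2 ie').
  have Esame : ev id (p ++ e ++ q) = ev id (p ++ flatten (nseq (wexp S) H) ++ (H ++ q')).
    rewrite [in RHS]ev_cat (ev_cat _ (flatten _)) (ev_cat _ H) ev_flatten_nseq -/(om _).
    rewrite (mulgA (om _)) group.
    rewrite Eq q0E -{1}(cat_take_drop (size q0' - m) q0') /H !(ev_cat, ev_cons) E' !ev_cat !mulgA.
    by [].
  have subH : {subset p ++ flatten (nseq (wexp S) H) ++ (H ++ q') <= A}.
    have H1 : {subset H ++ q' <= A}.
      move=> b bH; apply: sub; rewrite mem_cat Eq q0E.
      have : b \in (e ++ q1 ++ [:: a] ++ take (size q0' - m) q0') ++ (p' ++ e' ++ q').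
        by move: bH; rewrite /H -cat1s -!catA.
      rewrite mem_cat => /orP [|/sub' /mem_drop bp]; last first.
        by rewrite !mem_cat inE bp !orbT.
      rewrite !mem_cat !inE => /or4P [->|->|->|/mem_take ->]; by rewrite ?orbT.
    move=> b; rewrite mem_cat => /orP [bp|]; first by apply: sub; rewrite mem_cat bp.
    rewrite mem_cat => /orP [|/H1 //].
    by move/subset_flatten_nseq => bH; apply: H1; rewrite mem_cat bH.
  have [|f0 [f1 [f [g1 [g0 [? ? ? ? E2]]]]]] := IH p (flatten (nseq (wexp S) H)) (H ++ q') _ (om_word HN) subH.
    apply: leq_trans (bound _ _ _) kb.
    rewrite ev_flatten_nseq -/(om _); apply: (divisors_proper (x := inj1 a)) => //.
      apply: divides_trans (divides_om _).
      by rewrite /H ev_cat; apply: divides_mulr.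
    apply: divides_trans (divides_om _).
    by apply: divides_ev; rewrite /H !(mem_cat, inE) eqxx !orbT.
  by exists f0, f1, f, g1, g0; split=> //; rewrite Esame.
have pq : p0 ++ p1 ++ e ++ q1 ++ q0 = p ++ e ++ q by rewrite Ep Eq -!catA.
exists p0, p1, e, q1, q0; rewrite pq; split=> //.
by move=> a; rewrite mem_cat => /orP [/d1|/d2].
Qed.

End WordDecomposition.

(** * Long products as group elements between short words *)

Section ShortForm.
Variables (S : finSemigroupType) (m : nat).
Local Open Scope group_scope.
Notation M := (adjone S).
Implicit Types p q e w u L : seq S.
Hypothesis hF : forall x e f : M, e != 1 -> f != 1 ->
  e * e = e -> f * f = f -> e * x = x -> x * f = x -> om x * x = x.
Hypothesis hR : forall e a b : M, e != 1 -> e * e = e ->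
  e * a = a -> a * e = a -> e * b = b -> b * e = b -> a * b = b -> b * a = a -> a = b.
Hypothesis hL : forall e a b : M, e != 1 -> e * e = e ->
  e * a = a -> a * e = a -> e * b = b -> b * e = b -> a * b = a -> b * a = b -> a = b.
Hypothesis m0 : (0 < m)%N.
Hypothesis hlen : forall w, size w = m ->
  exists w', [/\ {subset w' <= w}, (m < size w')%N & ev id w' = ev id w].

Definition set_idem (A : {set S}) : M := om (ev id (enum A)).

Lemma set_idem_neq1 (A : {set S}) a : a \in A -> set_idem A != 1.
Proof.
move=> aA; apply: om_neq1; rewrite ev_eq1.
by apply: contraL aA => /nilP E; rewrite -mem_enum E.
Qed.

Lemma divides_set_idem (A : {set S}) a : a \in A -> divides (inj1 a) (set_idem A).
Proof.
by move=> aA; apply: divides_trans (divides_om _); apply: divides_ev; rewrite mem_enum.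
Qed.

Lemma set_idem_divides (A : {set S}) f : f != 1 -> f * f = f ->
  (forall a, a \in A -> divides (inj1 a) f) -> divides (set_idem A) f.
Proof.
move=> f1 ff H; apply: dividesX => //; apply: ev_divides => // a.
by rewrite mem_enum; apply: H.
Qed.

(** In an irredundant set of letters, distinct subsets have distinct idempotents. *)
Lemma small_support L : L <> [::] -> exists U : seq S,
  [/\ {subset U <= L}, U <> [::], (2 ^ size U <= #|M|)%N & all_divide L (om (ev id U))].
Proof.
move=> L0; pose P (U : {set S}) := `[< all_divide L (set_idem U) >].
have PL : P [set a in L].
  by apply/asboolP => a aL; apply: divides_set_idem; rewrite finset.in_set.
have [U /minsetP [PU Umin] UL] := minset_exists PL.
have sub_inj (A B : {set S}) : A \subset U -> B \subset U ->
    set_idem A = set_idem B -> A \subset B.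
  move=> AU BU E; apply/fintype.subsetP => a aA; apply/negPn/negP => aB.
  have aI : divides (inj1 a) (set_idem B) by rewrite -E; apply: divides_set_idem.
  pose W := (U :\ a)%SET.
  have BW : B \subset W.
    apply/fintype.subsetP => b bB; rewrite finset.in_setD1 (fintype.subsetP BU) // andbT.
    by apply: contraNneq aB => <-.
  have [b bW] : exists b, b \in W.
    apply/finset.set0Pn; apply/negP => /eqP W0.
    have B0 : B = finset.set0 by apply/eqP; rewrite -finset.subset0 -W0.
    have := divides1 aI; rewrite B0 /set_idem enum_set0 ev_nil => /(_ (om_id (mulg1 _))).
    by [].
  have W1 := set_idem_neq1 bW; have WW : set_idem W * set_idem W = set_idem W by apply: om_idem.
  have aW : divides (inj1 a) (set_idem W).
    apply: divides_trans aI _; apply: set_idem_divides => // c cB.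
    by apply: divides_set_idem; apply: (fintype.subsetP BW).
  have UW : divides (set_idem U) (set_idem W).
    apply: set_idem_divides => // c cU; have [->//|ca] := eqVneq c a.
    by apply: divides_set_idem; rewrite finset.in_setD1 ca.
  have PW : P W.
    by apply/asboolP => c cL; apply: divides_trans UW; move/asboolP: PU; apply.
  have /setP /(_ a) := Umin _ PW (subsetDl _ _).
  by rewrite finset.in_setD1 eqxx (fintype.subsetP AU).
exists (enum U); split.
- by move=> a; rewrite mem_enum => /(fintype.subsetP UL); rewrite finset.in_set.
- move=> U0; have [a aL] : exists a, a \in L by case: (L) L0 => // a L' _; exists a; apply: mem_head.
  move/asboolP: PU => /(_ a aL) /divides1; rewrite /set_idem U0 ev_nil.
  by move=> /(_ (om_id (mulg1 _))).
- rewrite -cardE -card_powerset.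
  rewrite -(card_in_imset (f := set_idem)); first exact: max_card.
  move=> A B; rewrite !powersetE => AU BU E.
  by apply/eqP; rewrite finset.eqEsubset; apply/andP; split; apply: sub_inj.
- exact/asboolP.
Qed.

Definition short_form (A : seq S) (t : M) := exists U L p q k x,
  [/\ {subset U ++ L ++ p ++ q <= A}, U <> [::], (2 ^ size U <= #|M|)%N,
      (1 < k <= 2 * #|M|)%N & (size p <= 2 * m)%N /\ (size q <= 2 * m)%N] /\
  [/\ ev id U ^+ k * ev id U ^+ k = ev id U ^+ k, all_divide L (ev id U ^+ k),
      generated (sandwich (ev id U ^+ k) L m) x & t = ev id p * x * ev id q].

(** In the outer decomposition [p0 * p1 * f * q1 * q0], let [L] be the letters of the
    middle part, which all divide [f].  As [f] and [g] divide each other, [g] can be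
    inserted into [f]; repeating [f] makes both sides long enough. *)
Lemma short_form_exists w : (m <= size w)%N -> short_form w (ev id w).
Proof.
move=> mw; have [p [e [q [ie sub E]]]] := block_split hlen (size_takel mw).
have sub' : {subset p ++ e ++ (q ++ drop m w) <= w}.
  move=> a; rewrite !catA mem_cat -catA => /orP [/sub /mem_take //|/mem_drop //].
have [p0 [p1 [f [q1 [q0 [jf subf df [p0m q0m] Ef]]]]]] := outer_decomposition hF hlen ie sub'.
have wE : ev id w = ev id (p0 ++ p1 ++ f ++ q1 ++ q0).
  by rewrite -Ef -{1}(cat_take_drop m w) !ev_cat E !ev_cat !mulgA.
pose L := p1 ++ f ++ q1.
have L0 : L <> [::] by move/(congr1 size); rewrite !size_cat; case: (f) (proj1 jf) => //=; lia.
have [f1 ff] := (idem_word_neq1 jf, proj2 jf).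
have Lf : all_divide L (ev id f).
  move=> a; rewrite mem_cat => /orP [ap|]; first by apply: df; rewrite mem_cat ap.
  rewrite mem_cat => /orP [/divides_ev //|aq]; by apply: df; rewrite mem_cat aq orbT.
have [U [UL U0 Ucard LU]] := small_support L0.
have [k kM gE] := om_exp (ev id U); set g := om _ in LU gE.
have g1 : g != 1 by apply: om_neq1; rewrite ev_eq1; case: (U) U0.
have gg : g * g = g by apply: om_idem.
have gf : divides g (ev id f).
  by apply: dividesX => //; apply: ev_divides => // a /UL /Lf.
have Hn b : all (mem L) b -> size b = m -> blocklike (ev id b).
  move=> _ /(block_split hlen) [x [y [z [iy _ ->]]]].
  exists (ev id x), (ev id y), (ev id z); rewrite !ev_cat mulgA.
  by split=> //; [exact: idem_word_neq1 | case: iy].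
pose gw := flatten (nseq (wexp S) U).
pose fm := flatten (nseq m f).
have gwE : ev id gw = g by rewrite ev_flatten_nseq.
have fmE : ev id fm = ev id f by rewrite ev_flatten_nseq idem_exp.
have fms : (m <= size fm)%N.
  rewrite /fm size_flatten /shape map_nseq sumn_nseq.
  by case: (f) (proj1 jf) => // a f' _; rewrite /= mulSn leq_addr.
have allL u : {subset u <= L} -> all (mem L) u by move=> H; apply/allP.
have subf' : {subset f <= L} by move=> a af; rewrite /L !mem_cat af orbT.
have subfm : {subset fm <= L} by move=> a /subset_flatten_nseq /subf'.
pose core := f ++ gw ++ f.
pose y1 := p1 ++ fm; pose y2 := f ++ flatten (nseq (wexp S).-1 core) ++ fm ++ q1.
have subgw : {subset gw <= L} by move=> a /subset_flatten_nseq /UL.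
have suby1 : {subset y1 <= L}.
  by move=> a; rewrite mem_cat => /orP [ap|/subfm //]; rewrite /L mem_cat ap.
have suby2 : {subset y2 <= L}.
  move=> a; rewrite mem_cat => /orP [/subf' //|]; rewrite mem_cat => /orP [|].
    move/subset_flatten_nseq; rewrite mem_cat => /orP [/subf' //|].
    by rewrite mem_cat => /orP [/subgw|/subf'].
  rewrite mem_cat => /orP [/subfm //|aq]; by rewrite /L !mem_cat aq !orbT.
have coreE : ev id p1 * ev id f * ev id q1 = ev id y1 * g * ev id y2.
  have H : ev id f = ev id f * g * ev id f * omV (ev id f * g * ev id f).
    by rewrite -[in LHS](om_gbg hF f1 ff gf) -omVr.
  rewrite /y1 /y2 !ev_cat fmE ev_flatten_nseq /core !ev_cat gwE.
  rewrite (mulgA (ev id f) g) -/(omV _).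
  have H2 : ev id f = ev id f * g * ev id f * omV (ev id f * g * ev id f) * ev id f.
    by rewrite -H ff.
  by rewrite {1}H2 !mulgA.
have n1 : (m <= size y1)%N by rewrite size_cat; lia.
have n2 : (m <= size y2)%N by rewrite !size_cat; lia.
have [b1 [b2 [x [Lb1 Lb2 s1 s2 [gx xE]]]]] :=
  through_group hF hR hL g1 gg LU Hn (allL _ suby1) (allL _ suby2) n1 n2.
exists U, L, (p0 ++ b1), (b2 ++ q0), k, x; rewrite -gE; split; split=> //.
- move=> a; rewrite !mem_cat => H; apply: subf; rewrite !mem_cat.
  have toL : a \in L -> [|| a \in p0, a \in p1, a \in f, a \in q1 | a \in q0].
    by rewrite /L !mem_cat => /or3P [] ->; rewrite ?orbT.
  case/or4P: H => [/UL/toL //|||].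
  + by move=> H; apply: toL; rewrite /L !mem_cat.
  + by case/orP=> [->//|/(allP Lb1)/toL].
  + by case/orP=> [/(allP Lb2)/toL //|->]; rewrite !orbT.
- by rewrite !size_cat s1 s2; lia.
- rewrite wE !ev_cat.
  have := congr1 (fun t => ev id p0 * t * ev id q0) xE; rewrite -coreE !mulgA.
  by [].
Qed.

End ShortForm.

(** * Permutation identities *)

Lemma uniq_two (i j : nat) A Z B : uniq (A ++ i :: Z ++ j :: B) ->
  [/\ i \notin A, i \notin Z & i \notin B] /\ [/\ j \notin A, j \notin Z & j \notin B].
Proof.
have -> : uniq (A ++ i :: Z ++ j :: B) = uniq (i :: j :: A ++ Z ++ B).
  by apply: perm_uniq; apply/permP => a; rewrite /= !count_cat /= !count_cat /=; lia.
by rewrite /= inE !mem_cat !negb_or => /and3P [/and4P [_ -> -> ->] /and3P [-> -> ->] _].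
Qed.

Section Permutation.
Variables (N : nat) (w : seq nat).
Hypotheses (wN : perm_eq w (iota 0 N)) (wi : w <> iota 0 N).

Lemma mem_perm_iota i : (i \in w) = (i < N)%N.
Proof. by rewrite (perm_mem wN) mem_iota. Qed.

Lemma uniq_perm_iota : uniq w.
Proof. by rewrite (perm_uniq wN) iota_uniq. Qed.

Lemma size_perm_iota : size w = N.
Proof. by rewrite (perm_size wN) size_iota. Qed.

Lemma non_adjacent : exists2 i, (i.+1 < N)%N & index i.+1 w <> (index i w).+1.
Proof.
apply: contrapT => H; apply: wi.
have idx i : (i < N)%N -> index i w = (index 0 w + i)%N.
  elim: i => [|i IH] iN; first by rewrite addn0.
  rewrite addnS -IH; last exact: ltnW.
  by apply: contrapT => ne; apply: H; exists i.
have i0 : (0 < N)%N -> index 0 w = 0%N.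
  move=> N0; have := idx N.-1; rewrite ltn_predL N0 => /(_ isT).
  have : (index N.-1 w < N)%N by rewrite -{2}size_perm_iota index_mem mem_perm_iota prednK.
  lia.
apply: (@eq_from_nth _ 0%N); rewrite ?size_iota size_perm_iota // => i iN.
rewrite nth_iota // add0n; have := idx i iN; rewrite i0 ?add0n; last exact: leq_ltn_trans iN.
by move=> {1}<-; rewrite nth_index // mem_perm_iota.
Qed.

(** Let [i] and [i.+1] be letters that are not adjacent in [w].  A further letter
    between them in [iota 0 N] may be joined to either; in [w] it then occurs in two
    different places. *)
Lemma moving_factor (S : finSemigroupType) :
  (forall s : nat -> S, ev s w = ev s (iota 0 N)) ->
  exists A Z B, [/\ w = A ++ Z ++ B, Z <> [::] &
    forall (s : nat -> S) y, (ev s A * inj1 y * ev s Z * ev s B =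
                              ev s A * ev s Z * inj1 y * ev s B)%g].
Proof.
move=> H; have [i iN ne] := non_adjacent; set j := i.+1 in iN ne.
have iw : i \in w by rewrite mem_perm_iota ltnW.
have jw : j \in w by rewrite mem_perm_iota.
have uw := uniq_perm_iota.
pose s1 (s : nat -> S) y k := if k == i then (s i * y)%g else s k.
pose s2 (s : nat -> S) y k := if k == j then (y * s j)%g else s k.
have out1 s y u : i \notin u -> ev (s1 s y) u = ev s u.
  by move=> iu; apply: eq_in_ev => k ku; rewrite /s1; case: eqP => // ki; rewrite ki (negbTE iu) in ku.
have out2 s y u : j \notin u -> ev (s2 s y) u = ev s u.
  by move=> ju; apply: eq_in_ev => k ku; rewrite /s2; case: eqP => // kj; rewrite kj (negbTE ju) in ku.
have s1i s y : s1 s y i = (s i * y)%g by rewrite /s1 eqxx.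
have s2j s y : s2 s y j = (y * s j)%g by rewrite /s2 eqxx.
have s1j s y : s1 s y j = s j by rewrite /s1 /j; case: eqP => //; lia.
have s2i s y : s2 s y i = s i by rewrite /s2 /j; case: eqP => //; lia.
have E s y : ev (s1 s y) w = ev (s2 s y) w.
  rewrite !H (_ : N = i + (1 + (1 + (N - i.+2))))%N; last by rewrite /j in iN; lia.
  rewrite iotaD ev_cat ev_cat add0n /= !ev_cons s1i s2j s1j s2i !(out1, out2) ?mem_iota; try by rewrite /j; lia.
  by rewrite !inj1M !mulgA.
have [[A [Z [B wE]]]|[A [Z [B wE]]]] : (exists A Z B, w = A ++ i :: Z ++ j :: B) \/
    (exists A Z B, w = A ++ j :: Z ++ i :: B).
  case/splitPr: iw jw {uw H ne E} => A B.
  rewrite mem_cat inE => /or3P [|/eqP|].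
  - by case/splitPr => A1 A2; right; exists A1, A2, B; rewrite -catA.
  - by rewrite /j; lia.
  - by case/splitPr => B1 B2; left; exists A, B1, B2.
- have := uw; rewrite wE => /uniq_two [[iA iZ iB] [jA jZ jB]].
  exists (A ++ [:: i]), Z, (j :: B); split; first by rewrite -catA.
    move=> Z0; apply: ne; rewrite wE Z0 /= !index_cat (negbTE iA) (negbTE jA) /= !eqxx.
    by case: eqP => [|_]; rewrite ?addn1 ?addn0 // /j; lia.
  move=> s y; have := E s y.
  rewrite wE !(ev_cat, ev_cons) ev_nil s1i s2j s1j s2i !out1 // !out2 // !inj1M mulg1.
  by rewrite !mulgA.
- have := uw; rewrite wE => /uniq_two [[jA jZ jB] [iA iZ iB]].
  exists A, (j :: rcons Z i), B; split=> //; first by rewrite /= cat_rcons.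
  move=> s y; have := E s y.
  rewrite wE !(ev_cat, ev_cons, ev_rcons) s1i s2j s1j s2i !out1 // !out2 // !inj1M.
  by rewrite !mulgA.
Qed.

End Permutation.

Section Commutation.
Variable S : finSemigroupType.
Local Open Scope group_scope.
Implicit Types a b c u v z : seq S.

Lemma word_as_tuple (A Z B : seq nat) (a z b : seq S) :
  uniq (A ++ Z ++ B) -> size a = size A -> size z = size Z -> size b = size B -> S ->
  exists s : nat -> S, [/\ ev s A = ev id a, ev s Z = ev id z & ev s B = ev id b].
Proof.
move=> U sa sz sb x0; pose s k := nth x0 (a ++ z ++ b) (index k (A ++ Z ++ B)).
have sE : map s (A ++ Z ++ B) = a ++ z ++ b.
  apply: (@eq_from_nth _ x0); first by rewrite size_map !size_cat sa sz sb.
  move=> i; rewrite size_map => iw.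
  by rewrite (nth_map 0%N) // /s index_uniq.
exists s; move/eqP: sE; rewrite !map_cat eqseq_cat ?size_map // eqseq_cat ?size_map //.
by case/and3P => /eqP <- /eqP <- /eqP <-; rewrite !ev_id_map.
Qed.

Lemma ev_as_one z : z <> [::] -> exists x : S, ev id z = inj1 x.
Proof. by move=> z0; apply: adjone_neq1; rewrite ev_eq1; case: z z0. Qed.

Variables (N : nat) (w : seq nat).
Hypotheses (wN : perm_eq w (iota 0 N)) (wi : w <> iota 0 N).
Hypothesis hw : forall s : nat -> S, ev s w = ev s (iota 0 N).

(** Inside long contexts a factor [x] may be moved across any long [z]; moving it
    to the right across [y * c] and back to the left across [c] exchanges [x] and [y]. *)
Lemma commute_in_context u v (x y : S) : (N <= size u)%N -> (N <= size v)%N ->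
  ev id (u ++ x :: y :: v) = ev id (u ++ y :: x :: v).
Proof.
move=> Nu Nv; have [A [Z [B [wE Z0 mvZ]]]] := moving_factor wN wi hw.
have sw : (size A + size Z + size B = N)%N by rewrite -(size_perm_iota wN) wE !size_cat; lia.
have mv a z b (t : S) : (size A <= size a)%N -> (size Z <= size z)%N -> (size B <= size b)%N ->
    ev id (a ++ t :: z ++ b) = ev id (a ++ z ++ t :: b).
  move=> Aa Zz Bb.
  have sZ0 : (0 < size Z)%N by case: (Z) Z0.
  pose z1 := take (size Z).-1 z; pose z2 := drop (size Z).-1 z.
  have sz1 : size z1 = (size Z).-1 by rewrite size_take_min; lia.
  have z20 : z2 <> [::] by move/(congr1 size); rewrite size_drop /=; lia.
  have [r rE] := ev_as_one z20.
  pose a1 := take (size a - size A) a; pose a2 := drop (size a - size A) a.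
  pose b1 := take (size B) b; pose b2 := drop (size B) b.
  have U : uniq (A ++ Z ++ B) by rewrite -wE (uniq_perm_iota wN).
  have [|||s [sA sZ sB]] := @word_as_tuple A Z B a2 (rcons z1 r) b1 U _ _ _ t.
  - by rewrite size_drop subKn.
  - by rewrite size_rcons sz1 prednK.
  - by rewrite size_take_min; lia.
  have zE : ev id z = ev id (rcons z1 r).
    by rewrite ev_rcons -rE -ev_cat cat_take_drop.
  have := mvZ s t; rewrite sA sZ sB => E.
  have := congr1 (fun m => ev id a1 * m * ev id b2) E.
  have aE : ev id a = ev id a1 * ev id a2 by rewrite -ev_cat cat_take_drop.
  have bE : ev id b = ev id b1 * ev id b2 by rewrite -ev_cat cat_take_drop.
  by rewrite !(ev_cat, ev_cons) aE bE zE !mulgA.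
pose c := take (size Z) v; pose b := drop (size Z) v.
have vE : v = c ++ b by rewrite cat_take_drop.
have sc : size c = size Z by rewrite size_take_min; lia.
have sb : (size B <= size b)%N by rewrite size_drop; lia.
rewrite vE -[x :: y :: c ++ b]/(x :: (y :: c) ++ b) mv ?sc //=; try lia.
rewrite -[u ++ y :: c ++ _](cat_rcons y) -mv ?sc ?size_rcons ?cat_rcons //; lia.
Qed.

Lemma perm_in_context u v z z' : (N <= size u)%N -> (N <= size v)%N -> perm_eq z z' ->
  ev id (u ++ z ++ v) = ev id (u ++ z' ++ v).
Proof.
move=> Nu Nv; elim: z z' u Nu => [|x z IH] z' u Nu pz.
  by move: pz; rewrite perm_sym => /perm_nilP ->.
have xz' : x \in z' by rewrite -(perm_mem pz) mem_head.
case/splitPr: xz' pz => z1 z2; rewrite perm_sym perm_catC /= perm_cons perm_catC => pz.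
have front : ev id (u ++ (z1 ++ x :: z2) ++ v) = ev id (u ++ x :: (z1 ++ z2) ++ v).
  elim/last_ind: z1 {pz} z2 => [|z1 y IHz] z2 //.
  rewrite !cat_rcons -(IHz (y :: z2)).
  by have := @commute_in_context (u ++ z1) (z2 ++ v) y x; rewrite -!catA; apply; rewrite size_cat; lia.
rewrite front -!cat_rcons -(IH (z1 ++ z2)) ?size_rcons ?cat_rcons //; first by lia.
by rewrite perm_sym.
Qed.

End Commutation.

(** * Short products of commuting generators *)

Lemma base_digits B k (f f' : nat -> nat) : (forall i, f i < B) -> (forall i, f' i < B) ->
  \sum_(i < k) f i * B ^ i = \sum_(i < k) f' i * B ^ i -> forall i, i < k -> f i = f' i.
Proof.
elim: k f f' => // k IH f f' fB f'B.
have B0 : 0 < B by apply: leq_ltn_trans (fB 0).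
have E (h : nat -> nat) : \sum_(i < k.+1) h i * B ^ i = h 0 + B * \sum_(i < k) h i.+1 * B ^ i.
  rewrite big_ord_recl muln1; congr (_ + _); rewrite big_distrr /=.
  by apply: eq_bigr => i _; rewrite /bump /= add1n expnS; lia.
rewrite !E => H.
have H0 : f 0 = f' 0.
  by have := congr1 (modn^~ B) H; rewrite /= ![_ + B * _]addnC ![B * _]mulnC !modnMDl !modn_small.
case=> [//|i] ik; apply: (IH (f \o succn) (f' \o succn)) => //=.
move: H; rewrite H0 => /addnI /eqP; rewrite eqn_mul2l => /orP [|/eqP //].
by rewrite eqn0Ngt B0.
Qed.

Section CommutativeForm.
Variable S : finSemigroupType.
Local Open Scope group_scope.
Notation M := (adjone S).
Implicit Types u v z l : seq S.

Definition power_word (f : S -> nat) l := flatten [seq nseq (f y) y | y <- l].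

Lemma count_power_word f l x : uniq l ->
  count_mem x (power_word f l) = if x \in l then f x else 0%N.
Proof.
elim: l => //= y l IH /andP [yl ul]; rewrite /power_word /= count_cat count_nseq /= IH // inE eq_sym.
by have [<-|_] := eqVneq y x; rewrite ?(negbTE yl) ?addn0 ?mul1n // mul0n.
Qed.

Lemma mem_power_word f l x : x \in power_word f l -> (x \in l) && (0 < f x)%N.
Proof. by case/flatten_mapP => y yl; rewrite mem_nseq => /andP [f0 /eqP ->]; rewrite yl. Qed.

Lemma card_bounded_ord n c : (c <= n)%N -> (c.+1 <= #|[pred i : 'I_n.+1 | (i <= c)%N]|)%N.
Proof.
move=> cn; have cn' : (c.+1 <= n.+1)%N by [].
have inj : injective (widen_ord cn') by move=> i j /(congr1 val) ij; apply: val_inj.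
rewrite -[leqLHS]card_ord -(card_imset predT inj).
apply: subset_leq_card; apply/fintype.subsetP => i /imsetP [j _ ->].
by rewrite inE /= -ltnS.
Qed.

(** Among all words [z] giving the same value in the context [u, v], one of
    minimal length, and among these one of minimal weight for weights that tell
    all multisets of that size apart, has only distinct sub-multisets: a coincidence
    [u * f = u * f'] would allow exchanging [f] and [f'] inside [z]. *)
Lemma minimal_multiset u v z0 :
  (forall z z', perm_eq z z' -> ev id (u ++ z ++ v) = ev id (u ++ z' ++ v)) ->
  exists z, [/\ {subset z <= z0}, ev id (u ++ z ++ v) = ev id (u ++ z0 ++ v) &
    (\prod_(x : S) (count_mem x z).+1 <= #|M|)%N].
Proof.
move=> comm; pose t := ev id (u ++ z0 ++ v).
pose P z := `[< {subset z <= z0} >] && (ev id (u ++ z ++ v) == t).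
have Pz0 : P z0 by rewrite /P eqxx andbT; apply/asboolP.
have [k [[z1 Pz1 sz1] kmin]] : exists k, (exists2 z, P z & size z = k) /\
    forall z, P z -> (k <= size z)%N.
  pose Q k := `[< exists2 z, P z & size z = k >].
  have exQ : exists k, Q k by exists (size z0); apply/asboolP; exists z0.
  exists (ex_minn exQ); case: ex_minnP => k /asboolP Qk kmin; split=> // z Pz.
  by apply: kmin; apply/asboolP; exists z.
(* multiplicities are at most [k], so [wt] reads them as digits in base [k + 1] *)
pose B := k.+1.
pose wt z := (\sum_(i < #|S|) count_mem (enum_val i) z * B ^ i)%N.
have [z [Pz sz wmin]] : exists z, [/\ P z, size z = k &
    forall z', P z' -> size z' = k -> (wt z <= wt z')%N].
  pose Q m := `[< exists z, [/\ P z, size z = k & wt z = m] >].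
  have exQ : exists m, Q m by exists (wt z1); apply/asboolP; exists z1.
  case: (ex_minnP exQ) => m /asboolP [z [Pz sz <-]] mmin; exists z; split=> // z' Pz' sz'.
  by apply: mmin; apply/asboolP; exists z'.
have /andP [/asboolP zsub /eqP zt] := Pz.
exists z; split=> //.
pose e x := count_mem x z.
have ek x : (e x <= k)%N by rewrite -sz count_size.
pose F (x : S) := [pred i : 'I_k.+1 | (i <= e x)%N].
pose wf (f : S -> nat) := power_word f (enum S).
have cwf f x : count_mem x (wf f) = f x by rewrite count_power_word ?enum_uniq // mem_enum.
pose val_of (f : {ffun S -> 'I_k.+1}) := ev id (u ++ wf (fun x => f x : nat)).
have exch (f f' : {ffun S -> 'I_k.+1}) : f \in family F -> f' \in family F ->
    val_of f = val_of f' ->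
    let z' := wf (fun x => f' x : nat) ++ wf (fun x => e x - f x)%N in
    perm_eq z (wf (fun x => f x : nat) ++ wf (fun x => e x - f x)%N) /\ P z'.
  move=> /familyP fF /familyP f'F E z'.
  have pz : perm_eq z (wf (fun x => f x : nat) ++ wf (fun x => e x - f x)%N).
    apply/allP => x _ /=; rewrite count_cat !cwf -/(e x); apply/eqP.
    by rewrite subnKC // ; exact: (fF x).
  split=> //; apply/andP; split.
    apply/asboolP => x; rewrite mem_cat => xz; apply: zsub; rewrite -has_pred1 has_count -/(e x).
    case/orP: xz => /mem_power_word /andP [_]; last by lia.
    by move=> /leq_trans -> //; exact: (f'F x).
  rewrite -zt (comm _ _ pz) /z' -!catA !(catA u) !(ev_cat _ (u ++ _)).
  by rewrite -[ev id (u ++ wf (fun x => f' x : nat))]/(val_of f') -E.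
have inj : {in family F &, injective val_of}.
  move=> f f' fF f'F E.
  have [p1 P1] := exch f f' fF f'F E; have [p2 P2] := exch f' f f'F fF (esym E).
  have s1 := perm_size p1; have s2 := perm_size p2.
  rewrite sz !size_cat in s1 s2.
  have k1 := kmin _ P1; have k2 := kmin _ P2; rewrite !size_cat in k1 k2.
  have w1 := wmin _ P1; have w2 := wmin _ P2; rewrite !size_cat in w1 w2.
  have {}w1 : (wt z <= wt (wf (fun x => f' x : nat) ++ wf (fun x => e x - f x)%N))%N.
    apply: w1; move: s1 s2 k1 k2.
    move: (size (wf (fun x => e x - f x)%N)) (size (wf (fun x => e x - f' x)%N)).
    by move: (size _) (size _) => a b c d; clear; lia.
  have {}w2 : (wt z <= wt (wf (fun x => f x : nat) ++ wf (fun x => e x - f' x)%N))%N.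
    apply: w2; move: s1 s2 k1 k2 {w1}.
    move: (size (wf (fun x => e x - f x)%N)) (size (wf (fun x => e x - f' x)%N)).
    by move: (size _) (size _) => a b c d; clear; lia.
  have wt_cat a b : wt (a ++ b) = (wt a + wt b)%N.
    by rewrite /wt -big_split; apply: eq_bigr => i _; rewrite count_cat mulnDl.
  have wt_perm a b : perm_eq a b -> wt a = wt b.
    by move=> /permP pab; apply: eq_bigr => i _; rewrite pab.
  rewrite (wt_perm _ _ p1) !wt_cat in w1; rewrite (wt_perm _ _ p2) !wt_cat in w2.
  have : wt (wf (fun x => f x : nat)) = wt (wf (fun x => f' x : nat)).
    move: w1 w2; move: (wt (wf (fun x => e x - f x)%N)) (wt (wf (fun x => e x - f' x)%N)).
    by move: (wt _) (wt _) => a b c d; clear; lia.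
  rewrite /wt; under eq_bigr do rewrite cwf; under [RHS]eq_bigr do rewrite cwf.
  move=> D; apply/ffunP => x; apply: val_inj => /=.
  pose ext (h : {ffun S -> 'I_k.+1}) i := if insub i is Some j then h (enum_val (j : 'I_#|S|)) : nat else 0%N.
  have extE h (i : 'I_#|S|) : ext h i = h (enum_val i) by rewrite /ext insubT //= => ?; congr (nat_of_ord (h (enum_val _))); apply: val_inj.
  have extB h i : (ext h i < B)%N by rewrite /ext; case: insub.
  have := @base_digits B #|S| (ext f) (ext f') (extB f) (extB f').
  have -> : (\sum_(i < #|S|) ext f i * B ^ i = \sum_(i < #|S|) f (enum_val i) * B ^ i)%N.
    by apply: eq_bigr => i _; rewrite extE.
  have -> : (\sum_(i < #|S|) ext f' i * B ^ i = \sum_(i < #|S|) f' (enum_val i) * B ^ i)%N.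
    by apply: eq_bigr => i _; rewrite extE.
  move=> /(_ D (enum_rank x) (ltn_ord _)); by rewrite !extE enum_rankK.
have : (#|family F| <= #|M|)%N by rewrite -(card_in_imset inj) max_card.
apply: leq_trans; rewrite card_family foldrE big_map big_enum /=.
by apply: leq_prod => x _; apply: card_bounded_ord (ek x).
Qed.

End CommutativeForm.

(** * Straight-line programs *)

Section Programs.
Variable S : finSemigroupType.
Local Open Scope group_scope.
Notation M := (adjone S).
Implicit Types (p q : slp S) (r : nat -> M) (w : seq S).

(** States are read in [S] with an adjoined identity, so that unassigned registers
    hold [1]. *)
Definition runs p r r' :=
  foldl (fun o c => obind (@exec_instr S ^~ c) o) (Some (r : state S)) p = Some (r' : state S).

Definition setr r k (x : M) : nat -> M := fun n => if n == k then x else r n.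

Lemma setr_eq r k x : setr r k x k = x. Proof. by rewrite /setr eqxx. Qed.
Lemma setr_neq r k x j : j != k -> setr r k x j = r j. Proof. by rewrite /setr => /negbTE ->. Qed.

Lemma runs_cat p q r1 r2 r3 : runs p r1 r2 -> runs q r2 r3 -> runs (p ++ q) r1 r3.
Proof. by rewrite /runs foldl_cat => ->. Qed.

Lemma runs_cons c q r1 r2 r3 : runs [:: c] r1 r2 -> runs q r2 r3 -> runs (c :: q) r1 r3.
Proof. by move=> h1 h2; rewrite -cat1s; apply: runs_cat h1 h2. Qed.

Lemma runs_const k s r : runs [:: Const k s] r (setr r k (inj1 s)).
Proof. by []. Qed.

Lemma runs_mul k i j r : r i != 1 -> r j != 1 -> runs [:: Mul S k i j] r (setr r k (r i * r j)).
Proof.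
by rewrite /runs /=; case: (r i) (r j) => [a|] // [b|].
Qed.

Definition within (rs : seq nat) p := all (mem rs) (flatten (map (@registers S) p)).

Lemma within_width rs p : within rs p -> (slp_width p <= size rs)%N.
Proof.
move=> H; apply: uniq_leq_size; first exact: undup_uniq.
by move=> k; rewrite mem_undup; apply: (allP H).
Qed.

Lemma within_sub rs rs' p : {subset rs <= rs'} -> within rs p -> within rs' p.
Proof. by move=> sub; apply: sub_all. Qed.

Lemma within_cat rs p q : within rs (p ++ q) = within rs p && within rs q.
Proof. by rewrite /within map_cat flatten_cat all_cat. Qed.

Variable A : {set S}.

Lemma over_cat p q : slp_over A (p ++ q) = slp_over A p && slp_over A q.
Proof. exact: all_cat. Qed.

Definition usable rs p := slp_over A p && within rs p.

Lemma usable_cat rs p q : usable rs (p ++ q) = usable rs p && usable rs q.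
Proof. by rewrite /usable over_cat within_cat andbACA. Qed.

Lemma usable_cons rs c q : usable rs (c :: q) = usable rs [:: c] && usable rs q.
Proof. by rewrite -cat1s usable_cat. Qed.

Lemma usable_sub rs rs' p : {subset rs <= rs'} -> usable rs p -> usable rs' p.
Proof. by move=> sub /andP [hov h]; rewrite /usable hov (within_sub sub h). Qed.

Lemma usable_mul rs k i j : k \in rs -> i \in rs -> j \in rs -> usable rs [:: Mul S k i j].
Proof. by move=> h1 h2 h3; rewrite /usable /within /= h1 h2 h3. Qed.

Lemma usable_const rs k s : k \in rs -> s \in A -> usable rs [:: Const k s].
Proof. by move=> h1 h2; rewrite /usable /within /= h1 h2. Qed.

(** A contract for a part of a program: from any state satisfying [pre], it changes
    registers in [out] only and leaves [post] of the old state in register [k]. *)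
Definition piece (p : slp S) (rs out : seq nat) (len : nat) (pre : (nat -> M) -> Prop)
    (k : nat) (post : (nat -> M) -> M) :=
  [/\ usable rs p, (size p <= len)%N &
    forall r, pre r -> exists r', [/\ runs p r r', r' k = post r &
      forall j, j \notin out -> r' j = r j]].

Lemma mulr_word k a w : k != a -> all (mem A) w ->
  exists p, piece p [:: k; a] [:: k; a] (2 * size w) (fun r => r k != 1) k
    (fun r => r k * ev id w).
Proof.
move=> ka; elim: w => [|s w IH] /=.
  by move=> _; exists [::]; split=> // r _; exists r; split=> //; rewrite ev_nil mulg1.
case/andP => sA /IH [p [up sp Hp]].
exists [:: Const a s, Mul S k k a & p]; split.
- rewrite usable_cons usable_const ?inE ?eqxx ?orbT //=.
  by rewrite usable_cons usable_mul ?inE ?eqxx ?orbT.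
- by rewrite /=; lia.
- move=> r rk; set r1 := setr r a (inj1 s); set r2 := setr r1 k (r k * inj1 s).
  have r1k : r1 k = r k by rewrite /r1 setr_neq.
  have [|r' [run E out]] := Hp r2; first by rewrite /r2 setr_eq adjone_mul_eq1 (negbTE rk).
  exists r'; split.
  + apply: runs_cons (runs_const _ _ _) _; apply: runs_cons run.
    have := @runs_mul k k a r1; rewrite r1k /r1 setr_eq => h; exact: h.
  + by rewrite E /r2 setr_eq ev_cons mulgA.
  + move=> j jo; rewrite out //; move: jo; rewrite !inE negb_or => /andP [jk ja].
    by rewrite ?/r2 ?/r1 !setr_neq.
Qed.

Lemma mull_word k a w : k != a -> all (mem A) w ->
  exists p, piece p [:: k; a] [:: k; a] (2 * size w) (fun r => r k != 1) k
    (fun r => ev id w * r k).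
Proof.
move=> ka; elim/last_ind: w => [|w s IH] /=.
  by move=> _; exists [::]; split=> // r _; exists r; split=> //; rewrite ev_nil mul1g.
rewrite all_rcons; case/andP => sA /IH [p [up sp Hp]].
exists [:: Const a s, Mul S k a k & p]; split.
- rewrite usable_cons usable_const ?inE ?eqxx ?orbT //=.
  by rewrite usable_cons usable_mul ?inE ?eqxx ?orbT.
- by rewrite /= size_rcons; lia.
- move=> r rk; set r1 := setr r a (inj1 s); set r2 := setr r1 k (inj1 s * r k).
  have r1k : r1 k = r k by rewrite /r1 setr_neq.
  have [|r' [run E out]] := Hp r2; first by rewrite /r2 setr_eq adjone_mul_eq1 (negbTE rk) andbF.
  exists r'; split.
  + apply: runs_cons (runs_const _ _ _) _; apply: runs_cons run.
    have := @runs_mul k a k r1; rewrite r1k /r1 setr_eq => h; exact: h.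
  + by rewrite E /r2 setr_eq ev_rcons mulgA.
  + move=> j jo; rewrite out //; move: jo; rewrite !inE negb_or => /andP [jk ja].
    by rewrite ?/r2 ?/r1 !setr_neq.
Qed.

Lemma load_word k a w : k != a -> w <> [::] -> all (mem A) w ->
  exists p, piece p [:: k; a] [:: k; a] (2 * size w) (fun=> True) k (fun=> ev id w).
Proof.
move=> ka; case: w => // s w _ /= /andP [sA wA].
have [p [up sp Hp]] := mulr_word ka wA.
exists (Const k s :: p); split.
- by rewrite usable_cons usable_const ?inE ?eqxx.
- by rewrite /=; lia.
- move=> r _; have [|r' [run E out]] := Hp (setr r k (inj1 s)); first by rewrite setr_eq.
  exists r'; split.
  + by apply: runs_cons (runs_const _ _ _) run.
  + by rewrite E setr_eq ev_cons.
  + move=> j jo; rewrite out //; move: jo; rewrite !inE negb_or => /andP [jk ja].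
    by rewrite ?/r2 ?/r1 !setr_neq.
Qed.

(** Square-and-multiply, without copying the base into the result register: the
    program starts with the square of the base. *)
Lemma power_piece k a e : k != a -> (1 < e)%N ->
  exists p, piece p [:: k; a] [:: k] (2 * trunc_log 2 e) (fun r => r a != 1) k
    (fun r => r a ^+ e).
Proof.
move=> ka; have [n] := ubnP e; elim: n e => // n IH e en e1.
have ak : a != k by rewrite eq_sym.
have U k' i j : all (mem [:: k; a]) [:: k'; i; j] -> usable [:: k; a] [:: Mul S k' i j].
  by rewrite /usable /within /=.
have step p0 e0 r (x : M) : (0 < e0)%N -> x = r a ^+ e0 -> r a != 1 ->
    (exists r', [/\ runs p0 r r', r' k = x & forall j, j \notin [:: k] -> r' j = r j]) ->
    exists r', [/\ runs (p0 ++ [:: Mul S k k a]) r r', r' k = r a ^+ e0.+1 &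
      forall j, j \notin [:: k] -> r' j = r j].
  move=> e00 xE ra [r1 [run1 E1 out1]].
  have r1a : r1 a = r a by rewrite out1 // inE.
  exists (setr r1 k (r1 k * r1 a)); split.
  - apply: runs_cat run1 (runs_mul _ _ _); rewrite ?r1a // E1 xE exp_eq1 //.
  - by rewrite setr_eq E1 xE r1a expgSr.
  - by move=> j jk; rewrite setr_neq ?out1 //; move: jk; rewrite inE.
have [e3|e4] := leqP e 3.
  have P2 r : r a != 1 -> exists r', [/\ runs [:: Mul S k a a] r r', r' k = r a ^+ 2 &
      forall j, j \notin [:: k] -> r' j = r j].
    move=> ra; exists (setr r k (r a * r a)); split; [exact: runs_mul | by rewrite setr_eq expg2|].
    by move=> j; rewrite inE => jk; rewrite setr_neq.
  have [->|->] : e = 2%N \/ e = 3%N by lia.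
  - by exists [:: Mul S k a a]; split=> //; apply: U; rewrite /= !inE !eqxx orbT.
  - exists ([:: Mul S k a a] ++ [:: Mul S k k a]); split=> //.
      by rewrite usable_cat !U //= !inE !eqxx orbT.
    by move=> r ra; apply: (step _ 2%N _ _ _ erefl) => //; apply: P2.
have [h1 h2] : (1 < e./2)%N /\ (e./2 < n)%N by lia.
have [p [up sp Hp]] := IH _ h2 h1.
have PD r : r a != 1 -> exists r', [/\ runs (p ++ [:: Mul S k k k]) r r',
    r' k = r a ^+ (e./2).*2 & forall j, j \notin [:: k] -> r' j = r j].
  move=> ra; have [r1 [run1 E1 out1]] := Hp r ra.
  have r1k : r1 k != 1 by rewrite E1 exp_eq1 // ltnW.
  exists (setr r1 k (r1 k * r1 k)); split.
  - by apply: runs_cat run1 (runs_mul _ _ _).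
  - by rewrite setr_eq E1 -expgnDr addnn.
  - by move=> j jk; rewrite setr_neq ?out1 //; move: jk; rewrite inE.
have szE : trunc_log 2 e = (trunc_log 2 e./2).+1 by rewrite trunc_log2S.
have [oe|ee] := boolP (odd e).
- exists ((p ++ [:: Mul S k k k]) ++ [:: Mul S k k a]); split.
  + by rewrite !usable_cat up !U //= !inE !eqxx ?orbT.
  + by rewrite !size_cat /= szE; lia.
  + move=> r ra; rewrite (_ : e = (e./2).*2.+1); last by lia.
    by apply: (step _ _ _ _ _ erefl) => //; [lia | apply: PD].
- exists (p ++ [:: Mul S k k k]); split.
  + by rewrite !usable_cat up !U //= !inE !eqxx ?orbT.
  + by rewrite !size_cat /= szE; lia.
  + move=> r ra; have := PD r ra; rewrite (_ : (e./2).*2 = e) //; lia.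
Qed.

Lemma exec_none p : foldl (fun o c => obind (@exec_instr S ^~ c) o) None p = None.
Proof. by elim: p. Qed.

Lemma runs_unassigned p r r' j : runs p r r' ->
  j \notin flatten (map (@registers S) p) -> r' j = r j.
Proof.
elim: p r => [|c p IH] r; first by rewrite /runs => -[->].
rewrite /runs /= mem_cat negb_or; case: c => [k s|k i l] /=.
  by move/IH => H /andP [jk /H ->]; rewrite /assign; move: jk; rewrite inE => /negbTE ->.
case: (r i) => [a|]; last by rewrite exec_none.
case: (r l) => [b|]; last by rewrite exec_none.
move/IH => H /andP [jk /H ->]; rewrite /assign; move: jk.
by rewrite !inE negb_or => /andP [/negbTE ->].
Qed.

End Programs.

(** * Costs *)

Section Extrema.
Local Open Scope classical_set_scope.

Lemma nat_min_in (A : set nat) n : A n -> (A `&` lbound A) (nat_min A).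
Proof.
move=> An; apply: xgetPex.
have exA : exists m, `[< A m >] by exists n; apply/asboolP.
case: (ex_minnP exA) => m /asboolP Am mmin; exists m; split=> // x Ax.
by rewrite leEnat; apply: mmin; apply/asboolP.
Qed.

Lemma nat_min_le (A : set nat) n : A n -> nat_min A <= n.
Proof. by move=> An; have [_ /(_ _ An)] := nat_min_in An; rewrite leEnat. Qed.

Lemma nat_max_le (A : set nat) B : (forall n, A n -> n <= B) -> nat_max A <= B.
Proof. by move=> H; rewrite /nat_max; case: xgetP => [x -> [Ax _]|_] //; apply: H. Qed.

Lemma le_nat_max (A : set nat) B n : (forall n, A n -> n <= B) -> A n -> n <= nat_max A.
Proof.
move=> H An; have : (A `&` ubound A) (nat_max A).
  apply: xgetPex.
  have exA : exists m, `[< A m >] by exists n; apply/asboolP.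
  have bA m : `[< A m >] -> m <= B by move/asboolP; apply: H.
  case: (ex_maxnP exA bA) => m /asboolP Am mmax; exists m; split=> // x Ax.
  by rewrite leEnat; apply: mmax; apply/asboolP.
by case=> _ /(_ _ An); rewrite leEnat.
Qed.
End Extrema.

Section Generation.
Variables (S : finSemigroupType) (A : {set S}).
Local Open Scope group_scope.

Lemma subsemigroup_gen_word t : t \in subsemigroup_gen A ->
  exists w, all (mem A) w /\ ev id w = inj1 t.
Proof.
move=> /bigcapP tA; pose W := [set x : S | `[< exists w, all (mem A) w /\ ev id w = inj1 x >]]%SET.
have : t \in W.
  apply: tA; apply/andP; split.
    apply/fintype.subsetP => a aA; rewrite finset.in_set; apply/asboolP.
    by exists [:: a]; rewrite ev_seq1 /= aA.
  apply/forall_inP => x; rewrite finset.in_set => /asboolP [u [uA uE]].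
  apply/forall_inP => y; rewrite finset.in_set => /asboolP [v [vA vE]].
  rewrite finset.in_set; apply/asboolP; exists (u ++ v).
  by rewrite all_cat uA vA ev_cat uE vE.
by rewrite finset.in_set => /asboolP.
Qed.

Lemma generated_subsemigroup_gen (P : S -> Prop) t :
  (forall x, P x -> x \in A) -> generated P t -> t \in subsemigroup_gen A.
Proof.
move=> PA g; apply/bigcapP => B /andP [AB /forall_inP cl].
elim: g => [x /PA xA|x y _ xB _ yB]; first exact: (fintype.subsetP AB).
by have /forall_inP := cl x xB; apply.
Qed.

(** What lies between two prefixes with the same value can be cut out. *)
Lemma short_word (w : seq S) : w <> [::] -> exists u,
  [/\ u <> [::], {subset u <= w}, ev id u = ev id w & (size u <= #|S|)%N].
Proof.
have [n] := ubnP (size w); elim: n w => // n IH w wn w0.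
have [wS|Sw] := leqP (size w) #|S|; first by exists w; split.
pose h (i : 'I_(size w)) := ev id (take i.+1 w).
have /repeated_value [i [j [lij hij]]] : ~~ injectiveb h.
  apply/negP => /injectiveP inj.
  have h1 i : h i != 1 by rewrite /h ev_eq1 /nilp size_take_min; have := ltn_ord i; lia.
  have [k kE] : exists k : 'I_(size w) -> S, forall i, h i = inj1 (k i).
    have ex i : exists x, h i = inj1 x by apply: adjone_neq1.
    by have [k kE] := choice ex; exists k.
  have /leq_card : injective k by move=> a b E; apply: inj; rewrite !kE E.
  by rewrite card_ord leqNgt Sw.
pose u := take i.+1 w ++ drop j.+1 w.
have uE : ev id u = ev id w.
  by rewrite /u ev_cat -/(h i) hij -ev_cat cat_take_drop.
have jw := ltn_ord j.
have su : (size u < size w)%N by rewrite size_cat size_drop size_take_min; lia.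
have u0 : u <> [::].
  by move/(congr1 size); rewrite /= size_cat size_take_min; lia.
have [|v [v0 vu vE vS]] := IH u _ u0; first by lia.
exists v; split=> //; last by rewrite vE.
by move=> a /vu; rewrite mem_cat => /orP [/mem_take|/mem_drop].
Qed.

End Generation.

Lemma leq_width_le a b w : a <= b -> leq_width b w -> leq_width a w.
Proof. by case: w => //= c; apply: leq_trans. Qed.

Lemma leq_add_width a w c : leq_width a w -> leq_width (a + c) (add_width w c).
Proof. by case: w => //= b; rewrite leq_add2r. Qed.

Section Cost.
Variable S : finSemigroupType.
Local Open Scope group_scope.

Lemma slp_cost_le (w : width) (A : {set S}) (p : slp S) rs k (r : nat -> adjone S) (t : S) :
  usable A rs p -> leq_width (size rs) w -> runs p (fun=> 1) r -> r k = inj1 t ->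
  (slp_cost w A t <= size p)%N.
Proof.
move=> /andP [oA wi] lw run E; apply: nat_min_le; exists p => //; split=> //.
- by apply: leq_width_le lw; apply: within_width.
- by exists r; split=> //; exists k.
Qed.

(** Two registers suffice to multiply out a short word letter by letter; so minimal
    programs exist and [CV] is a maximum of a bounded set. *)
Lemma slp_cost_two_registers (w : width) (A : {set S}) (t : S) : leq_width 2 w ->
  t \in subsemigroup_gen A ->
  (slp_cost w A t <= 2 * #|S|)%N /\
  exists p : slp S, [/\ slp_over A p, leq_width (slp_width p) w, computes p t &
    size p = slp_cost w A t].
Proof.
move=> w2 /subsemigroup_gen_word [u [uA uE]].
have u0 : u <> [::] by move=> u0; rewrite u0 ev_nil in uE.
have [v [v0 vu vE vS]] := short_word u0.
have vA : all (mem A) v by apply/allP => a /vu; apply: (allP uA).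
have [p [/andP [op wp] sp Hp]] := load_word (k := 0) (a := 1%N) isT v0 vA.
have [r [run E _]] := Hp (fun=> 1) I; rewrite vE uE in E.
have pw : leq_width (slp_width p) w by apply: leq_width_le w2; apply: within_width wp.
have cp : computes p t by exists r; split=> //; exists 0%N.
split.
  apply: leq_trans (_ : size p <= _)%N; first by apply: nat_min_le; exists p.
  by apply: leq_trans sp _; rewrite leq_mul2l.
pose Q := [set p : slp S | [/\ slp_over A p, leq_width (slp_width p) w & computes p t]]%classic.
have [[q [oq wq cq] sq] _] := @nat_min_in [set size p | p in Q]%classic (size p) (ex_intro2 _ _ p (And3 op pw cp) erefl).
by exists q; split.
Qed.

Lemma CS_le w B : (forall (A : {set S}) t, t \in subsemigroup_gen A -> (slp_cost w A t <= B)%N) ->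
  (CS w S <= B)%N.
Proof. by move=> H; apply/bigmax_leqP => A _; apply/bigmax_leqP => t; apply: H. Qed.

Lemma slp_cost_CS w (A : {set S}) t : t \in subsemigroup_gen A -> (slp_cost w A t <= CS w S)%N.
Proof.
move=> tA; apply: leq_trans (leq_bigmax A).
exact: (@leq_bigmax_cond _ (mem (subsemigroup_gen A)) (fun t => slp_cost w A t) t tA).
Qed.

End Cost.

Lemma CV_le w (V : finSemigroupType -> Prop) N B : (forall S, V S -> #|S| <= N -> CS w S <= B) -> CV w V N <= B.
Proof. by move=> H; apply: nat_max_le => n [S [VS SN ->]]; apply: H. Qed.

Lemma le_CV w (V : finSemigroupType -> Prop) (S : finSemigroupType) N : leq_width 2 w -> V S -> #|S| <= N ->
  CS w S <= CV w V N.
Proof.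
move=> w2 VS SN; apply: (@le_nat_max _ (2 * N)); last by exists S.
move=> n [T [VT TN ->]]; apply: CS_le => A t tA.
have [H _] := slp_cost_two_registers w2 tA.
by apply: leq_trans H _; rewrite leq_mul2l.
Qed.

(** * Simulating programs of a maximal subgroup *)

Section Simulation.
Variables (G S : finSemigroupType) (f : G -> S).
Hypothesis fM : {morph f : x y / (x * y)%g}.
Local Open Scope group_scope.
Variables (Gam : {set G}) (A : {set S}) (g : adjone S) (n : nat) (ra rg : nat).
Hypotheses (g1 : g != 1) (rag : ra != rg).
Hypothesis GamA : forall c, c \in Gam -> exists b,
  [/\ b <> [::], all (mem A) b, (size b <= n)%N & inj1 (f c) = g * ev id b * g].

(** With [g] kept in register [rg], a constant [g * b * g] is loaded by multiplying
    in place; [ra] holds the letters of [b]. *)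
Lemma load_sandwich c k : k != ra -> k != rg -> c \in Gam ->
  exists p, [/\ usable A [:: ra; rg; k] p, (size p <= 2 * n + 1)%N &
    forall r, r rg = g -> exists r', [/\ runs p r r', r' k = inj1 (f c) &
      forall j, j \notin [:: k; ra] -> r' j = r j]].
Proof.
move=> kra krg /GamA [[|s b] [// _ /= /andP [sA bA] bn fc]].
have [p [up sp Hp]] := mulr_word kra bA.
exists ([:: Const ra s; Mul S k rg ra] ++ p ++ [:: Mul S k k rg]); split.
- rewrite !usable_cat (usable_sub _ up) ?usable_mul ?inE ?eqxx ?orbT //; last first.
    by move=> j; rewrite !inE => /orP [] ->; rewrite ?orbT.
  by rewrite usable_cons usable_const ?usable_mul ?inE ?eqxx ?orbT.
- by rewrite !size_cat /=; lia.
- move=> r rgE; set r1 := setr r ra (inj1 s); set r2 := setr r1 k (g * inj1 s).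
  have r1g : r1 rg = g by rewrite /r1 setr_neq // eq_sym.
  have run2 : runs [:: Const ra s; Mul S k rg ra] r r2.
    apply: runs_cons (runs_const _ _ _) _.
    by have := @runs_mul S k rg ra r1; rewrite r1g /r1 setr_eq => h; exact: h.
  have [|r3 [run3 E3 out3]] := Hp r2; first by rewrite /r2 setr_eq adjone_mul_eq1 (negbTE g1).
  have r3g : r3 rg = g.
    by rewrite out3 ?inE ?negb_or ?(eq_sym rg) ?krg ?rag // /r2 setr_neq // eq_sym.
  exists (setr r3 k (r3 k * r3 rg)); split.
  + apply: runs_cat run2 _; apply: runs_cat run3 _; apply: runs_mul; rewrite ?r3g //.
    by rewrite E3 /r2 setr_eq -mulgA adjone_mul_eq1 (negbTE g1).
  + by rewrite setr_eq r3g E3 /r2 setr_eq fc ev_cons !mulgA.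
  + move=> j jk; have := jk; rewrite !inE negb_or => /andP [jk' jr].
    by rewrite setr_neq // out3 // /r2 setr_neq // /r1 setr_neq.
Qed.

(** Registers of the group program keep their numbers. *)
Definition simulates (r : nat -> adjone G) (r' : nat -> adjone S) :=
  r' rg = g /\ forall j, j != ra -> j != rg -> r' j = omap f (r j).

Lemma simulation (p : slp G) : slp_over Gam p ->
  ra \notin flatten (map (@registers G) p) -> rg \notin flatten (map (@registers G) p) ->
  exists p', [/\ usable A (ra :: rg :: flatten (map (@registers G) p)) p',
    (size p' <= (2 * n + 1) * size p)%N &
    forall r r1, runs p r r1 -> forall r', simulates r r' ->
      exists r1', runs p' r' r1' /\ simulates r1 r1'].
Proof.
elim: p => [|c p IH].
  move=> _ _ _; exists [::]; split=> // r r1; rewrite /runs /= => -[<-] r' sr.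
  by exists r'.
rewrite /= !mem_cat !negb_or => /andP [oc /IH {}IH] /andP [rac /IH {}IH] /andP [rgc /IH].
case=> [p' [up' sp' Hp']].
have sub rs : {subset ra :: rg :: flatten (map (@registers G) p) <=
    ra :: rg :: rs ++ flatten (map (@registers G) p)}.
  by move=> j; rewrite !inE mem_cat => /or3P [->|->|->]; rewrite ?orbT.
case: c oc rac rgc => [k s|k i j] /=.
- move=> sG; rewrite !inE ![_ == k]eq_sym => kra krg.
  have [q [uq sq Hq]] := load_sandwich kra krg sG.
  exists (q ++ p'); split.
  + rewrite usable_cat (usable_sub _ uq) ?(usable_sub (sub [:: k]) up') //.
    by move=> j; rewrite !inE => /or3P [] ->; rewrite ?orbT.
  + by rewrite size_cat; lia.
  + move=> r r1 run r' [r'g sr]; have [r2 [run2 E2 out2]] := Hq r' r'g.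
    have [|r1' [run1' s1']] := Hp' _ _ run r2.
      split; first by rewrite out2 ?inE ?negb_or ?(eq_sym rg) ?krg ?rag.
      move=> j ja jg; rewrite /assign; case: eqP => [->|/eqP jk]; first by rewrite E2.
      by rewrite out2 ?inE ?negb_or ?jk ?ja ?sr.
    by exists r1'; split=> //; apply: runs_cat run2 run1'.
- move=> _; rewrite !inE !negb_or ![_ == k]eq_sym ![_ == i]eq_sym ![_ == j]eq_sym.
  move=> /and3P [ka ia ja] /and3P [kg ig jg].
  exists (Mul S k i j :: p'); split.
  + rewrite usable_cons usable_mul ?inE ?eqxx ?orbT //=.
    exact: (usable_sub (sub [:: k; i; j]) up').
  + by rewrite /=; lia.
  + move=> r r1 run r' [r'g sr].
    have [a [b [ri rj run']]] : exists a b, [/\ r i = inj1 a, r j = inj1 b &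
        runs p (assign r k (a * b)) r1].
      move: run; rewrite /runs /=; case: (r i) => [a|]; last by rewrite exec_none.
      by case: (r j) => [b|]; [exists a, b | rewrite exec_none].
    have r'i : r' i = inj1 (f a) by rewrite sr // ri.
    have r'j : r' j = inj1 (f b) by rewrite sr // rj.
    have [|r1' [run1' s1']] := Hp' _ _ run' (setr r' k (inj1 (f a) * inj1 (f b))).
      split; first by rewrite setr_neq // eq_sym.
      move=> l la lg; rewrite /setr /assign; case: eqP => [_|_]; last exact: sr.
      by rewrite -inj1M -fM.
    exists r1'; split=> //; apply: runs_cons run1'.
    by rewrite -r'i -r'j; apply: runs_mul; rewrite ?r'i ?r'j.
Qed.

End Simulation.

Section MaximalSubgroupType.
Variables (S : finSemigroupType) (g0 : S).
Local Open Scope group_scope.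
Notation M := (adjone S).
Hypothesis hF : forall x e f : M, e != 1 -> f != 1 ->
  e * e = e -> f * f = f -> e * x = x -> x * f = x -> om x * x = x.
Let g := inj1 g0.
Hypothesis gg : g * g = g.
Let g1 : g != 1. Proof. by []. Qed.

(** The H-class of [g]: elements between [g] and [g] that divide [g]. *)
Definition in_subgroup : {pred S} :=
  fun x => `[< g * inj1 x * g = inj1 x /\ divides (inj1 x) g >].

Lemma in_subgroupM x y : in_subgroup x -> in_subgroup y -> in_subgroup (x * y).
Proof.
move=> /asboolP [xg xd] /asboolP [yg yd]; apply/asboolP; rewrite inj1M; split; last exact: dividesM.
have gx : g * inj1 x = inj1 x by rewrite -xg !mulgA gg.
have yg' : inj1 y * g = inj1 y by rewrite -yg -!mulgA gg.
by rewrite mulgA gx -mulgA yg'.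
Qed.

Definition maxsubgroup : finSemigroupType := subsemigroup in_subgroupM.

Lemma maxsubgroup_group : is_group maxsubgroup.
Proof.
have Pg : in_subgroup g0.
  by apply/asboolP; rewrite -/g !gg; split=> //; apply: divides_refl.
pose e : maxsubgroup := Sub g0 Pg; exists e.
have unit (x : maxsubgroup) : g * inj1 (val x) = inj1 (val x) /\ inj1 (val x) * g = inj1 (val x).
  have /asboolP [xg _] := valP x; split; first by rewrite -xg !mulgA gg.
  by rewrite -xg -!mulgA gg.
split=> x; first by split; apply: val_inj; apply: inj1_inj; rewrite inj1M; case: (unit x).
have /asboolP [xg xd] := valP x; have [gx gx'] := unit x.
have omx : om (inj1 (val x)) = g by rewrite -xg om_gbg.
have [y yE] : exists y, omV (inj1 (val x)) = inj1 y.
  apply: adjone_neq1; rewrite /omV exp_eq1 //.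
  by have := @wexp_gt1 S; lia.
have Py : in_subgroup y.
  apply/asboolP; rewrite -yE; split; last by apply: dividesX.
  by have := giE gg (inj1 (val x)); rewrite /gi xg => -[-> ->].
exists (Sub y Py); split; apply: val_inj; apply: inj1_inj; rewrite inj1M /= -yE.
- by rewrite omVr.
- by rewrite omVl.
Qed.

Lemma maxsubgroup_generated (L : seq S) m x (A : {set maxsubgroup}) :
  all_divide L g -> generated (sandwich g L m) x ->
  (forall c : maxsubgroup, sandwich g L m (inj1 (val c)) -> c \in A) ->
  exists2 c : maxsubgroup, c \in subsemigroup_gen A & inj1 (val c) = x.
Proof.
move=> Lg gx HA.
suff [c gc cx] : exists2 c : maxsubgroup,
    generated (fun d : maxsubgroup => sandwich g L m (inj1 (val d))) c & inj1 (val c) = x.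
  by exists c => //; apply: generated_subsemigroup_gen gc.
elim: gx => {x} [x sx|x y _ [c gc <-] _ [d gd <-]]; last first.
  by exists (c * d); [apply: generated_mul | rewrite -inj1M].
have [b [Lb _ xE]] := sx.
have bg : divides (ev id b) g by apply: ev_divides => // a ab; apply: Lg; apply: (allP Lb).
have [x0 xx] : exists x0, x = inj1 x0.
  by apply: adjone_neq1; rewrite xE -mulgA adjone_mul_eq1.
have P0 : in_subgroup x0.
  apply/asboolP; rewrite -xx xE; split; first by rewrite !mulgA gg -!mulgA gg.
  by apply: dividesM => //; [apply: dividesM => //; apply: divides_refl | apply: divides_refl].
by exists (Sub x0 P0 : maxsubgroup); [apply: generated_base; rewrite /= -xx | rewrite xx].
Qed.

End MaximalSubgroupType.

(** * Upper bounds *)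

Section LengtheningCost.
Variables (V : finSemigroupType -> Prop) (hV : pseudovariety V) (n : nat).
Hypotheses (hn : lengthening V n.+1) (nL : ~ contains V LRB) (nR : ~ contains V RRB).
Local Open Scope group_scope.
Local Notation m := n.+1.

Lemma lengthening_word (S : finSemigroupType) (w : seq S) : V S -> size w = m ->
  exists w', [/\ {subset w' <= w}, (m < size w')%N & ev id w' = ev id w].
Proof.
move=> VS; case: w => // x0 w sw.
have [v [av vm E]] := hn (nth x0 (x0 :: w)) VS.
exists (map (nth x0 (x0 :: w)) v); rewrite size_map ev_id_map E; split=> //.
  by move=> a /mapP [i iv ->]; apply: mem_nth; rewrite sw; apply: (allP av).
by rewrite -ev_id_map -{2}(mkseq_nth x0 (x0 :: w)) /mkseq sw.
Qed.

Lemma cost_short_word (S : finSemigroupType) (A : {set S}) (w : width) (u : seq S) t :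
  leq_width 2 w -> all (mem A) u -> ev id u = inj1 t -> (slp_cost w A t <= 2 * size u)%N.
Proof.
move=> w2 uA uE; have u0 : u <> [::] by move=> u0; rewrite u0 ev_nil in uE.
have [p [up sp Hp]] := load_word (k := 0%N) (a := 1%N) isT u0 uA.
have [r [run E _]] := Hp (fun=> 1) I; rewrite uE in E.
by apply: leq_trans sp; apply: slp_cost_le up _ run E.
Qed.

(** The program computes the product of the letters of [U] in [ra], its power [g] in
    [rg], then runs the simulated group program, and finally multiplies its result by
    the two short outer words. *)
Lemma lengthening_cost : exists C, forall w d N (S : finSemigroupType) (A : {set S}) t,
  leq_width 2 w -> (1 < d)%N -> V S -> (#|S| <= N)%N -> t \in subsemigroup_gen A ->
  (slp_cost (add_width w d) A t <= C * (CV w (groups_of V) N + trunc_log 2 N.+1))%N.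
Proof.
exists (8 * m + 10)%N => w d N S A t w2 d2 VS SN tA.
have lg1 : (0 < trunc_log 2 N.+1)%N.
  by rewrite trunc_log_gt0 //= ltnS (leq_trans _ SN) //; apply/card_gt0P; exists t.
have wd2 : leq_width 2 (add_width w d) by apply: leq_width_le (leq_add_width d w2); lia.
have [u [uA uE]] := subsemigroup_gen_word tA.
have [um|mu] := ltnP (size u) m.
  apply: leq_trans (cost_short_word wd2 uA uE) (leq_trans (_ : _ <= 8 * m + 10)%N _).
    by move: um; move: (size u) (n) => a b; clear; lia.
  by rewrite leq_pmulr // addn_gt0 lg1 orbT.
have hF := local_group_element hV hn VS.
have hR e a b := @no_local_right_zero V hV S VS e a b nR.
have hL e a b := @no_local_left_zero V hV S VS e a b nL.
have hlen v := @lengthening_word S v VS.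
have [U [L [p [q [k [x [[sub U0 Uc /andP [k1 kM] [sp sq]] [gg Lg gx tE]]]]]]]] :=
  short_form_exists hF hR hL (ltn0Sn n) hlen mu.
set g := ev id U ^+ k in gg Lg gx tE.
have g1 : g != 1 by rewrite exp_eq1 ?ev_eq1; [case: (U) U0 | lia].
have [g0 gE] := adjone_neq1 g1; rewrite gE in gg Lg gx.
have inA v : {subset v <= U ++ L ++ p ++ q} -> all (mem A) v.
  by move=> H; apply/allP => a /H /sub; apply: (allP uA).
have UA : all (mem A) U by apply: inA => a; rewrite !mem_cat => ->.
have LA : all (mem A) L by apply: inA => a; rewrite !mem_cat => ->; rewrite orbT.
have pA : all (mem A) p by apply: inA => a; rewrite !mem_cat => ->; rewrite !orbT.
have qA : all (mem A) q by apply: inA => a; rewrite !mem_cat => ->; rewrite !orbT.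
pose G := maxsubgroup hF gg.
pose fi : {multiplicative G -> S} := subsg_emb (in_subgroupM hF gg).
pose Gam := [set c : G | `[< sandwich (inj1 g0) L m (inj1 (val c)) >]]%SET.
have [c cG cx] : exists2 c : G, c \in subsemigroup_gen Gam & inj1 (val c) = x.
  apply: maxsubgroup_generated Lg gx _ => c sc.
  by rewrite finset.in_set; apply/asboolP.
have GV : groups_of V G.
  by split; [apply: (pv_sub hV (@subsg_emb_inj _ _ _)) | apply: maxsubgroup_group].
have GN : (#|G| <= N)%N by apply: leq_trans SN; apply: card_subsemigroup.
have [_ [pG [oG wG [r [runG [kap rk]]] sG]]] := slp_cost_two_registers w2 cG.
have sGN : (size pG <= CV w (groups_of V) N)%N.
  by rewrite sG; apply: leq_trans (slp_cost_CS w cG) (le_CV w2 GV GN).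
set regs := flatten (map (@registers G) pG).
(* two registers not used by the group program *)
pose ra := (\max_(i <- regs) i).+1%N; pose rg := ra.+1.
have fresh j : (ra <= j)%N -> j \notin regs.
  move=> rj; apply/negP => jr; have := @leq_bigmax_seq _ regs predT id j jr isT.
  by rewrite leqNgt => /negP; apply.
have rag : ra != rg by rewrite /rg neq_ltn leqnn.
have GamA (c0 : G) : c0 \in Gam -> exists b,
    [/\ b <> [::], all (mem A) b, (size b <= m.+1)%N & inj1 (fi c0) = g * ev id b * g].
  rewrite finset.in_set => /asboolP [b [Lb /andP [mb bm] bE]]; exists b; split=> //.
  - by move=> b0; rewrite b0 in mb.
  - by apply: sub_all Lb => a aL; apply: (allP LA).
  - by rewrite gE -bE.
have [p' [up' sp' Hp']] := simulation (@gmulfM _ _ fi) g1 rag GamA oG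
  (fresh _ (leqnn _)) (fresh _ (leqnSn _)).
have [p1 [up1 sp1 Hp1]] := load_word rag U0 UA.
have rga : rg != ra by rewrite eq_sym.
have [p2 [up2 sp2 Hp2]] := power_piece A rga k1.
have kreg : kap \in regs.
  apply/negPn/negP => /(runs_unassigned runG); by rewrite rk.
have ka : kap != ra by apply: contraTneq kreg => ->; apply: fresh.
have kg : kap != rg by apply: contraTneq kreg => ->; apply: fresh; apply: leqnSn.
have [p3 [up3 sp3 Hp3]] := mulr_word ka qA.
have [p4 [up4 sp4 Hp4]] := mull_word ka pA.
have [r1 [run1 E1 out1]] := Hp1 (fun=> 1) I.
have [|r2 [run2 E2 out2]] := Hp2 r1; first by rewrite E1 ev_eq1; case: (U) U0.
rewrite E1 -/g in E2.
have sim2 : simulates fi g ra rg (fun=> 1) r2.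
  split=> // j ja jg; rewrite out2 ?inE // out1 ?inE ?negb_or ?ja //.
have [r3 [run3 [r3g sim3]]] := Hp' _ _ runG _ sim2.
have r3k : r3 kap = x by rewrite sim3 // rk -cx.
have x1 : x != 1 by rewrite -cx.
have [|r4 [run4 E4 out4]] := Hp3 r3; first by rewrite r3k.
rewrite r3k in E4.
have [|r5 [run5 E5 out5]] := Hp4 r4; first by rewrite E4 adjone_mul_eq1 (negbTE x1).
rewrite E4 mulgA -tE uE in E5.
pose rs := ra :: rg :: undup regs.
have urs rs' : {subset rs' <= ra :: rg :: regs} -> {subset rs' <= rs}.
  by move=> H j /H; rewrite !inE mem_undup.
have up : usable A rs (p1 ++ p2 ++ p' ++ p3 ++ p4).
  rewrite !usable_cat; apply/and5P; split.
  - by apply: usable_sub up1; apply: urs => j; rewrite !inE => /orP [] ->; rewrite ?orbT.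
  - by apply: usable_sub up2; apply: urs => j; rewrite !inE => /orP [] ->; rewrite ?orbT.
  - by apply: usable_sub up'; apply: urs.
  - by apply: usable_sub up3; apply: urs => j; rewrite !inE => /orP [/eqP ->|->]; rewrite ?kreg ?orbT.
  - by apply: usable_sub up4; apply: urs => j; rewrite !inE => /orP [/eqP ->|->]; rewrite ?kreg ?orbT.
have run : runs (p1 ++ p2 ++ p' ++ p3 ++ p4) (fun=> 1) r5.
  by do 4!(apply: runs_cat; first by eassumption).
have lw : leq_width (size rs) (add_width w d).
  by apply: leq_width_le (leq_add_width d wG); rewrite -[size rs]/(slp_width pG).+2 -addn2 leq_add2l.
apply: leq_trans (slp_cost_le up lw run E5) _.
have MN : (#|adjone S| <= N.+1)%N by rewrite card_adjone ltnS.
have lU : (size U <= trunc_log 2 N.+1)%N by apply: trunc_log_max => //; apply: leq_trans Uc MN.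
have lk : (trunc_log 2 k <= (trunc_log 2 N.+1).+1)%N.
  rewrite -trunc_logMp //.
  by apply: leq_trunc_log; apply: leq_trans kM _; rewrite leq_mul2l MN.
have lG : ((2 * m.+1 + 1) * size pG <= (8 * m + 10) * CV w (groups_of V) N)%N.
  by apply: leq_mul => //; clear; lia.
have lT : (8 * m + 2 <= (8 * m + 2) * trunc_log 2 N.+1)%N by rewrite leq_pmulr.
have -> : ((8 * m + 10) * (CV w (groups_of V) N + trunc_log 2 N.+1) =
    (8 * m + 10) * CV w (groups_of V) N + (8 * m + 2) * trunc_log 2 N.+1 +
    8 * trunc_log 2 N.+1)%N by rewrite mulnDr -addnA -mulnDl -addnA.
rewrite !size_cat; move: sp1 sp2 sp' sp3 sp4 lU lk sp sq lG lT lg1.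
move: (size p1) (size p2) (size p') (size p3) (size p4) (size U) (trunc_log 2 k).
move: ((8 * m + 2) * trunc_log 2 N.+1)%N ((8 * m + 10) * CV w (groups_of V) N)%N.
move: ((2 * m.+1 + 1) * size pG)%N (size q) (size p) (trunc_log 2 N.+1) (n).
by clear; lia.
Qed.

End LengtheningCost.

Lemma sum_trunc_log (T : Type) (l : seq T) (h : T -> nat) : (forall x, 0 < h x) ->
  \sum_(x <- l) trunc_log 2 (h x) <= trunc_log 2 (\prod_(x <- l) h x).
Proof.
move=> h0; elim: l => [|x l IH]; first by rewrite !big_nil.
rewrite !big_cons; apply: leq_trans (leq_add (leqnn _) IH) _.
apply: trunc_log_max => //; rewrite expnD leq_mul ?trunc_logP ?h0 //.
exact: prodn_gt0.
Qed.

Section PermutationCost.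
Variables (V : finSemigroupType -> Prop) (n : nat) (w0 : seq nat).
Hypotheses (w0N : perm_eq w0 (iota 0 n)) (w0i : w0 <> iota 0 n).
Hypothesis hp : permutation_identity V n w0.
Local Open Scope group_scope.

(** Register [0] accumulates the product, register [2] holds a letter and register [1] its
    power. *)
Lemma power_word_piece (S : finSemigroupType) (A : {set S}) (f : S -> nat) l :
  all (mem A) l -> (forall x, x \in l -> (0 < f x)%N) ->
  exists p, piece A p [:: 0; 1; 2]%N [:: 0; 1; 2]%N
    (\sum_(x <- l) 4 * trunc_log 2 (f x).+1)%N (fun r => r 0%N != 1) 0%N
    (fun r => r 0%N * ev id (power_word f l)).
Proof.
elim: l => [|x l IH] /=.
  move=> _ _; exists [::]; split=> // r _; exists r.
  by rewrite /power_word /= ev_nil mulg1.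
case/andP => xA lA fl; have [p [up sp Hp]] := IH lA (fun y yl => fl y (@mem_behead _ (x :: l) y yl)).
have fx := fl x (mem_head _ _).
have lg1 : (0 < trunc_log 2 (f x).+1)%N by rewrite trunc_log_gt0.
have [q [uq sq Hq]] : exists q, piece A q [:: 0; 1; 2]%N [:: 1; 2]%N
    (4 * trunc_log 2 (f x).+1 - 1)%N (fun r => r 0%N != 1) 1%N (fun r => inj1 x ^+ f x).
  have [fx1|fx2] := leqP (f x) 1.
    have -> : f x = 1%N by lia.
    exists [:: Const 1%N x]; split; first by rewrite usable_const.
      by rewrite trunc_lognn.
    move=> r _; exists (setr r 1%N (inj1 x)); split; first exact: runs_const.
      by rewrite setr_eq expg1.
    by move=> j; rewrite !inE negb_or => /andP [j1 _]; rewrite setr_neq.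
  have [q [uq sq Hq]] := power_piece A (k := 1%N) (a := 2%N) isT fx2.
  exists (Const 2%N x :: q); split.
  - rewrite usable_cons usable_const //=.
    by apply: usable_sub uq => j; rewrite !inE => /orP [] ->; rewrite ?orbT.
  - by rewrite /=; have := leq_trunc_log 2 (leqnSn (f x)); lia.
  - move=> r _; have [|r' [run E out]] := Hq (setr r 2%N (inj1 x)); first by rewrite setr_eq.
    exists r'; split; first by apply: runs_cons (runs_const _ _ _) run.
      by rewrite E setr_eq.
    move=> j; rewrite !inE negb_or => /andP [j1 j2].
    by rewrite out ?inE // setr_neq.
exists (q ++ [:: Mul S 0%N 0%N 1%N] ++ p); split.
- by rewrite !usable_cat uq up usable_mul.
- rewrite !size_cat big_cons; move: sq sp lg1.
  by move: (size p) (size q) (\sum_(_ <- _) _)%N (trunc_log 2 _) => a b c d; clear; rewrite /=; lia.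
- move=> r r0; have [r1 [run1 E1 out1]] := Hq r r0.
  have r10 : r1 0%N = r 0%N by rewrite out1.
  have [|r2 [run2 E2 out2]] := Hp (setr r1 0%N (r1 0%N * r1 1%N)).
    by rewrite setr_eq adjone_mul_eq1 r10 (negbTE r0).
  exists r2; split.
  + apply: runs_cat run1 _; apply: runs_cat run2; apply: runs_mul; first by rewrite r10.
    by rewrite E1 exp_eq1.
  + rewrite E2 setr_eq r10 E1 /power_word /= ev_cat mulgA; congr (_ * _ * _).
    by rewrite -[nseq _ _]cat0s -(cats0 (nseq _ _)) /=; elim: (f x) => [|k IHk] /=; rewrite ?ev_nil // expgS ev_cons -IHk.
  + move=> j jo; rewrite out2 // setr_neq; last by move: jo; rewrite !inE negb_or => /andP [].
    by rewrite out1 //; move: jo; rewrite !inE !negb_or => /and3P [_ -> ->].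
Qed.

Lemma permutation_cost : exists C, forall w d N (S : finSemigroupType) (A : {set S}) t,
  leq_width 2 w -> (1 < d)%N -> V S -> (#|S| <= N)%N -> t \in subsemigroup_gen A ->
  (slp_cost (add_width w d) A t <= C * trunc_log 2 N.+1)%N.
Proof.
exists (4 * n + 4)%N => w d N S A t w2 d2 VS SN tA.
have lg1 : (0 < trunc_log 2 N.+1)%N.
  by rewrite trunc_log_gt0 //= ltnS (leq_trans _ SN) //; apply/card_gt0P; exists t.
have wd3 : leq_width 3 (add_width w d) by apply: leq_width_le (leq_add_width d w2); lia.
have wd2 : leq_width 2 (add_width w d) by apply: leq_width_le wd3.
have n0 : (0 < n)%N by case: (n) w0N w0i => // /perm_nilP ->.
have [u [uA uE]] := subsemigroup_gen_word tA.
have [un|nu] := leqP (size u) (2 * n).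
  apply: leq_trans (cost_short_word wd2 uA uE) (leq_trans (_ : _ <= 4 * n + 4)%N _).
    by move: un; move: (size u) => a; clear; lia.
  by rewrite leq_pmulr.
pose u1 := take n u; pose z0 := take (size u - 2 * n) (drop n u).
pose v1 := drop (size u - 2 * n) (drop n u).
have uD : u = u1 ++ z0 ++ v1 by rewrite /u1 /z0 /v1 !cat_take_drop.
have su : size u1 = n by rewrite size_take_min; lia.
have sv : size v1 = n by rewrite !size_drop; lia.
have /and3P [u1A z0A v1A] : [&& all (mem A) u1, all (mem A) z0 & all (mem A) v1].
  by rewrite -!all_cat -uD.
have perm z z' := @perm_in_context S n w0 w0N w0i (fun s => hp s VS) u1 v1 z z'.
have [|z [zz0 zE zprod]] := @minimal_multiset S u1 v1 z0.
  by move=> z z'; apply: perm; rewrite ?su ?sv.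
pose e x := count_mem x z; pose D := undup z.
have tE : inj1 t = ev id (u1 ++ power_word e D ++ v1).
  rewrite -uE uD -zE; apply: perm; rewrite ?su ?sv //.
  by rewrite perm_sym perm_count_undup.
have DA : all (mem A) D.
  by apply/allP => a; rewrite mem_undup => /zz0; apply: (allP z0A).
have [|p2 [up2 sp2 Hp2]] := @power_word_piece S A e D DA.
  by move=> x; rewrite mem_undup -has_pred1 has_count.
have u10 : u1 <> [::] by move/(congr1 size); rewrite su => n00; rewrite n00 in n0.
have [p1 [up1 sp1 Hp1]] := load_word (k := 0%N) (a := 1%N) isT u10 u1A.
have [p3 [up3 sp3 Hp3]] := mulr_word (k := 0%N) (a := 1%N) isT v1A.
have [r1 [run1 E1 _]] := Hp1 (fun=> 1) I.
have r10 : r1 0%N != 1 by rewrite E1 ev_eq1; case: (u1) u10.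
have [r2 [run2 E2 _]] := Hp2 r1 r10.
have [|r3 [run3 E3 _]] := Hp3 r2.
  by rewrite E2 adjone_mul_eq1 (negbTE r10).
rewrite E2 E1 -!ev_cat -catA -tE in E3.
have sub : {subset [:: 0; 1]%N <= [:: 0; 1; 2]%N}.
  by move=> j; rewrite !inE => /orP [] ->; rewrite ?orbT.
have up : usable A [:: 0; 1; 2]%N (p1 ++ p2 ++ p3).
  by rewrite !usable_cat up2 (usable_sub sub up1) (usable_sub sub up3).
have run : runs (p1 ++ p2 ++ p3) (fun=> 1) r3.
  by apply: runs_cat run1 (runs_cat run2 run3).
apply: leq_trans (slp_cost_le up wd3 run E3) _.
have H : (\sum_(x <- D) 4 * trunc_log 2 (e x).+1 <= 4 * trunc_log 2 N.+1)%N.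
  rewrite -big_distrr leq_mul2l /=.
  apply: leq_trans (sum_trunc_log _ _) _ => //; apply: leq_trunc_log.
  apply: leq_trans (_ : \prod_(x : S) (e x).+1 <= _)%N.
    rewrite big_uniq ?undup_uniq // [leqRHS](bigID (mem D)) /=.
    by rewrite leq_pmulr // prodn_gt0.
  by apply: leq_trans zprod _; rewrite card_adjone ltnS.
rewrite !size_cat; move: sp1 sp2 sp3; rewrite su sv => sp1 sp2 sp3.
have : (4 * n <= 4 * n * trunc_log 2 N.+1)%N by rewrite leq_pmulr.
rewrite mulnDl; move: sp1 (leq_trans sp2 H) sp3.
move: (size p1) (size p2) (size p3) (trunc_log 2 _) => a b c T.
by clear; lia.
Qed.

End PermutationCost.

Lemma compression_upper_bound V (hV : pseudovariety V) :
  ~ contains V LRB -> ~ contains V RRB -> ~ contains V Tnil ->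
  exists C, forall w d N, leq_width 2 w -> 1 < d ->
    CV (add_width w d) V N <= C * (CV w (groups_of V) N + trunc_log 2 N.+1).
Proof.
move=> nL nR nT; have [n [hn|[w0 [w0N w0i hp]]]] := no_Tnil hV nT.
- have [C HC] := lengthening_cost hV hn nL nR; exists C => w d N w2 d2.
  by apply: CV_le => S VS SN; apply: CS_le => A t tA; apply: HC VS SN tA.
- have [C HC] := permutation_cost w0N w0i hp; exists C => w d N w2 d2.
  apply: CV_le => S VS SN; apply: CS_le => A t tA.
  by apply: leq_trans (HC _ _ _ _ _ _ w2 d2 VS SN tA) _; rewrite leq_mul2l leq_addl orbT.
Qed.

(** * Groups: straight-line programs of quadratic logarithmic length *)

Section Chains.
Variables (S : finSemigroupType) (A : {set S}).
Local Open Scope group_scope.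
Implicit Types (l : seq S) (x y : S).

(** Programs in which no register is ever overwritten, latest value first. *)
Inductive chain : seq S -> Prop :=
  | chain_nil : chain [::]
  | chain_gen x l : x \in A -> chain l -> chain (x :: l)
  | chain_mul x y l : x \in l -> y \in l -> chain l -> chain (x * y :: l).

Lemma chain_program l : chain l -> exists p (r : nat -> adjone S),
  [/\ slp_over A p, size p = size l, runs p (fun=> 1) r &
    forall x, x \in l -> exists2 j, (j < size l)%N & r j = inj1 x].
Proof.
have ext l' (r : nat -> adjone S) c :
    (forall x, x \in l' -> exists2 j, (j < size l')%N & r j = inj1 x) ->
    forall x, x \in c :: l' -> exists2 j, (j < (size l').+1)%N &
      setr r (size l') (inj1 c) j = inj1 x.
  move=> H x; rewrite inE => /orP [/eqP ->|/H [j jl E]].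
    by exists (size l') => //; rewrite setr_eq.
  by exists j; [apply: leq_trans jl _ | rewrite setr_neq // neq_ltn jl].
elim=> [|x l' xA _ [p [r [op sp run H]]]|x y l' xl yl _ [p [r [op sp run H]]]].
- by exists [::], (fun=> 1).
- exists (p ++ [:: Const (size l') x]), (setr r (size l') (inj1 x)); split=> /=.
  + by rewrite over_cat op /= xA.
  + by rewrite size_cat sp addn1.
  + exact: runs_cat run (runs_const _ _ _).
  + exact: ext.
- have [[i il ri] [j jl rj]] := (H x xl, H y yl).
  exists (p ++ [:: Mul S (size l') i j]), (setr r (size l') (inj1 (x * y))); split=> /=.
  + by rewrite over_cat op.
  + by rewrite size_cat sp addn1.
  + by apply: runs_cat run _; rewrite inj1M -ri -rj; apply: runs_mul; rewrite ?ri ?rj.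
  + exact: ext.
Qed.

Lemma chain_cost l t : chain l -> t \in l -> (slp_cost None A t <= size l)%N.
Proof.
move=> /chain_program [p [r [op <- run H]]] /H [j _ E].
by apply: nat_min_le; exists p => //; split=> //; exists r; split=> //; exists j.
Qed.

(** Every chain containing [l] extends by at most [m] instructions to one containing
    [x]; quantifying over all such chains makes costs add up. *)
Definition cheap l m x := forall l', chain l' -> {subset l <= l'} ->
  exists l'', [/\ chain l'', {subset l' <= l''}, (size l'' <= size l' + m)%N & x \in l''].

Lemma cheap_mem l x : x \in l -> cheap l 0 x.
Proof. by move=> xl l' cl sub; exists l'; split=> //; [rewrite addn0 | apply: sub]. Qed.

Lemma cheap_gen l x : x \in A -> cheap l 1 x.
Proof.
move=> xA l' cl _; exists (x :: l'); split; rewrite ?mem_head ?addn1 //; first exact: chain_gen.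
by move=> y yl; rewrite inE yl orbT.
Qed.

Lemma cheap_le l m n x : (m <= n)%N -> cheap l m x -> cheap l n x.
Proof.
move=> mn H l' cl sub; have [l'' [? ? s ?]] := H l' cl sub; exists l''; split=> //.
by apply: leq_trans s _; rewrite leq_add2l.
Qed.

Lemma cheap_sub l l' m x : {subset l <= l'} -> cheap l m x -> cheap l' m x.
Proof. by move=> sub H l1 cl sub1; apply: H => // y /sub /sub1. Qed.

Lemma cheap_bind l m n x y : cheap l m x -> cheap (x :: l) n y -> cheap l (m + n) y.
Proof.
move=> Hx Hy l' cl sub; have [l1 [c1 s1 z1 x1]] := Hx l' cl sub.
have [|l2 [c2 s2 z2 y2]] := Hy l1 c1.
  by move=> a; rewrite inE => /orP [/eqP ->|/sub /s1].
exists l2; split=> //; first by move=> a /s1 /s2.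
by apply: leq_trans z2 _; rewrite addnA leq_add2r.
Qed.

Lemma cheap_mul l m n x y : cheap l m x -> cheap l n y -> cheap l (m + n).+1 (x * y).
Proof.
move=> Hx Hy; rewrite -addn1 -addnA; apply: cheap_bind Hx _.
apply: (@cheap_bind _ _ _ y); first by apply: cheap_sub Hy => a al; rewrite inE al orbT.
move=> l' cl sub; exists (x * y :: l'); split; rewrite ?mem_head ?addn1 //.
  by apply: chain_mul => //; apply: sub; rewrite !inE eqxx ?orbT.
by move=> a al; rewrite inE al orbT.
Qed.

Lemma cheap_power l x y e : x \in l -> (0 < e)%N -> inj1 y = inj1 x ^+ e ->
  cheap l (2 * trunc_log 2 e) y.
Proof.
move=> xl; have [n] := ubnP e; elim: n e y => // n IH e y en e0 yE.
have [e1|e2] := leqP e 1.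
  have e1' : e = 1%N by move: e0 e1; clear; lia.
  by move: yE; rewrite e1' expg1 => -[->]; apply: cheap_le (cheap_mem xl).
have h0 : (0 < e./2)%N by move: e2; clear; lia.
have hn : (e./2 < n)%N by move: en e2; clear; lia.
have [z zE] : exists z, inj1 x ^+ e./2 = inj1 z by apply: adjone_neq1; rewrite exp_eq1.
have Hz := IH _ z hn h0 (esym zE).
have lgE : (2 * trunc_log 2 e = 2 * trunc_log 2 e./2 + 2)%N by rewrite trunc_log2S // mulnS addnC.
rewrite lgE; apply: cheap_bind Hz _.
have zl : z \in z :: l by apply: mem_head.
have sq := cheap_mul (cheap_mem zl) (cheap_mem zl).
have yz : inj1 y = if odd e then inj1 (z * z * x) else inj1 (z * z).
  have eE : e = (e./2 + e./2 + odd e)%N by rewrite addnn addnC odd_double_half.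
  by rewrite yE [in LHS]eE !expgnDr zE; case: (odd e); rewrite ?expg1 ?expg0 ?mulg1 !inj1M.
case: (odd e) yz => /inj1_inj ->; last by apply: cheap_le sq.
have xzl : x \in z :: l by rewrite inE xl orbT.
exact: cheap_mul sq (cheap_mem xzl).
Qed.

End Chains.

Section Reachability.
Variables (G : finSemigroupType) (A : {set G}) (e : G) (inv : G -> G) (N : nat).
Local Open Scope group_scope.
Hypotheses (eG : forall x : G, e * x = x /\ x * e = x).
Hypotheses (invG : forall x : G, x * inv x = e /\ inv x * x = e).
Hypothesis GN : (#|G| <= N)%N.
Let T := trunc_log 2 N.+1.
Implicit Types (l : seq G) (x y z k : G) (K : {set G}).

Let ex x : e * x = x. Proof. by case: (eG x). Qed.
Let xe x : x * e = x. Proof. by case: (eG x). Qed.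
Let xV x : x * inv x = e. Proof. by case: (invG x). Qed.
Let Vx x : inv x * x = e. Proof. by case: (invG x). Qed.

Lemma inv_unique x y : x * y = e -> y = inv x.
Proof. by move=> E; rewrite -[y]ex -(Vx x) -mulgA E xe. Qed.

Lemma inv_mul x y : inv (x * y) = inv y * inv x.
Proof. by apply/esym/inv_unique; rewrite -mulgA (mulgA y) xV ex xV. Qed.

Lemma order_exponent x : exists k : nat, [/\ (0 < k)%N, (k.+1 <= 2 * N.+1)%N,
  inj1 x ^+ k.+1 = inj1 e & inj1 x ^+ k = inj1 (inv x)].
Proof.
have [k /andP [k1 kM] xk] := om_exp (inj1 x).
have k0 : (0 < k.-1)%N by move: k1; clear; lia.
have kE : k.-1.+1 = k by rewrite prednK // ltnW.
have [z zE] : exists z, inj1 x ^+ k = inj1 z by apply: adjone_neq1; rewrite exp_eq1 ?(ltnW k1).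
have zz : z * z = z by apply: inj1_inj; rewrite inj1M -zE -xk om_idem.
have ze : z = e by rewrite -[LHS]xe -(xV z) mulgA zz.
exists k.-1; split=> //; rewrite ?kE.
- by apply: leq_trans kM _; rewrite leq_mul2l card_adjone ltnS.
- by rewrite zE ze.
have [y yE] : exists y, inj1 x ^+ k.-1 = inj1 y by apply: adjone_neq1; rewrite exp_eq1.
rewrite yE; congr inj1; apply: inv_unique; apply: inj1_inj.
by rewrite inj1M -yE -expgS kE zE ze.
Qed.

Lemma trunc_log_exponent (k : nat) : (k <= 2 * N.+1)%N -> (2 * trunc_log 2 k <= 2 * T + 2)%N.
Proof.
move=> kN; rewrite -[leqRHS]/(2 * T + 2 * 1)%N -mulnDr leq_mul2l /= addn1.
by rewrite -trunc_logMp //; apply: leq_trunc_log.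
Qed.

Lemma cheap_inv l m x : cheap A l m x -> cheap A l (m + (2 * T + 2)) (inv x).
Proof.
move=> Hx; have [k [k0 kN _ kE]] := order_exponent x; apply: cheap_bind Hx _.
apply: cheap_le (trunc_log_exponent (ltnW kN)) _.
exact: cheap_power (mem_head _ _) k0 (esym kE).
Qed.

(** The cube spanned by [i] elements: the list [l] computes them and their
    inverses, and all their [2 ^ i] ordered subproducts are distinct. *)
Definition cube i l K := [/\ chain A l, e \in K, #|K| = (2 ^ i)%N &
  forall x, x \in K -> cheap A l i x /\ cheap A l i (inv x)].

Definition quotients K z := exists k k', [/\ k \in K, k' \in K & z = inv k * k'].

(** An element [z] outside of the quotients [inv k * k'] makes [K] and [K * z] disjoint;
    one of the form [inv k * k' * s] costs only [O(i)] instructions. *)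
Lemma cube_step i l K k k' s : cube i l K -> k \in K -> k' \in K -> s \in A ->
  ~ quotients K (inv k * k' * s) ->
  exists l' K', cube i.+1 l' K' /\ (size l' <= size l + (2 * i + 2 * T + 5))%N.
Proof.
move=> [cl eK cK HK] kK k'K sA nq; set z := inv k * k' * s in nq.
have Hz : cheap A l (2 * i + 3) z.
  have := cheap_mul (cheap_mul (proj2 (HK k kK)) (proj1 (HK k' k'K))) (cheap_gen (l := l) sA).
  by apply: cheap_le; clear; lia.
have [l1 [c1 s1 z1 x1]] := Hz l cl (fun x => id).
have [l2 [c2 s2 z2 x2]] := cheap_inv (cheap_mem (A := A) x1) c1 (fun x => id).
pose Kz := [set x * z | x in K]%SET.
have mulzI : injective (fun x => x * z).
  move: (z) => y0 x y /(congr1 (fun t => t * inv y0)).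
  by rewrite -!mulgA xV !xe.
have disj : K :&: Kz = finset.set0.
  apply/setP => x; rewrite finset.in_set0 finset.in_setI; apply/negP => /andP [xK /imsetP [y yK xE]].
  by apply: nq; exists y, x; split=> //; rewrite xE mulgA Vx ex.
exists l2, (K :|: Kz)%SET; split; last first.
  by apply: leq_trans z2 _; move: z1; move: (size l1) (size l); clear; lia.
split=> //.
- by rewrite finset.in_setU eK.
- by rewrite cardsU disj cards0 subn0 card_imset // cK expnS mul2n addnn.
- have sub : {subset l <= l2} by move=> x /s1 /s2.
  move=> x; rewrite finset.in_setU => /orP [xK|/imsetP [y yK ->]].
    by have [h1 h2] := HK x xK; split; apply: (cheap_le (leqnSn i)); apply: cheap_sub sub _.
  have [h1 h2] := HK y yK; split.
    have := cheap_mul (cheap_sub sub h1) (cheap_mem (A := A) (s2 _ x1)); by rewrite addn0.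
  have := cheap_mul (cheap_mem (A := A) x2) (cheap_sub sub h2); by rewrite (inv_mul y z).
Qed.

(** A set of quotients that contains [e] and is stable under the generators is everything. *)
Lemma cube_stops i l K t : cube i l K -> t \in subsemigroup_gen A ->
  (forall k k' s, k \in K -> k' \in K -> s \in A -> quotients K (inv k * k' * s)) ->
  cheap A l (2 * i + 1) t.
Proof.
move=> [cl eK cK HK] /subsemigroup_gen_word [w [wA wE]] closed.
suff [k [k' [kK k'K ->]]] : quotients K t.
  have := cheap_mul (proj2 (HK k kK)) (proj1 (HK k' k'K)).
  by apply: cheap_le; clear; lia.
have H z : quotients K z -> forall u, all (mem A) u ->
    forall y, inj1 z * ev id u = inj1 y -> quotients K y.
  move=> zq u; elim: u z zq => [|s u IH] z zq /=.
    by move=> _ y; rewrite ev_nil mulg1 => /inj1_inj <-.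
  case/andP => sA uA y; rewrite ev_cons mulgA -inj1M; apply: IH => //.
  by have [k [k' [kK k'K ->]]] := zq; apply: closed.
apply: (H e _ w wA); last by rewrite wE -inj1M ex.
by exists e, e; split=> //; rewrite Vx.
Qed.

(** Each of at most [T] doublings costs [O(T)] instructions, for the new element and for
    its inverse. *)
Lemma group_slp t : t \in subsemigroup_gen A -> (slp_cost None A t <= 32 * T ^ 2)%N.
Proof.
move=> tA.
have T1 : (0 < T)%N.
  by rewrite trunc_log_gt0 //= ltnS (leq_trans _ GN) //; apply/card_gt0P; exists t.
have [s sA] : exists s, s \in A.
  have [[|s w] [wA wE]] := subsemigroup_gen_word tA; first by rewrite ev_nil in wE.
  by exists s; case/andP: wA.
have [l0 [c0 _ z0 e0]] : exists l, [/\ chain A l, {subset [::] <= l},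
    (size l <= 0 + (1 + (2 * T + 2)))%N & e \in l].
  apply: (cheap_bind (cheap_gen (l := [::]) sA) _ (chain_nil A)) => //.
  have [k [k0 kN kE _]] := order_exponent s.
  apply: cheap_le (trunc_log_exponent kN) _.
  exact: cheap_power (mem_head _ _) _ (esym kE).
have cube0 : cube 0 l0 [set e]%SET.
  split=> //; rewrite ?set11 ?cards1 // => x /set1P ->.
  have -> : inv e = e by apply/esym/inv_unique; rewrite ex.
  by split; apply: cheap_mem.
have main f i l K : (i + f = T.+1)%N -> cube i l K ->
    exists l', [/\ chain A l', t \in l' & (size l' <= size l + f * (4 * T + 7) + (2 * T + 3))%N].
  elim: f i l K => [|f IH] i l K ifT cK.
    have [_ _ Kcard _] := cK; have := max_card (mem K); rewrite Kcard.
    have := trunc_log_ltn N.+1 (isT : 1 < 2)%N; rewrite -/T -ifT addn0 => lt le.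
    by have := leq_trans lt (leq_trans le GN); rewrite ltnNge leqnSn.
  have iT : (i <= T)%N by move: ifT; clear; lia.
  case: (pselect (forall k k' s, k \in K -> k' \in K -> s \in A ->
      quotients K (inv k * k' * s))) => [closed|nclosed].
    have [cl _ _ _] := cK.
    have [l' [c' _ z' t']] := cube_stops cK tA closed cl (fun x => id).
    exists l'; split=> //; apply: leq_trans z' _.
    by move: iT; move: (size l) (f.+1 * _)%N; clear; lia.
  have [k [k' [s' [kK k'K s'A nq]]]] : exists k k' s, [/\ k \in K, k' \in K, s \in A &
      ~ quotients K (inv k * k' * s)].
    apply: contrapT => H; apply: nclosed => k k' s' kK k'K s'A.
    by apply: contrapT => nq; apply: H; exists k, k', s'.
  have [l1 [K1 [cK1 z1]]] := cube_step cK kK k'K s'A nq.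
  have [|l' [c' t' z']] := IH i.+1 l1 K1 _ cK1; first by rewrite addSnnS.
  exists l'; split=> //; apply: leq_trans z' _; rewrite (mulSn f).
  by move: iT z1; move: (size l) (size l1) (f * _)%N; clear; lia.
have [l [cl tl zl]] := main T.+1 0%N l0 _ (add0n _) cube0.
apply: leq_trans (chain_cost cl tl) (leq_trans zl _).
move: z0 T1; move: (size l0) T => a b; rewrite expnS expn1; clear; nia.
Qed.

End Reachability.

Lemma groups_upper_bound V N :
  CV None (groups_of V) N <= 32 * trunc_log 2 N.+1 ^ 2.
Proof.
apply: CV_le => G [_ [e [eG invG]]] GN; apply: CS_le => A t tA.
have [inv invP] := choice invG.
apply: leq_trans (group_slp eG invP GN tA) _.
by [].
Qed.

(** * Lower bounds *)

Section ManyGenerators.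
Variables (S : finSemigroupType) (n : nat) (a : 'I_n.+1 -> S) (cov : S -> 'I_n.+1 -> bool).
Hypothesis covM : forall x y i, cov (x * y)%g i -> cov x i || cov y i.
Hypothesis cov_gen : forall i j, cov (a j) i -> i = j.
Variable t : S.
Hypotheses (cov_t : forall i, cov t i) (a_inj : injective a).
Hypothesis t_gen : generated (fun x => exists i, x = a i) t.

Definition constants (p : slp S) : seq S :=
  pmap (fun c => if c is Const _ s then Some s else None) p.

Lemma covered_constants (p : slp S) (r r' : state S) :
  foldl (fun o c => obind (@exec_instr S ^~ c) o) (Some r) p = Some r' ->
  slp_over [set a i | i : 'I_n.+1] p ->
  forall k x i, r' k = Some x -> cov x i ->
  a i \in constants p \/ exists l y, r l = Some y /\ cov y i.
Proof.
elim: p r => [|c p IH] r /=; first by move=> [<-] _ k x i rk ci; right; exists k, x.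
case: c => [k s|k l m] /=.
  move=> /IH {}IH /andP [sA /IH {}IH] k' x i r'k ci.
  have [|[l [y [yE cy]]]] := IH k' x i r'k ci; first by rewrite inE => ->; rewrite orbT; left.
  move: yE; rewrite /assign; case: eqP => [_ [sy]|_ yE]; last by right; exists l, y.
  left; move: cy; rewrite -sy; case/imsetP: sA => j _ ->.
  by move=> /cov_gen ->; rewrite mem_head.
case rl: (r l) => [b|]; last by rewrite exec_none.
case rm: (r m) => [d|]; last by rewrite exec_none.
move=> /IH {}IH /IH {}IH k' x i r'k ci.
have [|[q [y [yE cy]]]] := IH k' x i r'k ci; first by left.
right; move: yE; rewrite /assign; case: eqP => [_ [yE]|_ yE]; last by exists q, y.
by move: cy; rewrite -yE => /covM /orP [cb|cd]; [exists l, b | exists m, d].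
Qed.

(** Every generator covers only one index, so a program for [t] loads all of them. *)
Lemma many_generators : n < CS None S.
Proof.
pose A := [set a i | i : 'I_n.+1]%SET.
have tA : t \in subsemigroup_gen A.
  by apply: generated_subsemigroup_gen t_gen => x [i ->]; apply: imset_f.
apply: leq_trans (slp_cost_CS None tA).
have [_ [p [oA _ [r [run [k rk]]] <-]]] := slp_cost_two_registers (w := None) isT tA.
have H i : a i \in constants p.
  by have [//|[l [y []]]] := covered_constants run oA rk (cov_t i).
apply: leq_trans (_ : size (constants p) <= size p); last by rewrite size_pmap count_size.
rewrite -[leqLHS]size_enum_ord -(size_map a); apply: uniq_leq_size.
  by rewrite map_inj_uniq // enum_uniq.
by move=> x /mapP [i _ ->].
Qed.

End ManyGenerators.

(** The interval [lo, hi] acts on the natural numbers by sending the points from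
    [lo] to [hi] to [hi], fixing those above [hi], and killing those below [lo]. *)
Definition itv n : predArgType := {p : 'I_n.+2 * 'I_n.+2 | p.1 <= p.2}.
HB.instance Definition _ n := SubFinite.copy (itv n) {p : 'I_n.+2 * 'I_n.+2 | p.1 <= p.2}.

Section Intervals.
Variable n : nat.
Notation I := (itv n).
Definition lo (x : I) : nat := (val x).1.
Definition hi (x : I) : nat := (val x).2.

Lemma lo_hi x : lo x <= hi x. Proof. by case: x. Qed.

Lemma itv_ext x y : lo x = lo y -> hi x = hi y -> x = y.
Proof.
case: x y => [[l m] h] [[l' m'] h']; rewrite /lo /hi /= => e1 e2; apply: val_inj => /=.
by congr (_, _); apply: val_inj.
Qed.

Definition mk_itv (l m : nat) : I :=
  insubd (Sub (ord0, ord0) isT : I) (inord l : 'I_n.+2, inord m : 'I_n.+2).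

Lemma mk_itvE l m : l <= m <= n.+1 -> lo (mk_itv l m) = l /\ hi (mk_itv l m) = m.
Proof.
move=> lm; have [h1 h2] : l < n.+2 /\ m < n.+2 by lia.
by rewrite /lo /hi /mk_itv val_insubd /= !inordK // (proj1 (andP lm)) /= !inordK.
Qed.

Lemma hi_bound x : hi x <= n.+1. Proof. by rewrite -ltnS /hi ltn_ord. Qed.

Definition itv_mul x y := if lo y <= hi x then mk_itv (lo x) (maxn (hi x) (hi y)) else y.

Lemma lo_mul x y : lo (itv_mul x y) = if lo y <= hi x then lo x else lo y.
Proof.
rewrite /itv_mul; case: ifP => // _; apply: (proj1 (mk_itvE _)).
by have := lo_hi x; have := hi_bound x; have := hi_bound y; lia.
Qed.

Lemma hi_mul x y : hi (itv_mul x y) = if lo y <= hi x then maxn (hi x) (hi y) else hi y.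
Proof.
rewrite /itv_mul; case: ifP => // _; apply: (proj2 (mk_itvE _)).
by have := lo_hi x; have := hi_bound x; have := hi_bound y; lia.
Qed.

Lemma itv_mulA : associative itv_mul.
Proof.
move=> x y z; have := (lo_hi x, lo_hi y, lo_hi z).
move=> [[h1 h2] h3]; apply: itv_ext; rewrite !(lo_mul, hi_mul);
move: (lo x) (lo y) (lo z) (hi x) (hi y) (hi z) h1 h2 h3 => a b c d e f; clear;
repeat case: ifP; lia.
Qed.

Lemma itv_idem x : itv_mul x x = x.
Proof. by apply: itv_ext; rewrite !(lo_mul, hi_mul) lo_hi ?maxnn. Qed.

Lemma itv_abs x y : itv_mul (itv_mul x y) x = itv_mul x y.
Proof.
have := (lo_hi x, lo_hi y); move=> [h1 h2]; apply: itv_ext; rewrite !(lo_mul, hi_mul);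
move: (lo x) (lo y) (hi x) (hi y) h1 h2 => a b c d; clear; repeat case: ifP; lia.
Qed.

Lemma card_itv : #|I| <= n.+2 ^ 2.
Proof.
rewrite card_sub; apply: leq_trans (max_card _) _.
by rewrite card_prod !card_ord -mulnn.
Qed.

Definition itv_gen (i : 'I_n.+1) : I := mk_itv i i.+1.
Definition itv_cov (x : I) (i : 'I_n.+1) := lo x <= i < hi x.

Lemma itv_genE (i : 'I_n.+1) : lo (itv_gen i) = i /\ hi (itv_gen i) = i.+1.
Proof. by apply: mk_itvE; rewrite leqnSn ltn_ord. Qed.

Lemma itv_gen_inj : injective itv_gen.
Proof.
by move=> i j /(congr1 lo); rewrite (proj1 (itv_genE i)) (proj1 (itv_genE j)) => /val_inj.
Qed.

Lemma itv_cov_gen i j : itv_cov (itv_gen j) i -> i = j.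
Proof.
rewrite /itv_cov (proj1 (itv_genE j)) (proj2 (itv_genE j)) => h; apply: val_inj => /=.
by move: h; lia.
Qed.

Lemma itv_covM x y i : itv_cov (itv_mul x y) i -> itv_cov x i || itv_cov y i.
Proof.
rewrite /itv_cov lo_mul hi_mul; have := lo_hi x; have := lo_hi y.
by case: ifP => h1 h2 h3 h4; apply/orP; lia.
Qed.

Lemma itv_total (i : 'I_n.+1) : itv_cov (mk_itv 0 n.+1) i.
Proof. by have [h1 h2] := @mk_itvE 0 n.+1 (leqnn _); rewrite /itv_cov h1 h2 /=. Qed.

Lemma itv_first : mk_itv 0 1 = itv_gen ord0. Proof. by []. Qed.

Lemma itv_next j : 0 < j -> j < n.+1 ->
  mk_itv 0 j.+1 = itv_mul (mk_itv 0 j) (itv_gen (inord j)).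
Proof.
move=> j0 jn; have [h1 h2] := itv_genE (inord j); rewrite inordK // in h1 h2.
have [|l1 m1] := @mk_itvE 0 j; first by lia.
have [|l2 m2] := @mk_itvE 0 j.+1; first by lia.
apply: itv_ext; rewrite !(lo_mul, hi_mul) ?h1 ?h2 ?l1 ?m1 ?l2 ?m2 leqnn //; lia.
Qed.

End Intervals.

Definition lrb_itv n : predArgType := itv n.
HB.instance Definition _ n := Finite.copy (lrb_itv n) (itv n).
HB.instance Definition _ n := isSemigroup.Build (lrb_itv n) (@itv_mulA n).

Lemma itv_mulA_op n : associative (fun x y : itv n => itv_mul y x).
Proof. by move=> x y z; rewrite itv_mulA. Qed.

Definition rrb_itv n : predArgType := itv n.
HB.instance Definition _ n := Finite.copy (rrb_itv n) (itv n).
HB.instance Definition _ n := isSemigroup.Build (rrb_itv n) (@itv_mulA_op n).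

Lemma LRB_lower_bound n : LRB (lrb_itv n) /\ n < CS None (lrb_itv n).
Proof.
split; first by split; [exact: itv_idem | exact: itv_abs].
apply: (@many_generators (lrb_itv n) n (@itv_gen n) (@itv_cov n) (@itv_covM n)
  (@itv_cov_gen n) (mk_itv n 0 n.+1) (@itv_total n) (@itv_gen_inj n)).
suff H j : j < n.+1 -> generated (T := lrb_itv n) (fun x => exists i, x = @itv_gen n i)
    (mk_itv n 0 j.+1) by exact: H (ltnSn n).
elim: j => [|j IH] jn.
  by rewrite itv_first; apply: generated_base; exists ord0.
rewrite itv_next //; apply: (generated_mul (T := lrb_itv n)); first exact: IH (ltnW jn).
by apply: generated_base; exists (inord j.+1).
Qed.

Lemma RRB_lower_bound n : RRB (rrb_itv n) /\ n < CS None (rrb_itv n).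
Proof.
split.
  split; first exact: itv_idem.
  by move=> x y; apply: etrans (itv_mulA x y x) _; apply: itv_abs.
have covM (x y : rrb_itv n) i : itv_cov (x * y)%g i -> itv_cov x i || itv_cov y i.
  by rewrite orbC; apply: itv_covM.
apply: (@many_generators (rrb_itv n) n (@itv_gen n) (@itv_cov n) covM
  (@itv_cov_gen n) (mk_itv n 0 n.+1) (@itv_total n) (@itv_gen_inj n)).
suff H j : j < n.+1 -> generated (T := rrb_itv n) (fun x => exists i, x = @itv_gen n i)
    (mk_itv n 0 j.+1) by exact: H (ltnSn n).
elim: j => [|j IH] jn.
  by rewrite itv_first; apply: generated_base; exists ord0.
rewrite itv_next //; apply: (generated_mul (T := rrb_itv n)); last exact: IH (ltnW jn).
by apply: generated_base; exists (inord j.+1).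
Qed.

(** The factors of a word of [n.+1] distinct letters, by their two end points; pairs
    that are not increasing are null elements. *)
Definition path_sg n : predArgType := option ('I_n.+2 * 'I_n.+2).
HB.instance Definition _ n := Finite.copy (path_sg n) (option ('I_n.+2 * 'I_n.+2)).

Section Paths.
Variable n : nat.
Definition path_mul (x y : path_sg n) : path_sg n :=
  match x, y with
  | Some (i, j), Some (k, l) => if [&& i < j, j == k & k < l] then Some (i, l) else None
  | _, _ => None
  end.

Lemma path_mulA : associative path_mul.
Proof.
case=> [[i j]|] [[k l]|] [[p q]|] //=; last by case: ifP.
case E1: [&& k < l, l == p & p < q]; case E2: [&& i < j, j == k & k < l] => //=;
move: E1 E2; rewrite -!val_eqE /= => E1 E2; case: ifP => //; try case: ifP => //; lia.
Qed.
HB.instance Definition _ := isSemigroup.Build (path_sg n) path_mulA.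

Lemma path_mulE (x y : path_sg n) : (x * y)%g = path_mul x y. Proof. by []. Qed.

Lemma path_nil : Tnil (path_sg n).
Proof.
exists (None : path_sg n); split.
- by case=> [[i j]|].
- case=> [[i j]|]; rewrite !path_mulE //=.
  by case: ifP => // /and3P [ij /eqP ji _]; move: ij; rewrite ji ltnn.
- case=> [[i j]|] [[k l]|]; rewrite !path_mulE //=.
  case: ifP => // /and3P [ij /eqP jk kl] /=; case: ifP => // /and3P [il /eqP li _].
  by move: il; rewrite li ltnn.
Qed.

Definition path_gen (i : 'I_n.+1) : path_sg n := Some (inord i, inord i.+1).
Definition path_cov (x : path_sg n) (i : 'I_n.+1) := if x is Some (k, l) then k <= i < l else false.

Lemma path_gen_val (i : 'I_n.+1) : (inord i : 'I_n.+2) = i :> nat /\ (inord i.+1 : 'I_n.+2) = i.+1 :> nat.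
Proof. by split; rewrite inordK // ltnS ?ltn_ord // ltnW. Qed.

Lemma path_lower_bound : n < CS None (path_sg n).
Proof.
apply: (@many_generators (path_sg n) n path_gen path_cov _ _
  (Some (inord 0, inord n.+1) : path_sg n)).
- case=> [[i j]|] [[k l]|] m; rewrite !path_mulE //=; case: ifP => //=.
  case/and3P => ij /eqP jk kl /andP [im ml]; rewrite im ml /= andbT -jk.
  by case: ltnP.
- move=> i j; rewrite /path_cov /path_gen; have [-> ->] := path_gen_val j => h.
  by apply: val_inj => /=; move: h; lia.
- by move=> i; rewrite /path_cov !inordK //= -ltnS ltnW // ltnS.
- move=> i j [] /(congr1 val) /=; have [-> _] := path_gen_val i; have [-> _] := path_gen_val j.
  by move=> /val_inj.
suff H j : j < n.+1 -> generated (T := path_sg n) (fun x => exists i, x = path_gen i)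
    (Some (inord 0, inord j.+1)) by exact: H (ltnSn n).
elim: j => [|j IH] jn.
  by apply: generated_base; exists ord0.
have -> : (Some (inord 0, inord j.+2) : path_sg n) =
    (((Some (inord 0, inord j.+1) : path_sg n) * path_gen (inord j.+1))%g).
  rewrite path_mulE /= /path_gen (inordK jn) eqxx /= !inordK //; first by rewrite ltnSn.
  exact: leqW jn.
apply: (generated_mul (T := path_sg n)); first exact: IH (ltnW jn).
by apply: generated_base; exists (inord j.+1).
Qed.

End Paths.

Lemma compression_lower_bound V :
  contains V LRB \/ contains V RRB \/ contains V Tnil ->
  forall n, n < CV None V (n.+3 ^ 2).
Proof.
have le n (S : finSemigroupType) : V S -> #|S| <= n.+3 ^ 2 -> n < CS None S -> n < CV None V (n.+3 ^ 2).
  by move=> VS SN nS; apply: leq_trans nS (le_CV (w := None) isT VS SN).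
have sq n : n.+2 ^ 2 < n.+3 ^ 2 by rewrite ltn_sqr.
have cI n : #|itv n| <= n.+3 ^ 2 by apply: leq_trans (card_itv n) (ltnW (sq n)).
move=> H n; case: H => [VL|[VR|VT]].
- have [h1 h2] := LRB_lower_bound n; exact: (le n (lrb_itv n) (VL _ h1) (cI n) h2).
- have [h1 h2] := RRB_lower_bound n; exact: (le n (rrb_itv n) (VR _ h1) (cI n) h2).
- apply: (le n (path_sg n) (VT _ (path_nil n)) _ (path_lower_bound n)).
  by rewrite card_option card_prod !card_ord mulnn; apply: sq.
Qed.

Local Open Scope ring_scope.

(** * Asymptotics *)

Section Asymptotic.
Variable R : realType.

Lemma in_bigO_intro (f g : nat -> R) C N0 : 0 <= C -> (forall N, 0 <= f N) ->
  (forall N, (N0 <= N)%N -> f N <= C * g N) -> in_bigO f g.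
Proof.
move=> C0 f0 H; apply/eqO_exP; exists (C + 1); first by rewrite ltr_wpDl.
exists N0 => // N /= /H fN; rewrite (ger0_norm (f0 N)); apply: le_trans fN _.
apply: le_trans (ler_norm _) _; rewrite normrM (ger0_norm C0).
by rewrite ler_wpM2r // lerDl.
Qed.

Lemma in_bigO_elim (f g : nat -> R) : (forall N, 0 <= g N) -> in_bigO f g ->
  exists2 C, 0 <= C & exists N0, forall N, (N0 <= N)%N -> f N <= C * g N.
Proof.
move=> g0 /eqO_exP [C C0 [N0 _ H]]; exists C; first exact: ltW.
exists N0 => N /H /= fN; apply: le_trans (ler_norm _) _.
by rewrite -[X in _ * X](ger0_norm (g0 N)).
Qed.

Lemma logR_ge0 N : 0 <= logR R N.
Proof.
rewrite /logR; case: N => [|N]; first by rewrite ln0.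
by rewrite ln_ge0 // ler1n.
Qed.

Lemma ln2_gt0 : 0 < ln 2 :> R. Proof. by rewrite ln_gt0 // ltr1n. Qed.

Lemma logR_ge_ln2 N : (2 <= N)%N -> ln 2 <= logR R N.
Proof. by move=> N2; rewrite /logR ler_ln ?posrE ?ltr0n ?ler_nat // (leq_trans _ N2). Qed.

Lemma trunc_log_logR N : (2 <= N)%N -> (trunc_log 2 N.+1)%:R <= 2 / ln 2 * logR R N.
Proof.
move=> N2; rewrite mulrAC ler_pdivlMr ?ln2_gt0 //.
have N0 : 0 < N%:R :> R by rewrite ltr0n ltnW.
have le : ((2 ^ trunc_log 2 N.+1)%:R : R) <= (N ^ 2)%:R.
  rewrite ler_nat; apply: leq_trans (trunc_logP _ _) _ => //.
  by move: N2; rewrite expnS expn1; clear; nia.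
rewrite !natrX in le.
have : ln (2 ^+ trunc_log 2 N.+1) <= ln (N%:R ^+ 2) :> R.
  by rewrite ler_ln ?posrE ?exprn_gt0.
by rewrite !lnXn // -[X in X <= _]mulr_natl -[X in _ <= X]mulr_natl.
Qed.

Lemma CVR_ge0 w V N : 0 <= CVR R w V N. Proof. exact: ler0n. Qed.

(** Already the one-element group needs one instruction. *)
Lemma CVR_groups_ge1 V (hV : pseudovariety V) w N : leq_width 2 w -> (1 <= N)%N ->
  1 <= CVR R w (groups_of V) N.
Proof.
move=> w2 N1; rewrite /CVR ler1n.
pose T1 := direct_product (fun _ : 'I_0 => lz1).
have eqT (x y : T1) : x = y by apply/ffunP => -[].
pose t : T1 := [ffun i : 'I_0 => None].
have VT : groups_of V T1.
  split; first by apply: (pv_product hV) => -[].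
  by exists t; split=> x; [split; apply: eqT | exists t; split; apply: eqT].
have TN : (#|T1| <= N)%N.
  apply: leq_trans N1; rewrite -(card1 t); apply: subset_leq_card.
  by apply/fintype.subsetP => x _; rewrite inE (eqT x t).
apply: leq_trans (le_CV w2 VT TN).
have tA : t \in subsemigroup_gen [set: T1].
  by apply/bigcapP => A /andP [/fintype.subsetP sub _]; apply: sub; rewrite finset.in_setT.
apply: leq_trans (slp_cost_CS w tA).
have [_ [[|c p] [_ _ [r [run [k rk]]] <-]]] // := slp_cost_two_registers w2 tA.
by move: run rk; rewrite /exec /= => -[<-].
Qed.

Lemma upper_bounds V (hV : pseudovariety V) :
  [/\ ~ contains V LRB, ~ contains V RRB & ~ contains V Tnil] -> compression_bounds R V.
Proof.
case=> nL nR nT; have [C HC] := compression_upper_bound hV nL nR nT.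
have l2 := ln2_gt0.
have bound w d N : leq_width 2 w -> (1 < d)%N -> (2 <= N)%N ->
    CVR R (add_width w d) V N <=
    C%:R * (CVR R w (groups_of V) N + 2 / ln 2 * logR R N).
  move=> w2 d2 N2; apply: le_trans (_ : (C * (CV w (groups_of V) N + trunc_log 2 N.+1))%:R <= _).
    by rewrite ler_nat; apply: HC.
  by rewrite natrM natrD ler_wpM2l // lerD2l trunc_log_logR.
have q0 : 0 <= 2 / ln 2 :> R by rewrite divr_ge0 // ltW.
move=> w w2; split.
- apply: (@in_bigO_intro _ _ (C%:R * (1 + 2 / ln 2)) 2); first by rewrite mulr_ge0 // addr_ge0.
    by move=> N; apply: CVR_ge0.
  move=> N N2; apply: le_trans (bound w 3 N w2 isT N2) _.
  rewrite -[leRHS]mulrA ler_wpM2l //.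
  have := CVR_ge0 w (groups_of V) N; have := logR_ge0 N.
  move: (2 / ln 2) q0 (CVR _ _ _ _) (logR _ _) => q q0 c l l0 c0.
  by have := mulr_ge0 q0 c0; nra.
- apply: (@in_bigO_intro _ _ (C%:R * (3 / ln 2)) 2).
  + by rewrite mulr_ge0 // divr_ge0 // ltW.
  + by move=> N; apply: CVR_ge0.
  move=> N N2; apply: le_trans (bound w 2 N w2 isT N2) _.
  rewrite -[leRHS]mulrA ler_wpM2l //.
  have := CVR_groups_ge1 hV w2 (ltnW N2); have := logR_ge_ln2 N2.
  move: (CVR _ _ _ _) (logR _ _) => c l ll c1.
  have -> : c + 2 / ln 2 * l = (c * ln 2 + 2 * l) / ln 2.
    by field; rewrite gt_eqF.
  rewrite [3 / _ * _]mulrAC ler_wpM2r ?invr_ge0 ?(ltW l2) //.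
  have h1 : c * ln 2 <= c * l by rewrite ler_wpM2l // (le_trans _ c1).
  have h2 : l <= c * l by rewrite ler_peMl // (le_trans (ltW l2)).
  lra.
Qed.

Lemma log_squared V : compression_bounds R V -> in_bigO (CVR R None V) (fun N => logR R N ^+ 2).
Proof.
move=> H; have [H1 _] := H None isT.
have g0 N : 0 <= CVR R None (groups_of V) N + logR R N by rewrite addr_ge0 ?CVR_ge0 ?logR_ge0.
have [C C0 [N0 HC]] := in_bigO_elim g0 H1.
have l2 := ln2_gt0.
apply: (@in_bigO_intro _ _ (C * (32 * (2 / ln 2) ^+ 2 + (ln 2)^-1)) (maxn N0 2)).
- by rewrite mulr_ge0 // addr_ge0 ?mulr_ge0 ?exprn_ge0 ?divr_ge0 ?invr_ge0 ?(ltW l2).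
- by move=> N; apply: CVR_ge0.
move=> N; rewrite geq_max => /andP [/HC HN N2]; apply: le_trans HN _.
rewrite -[leRHS]mulrA ler_wpM2l // mulrDl; apply: lerD.
  apply: le_trans (_ : (32 * trunc_log 2 N.+1 ^ 2)%:R <= _).
    by rewrite ler_nat; apply: groups_upper_bound.
  rewrite natrM natrX -mulrA ler_wpM2l // -exprMn.
  apply: lerXn2r; rewrite ?nnegrE ?ler0n //; last exact: trunc_log_logR.
  by rewrite mulr_ge0 ?divr_ge0 ?logR_ge0 // ltW.
rewrite mulrC ler_pdivlMr // expr2 ler_wpM2l ?logR_ge0 //.
exact: logR_ge_ln2.
Qed.

(** At [N = (n + 3) ^ 2] the lower bound grows like the square root of [N]; for
    [n + 3 = z ^ (k + 1)], the k-th power of the logarithm is at most a constant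
    times [z ^ k]. *)
Lemma efficient_excludes V : efficient_compression R V ->
  [/\ ~ contains V LRB, ~ contains V RRB & ~ contains V Tnil].
Proof.
case=> k Hk.
suff nH : ~ (contains V LRB \/ contains V RRB \/ contains V Tnil).
  by split=> H; apply: nH; tauto.
move/compression_lower_bound => lower.
have [C C0 [N0 HC]] := in_bigO_elim (fun N => exprn_ge0 k (logR_ge0 N)) Hk.
pose D : R := C * (2 * k.+1%:R) ^+ k + 3.
have D0 : 0 <= D by rewrite addr_ge0 // mulr_ge0 // exprn_ge0 // mulr_ge0.
pose z := (N0 + (Num.truncn D).+1 + 3)%N.
have z3 : (3 <= z)%N by rewrite /z leq_addl.
have zD : D < z%:R.
  apply: lt_le_trans (truncnS_gt D) _.
  by rewrite ler_nat /z addnAC leq_addl.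
have z0 : 0 < z%:R :> R by rewrite ltr0n (leq_trans _ z3).
have zk : (z <= z ^ k.+1)%N by rewrite expnS leq_pmulr // expn_gt0 (leq_trans _ z3).
pose n := (z ^ k.+1 - 3)%N.
have n3 : n.+3 = (z ^ k.+1)%N by rewrite -addn3 subnK // (leq_trans z3).
have := lower n; rewrite n3 => lt.
have NN : (N0 <= (z ^ k.+1) ^ 2)%N.
  apply: leq_trans (_ : z <= _)%N; first by rewrite /z -addnA leq_addr.
  by apply: leq_trans zk _; rewrite -mulnn leq_pmulr // expn_gt0 (leq_trans _ z3).
have := HC _ NN.
have -> : logR R ((z ^ k.+1) ^ 2) = 2 * k.+1%:R * ln z%:R.
  by rewrite /logR -expnM natrX lnXn // mulrnA -[LHS]mulr_natl -[ln _ *+ _]mulr_natl mulrA.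
rewrite exprMn => up.
have lz : ln z%:R ^+ k <= z%:R ^+ k :> R.
  apply: lerXn2r; rewrite ?nnegrE ?(ltW z0) ?ln_ge0 ?ler1n ?(leq_trans _ z3) //.
  by rewrite ltW // ln_sublinear.
have e1 : (z ^ k.+1)%:R <= CVR R None V ((z ^ k.+1) ^ 2) + 3 :> R.
  by rewrite -[X in X%:R <= _]n3 -addn3 natrD lerD2r /CVR ler_nat; apply: ltnW.
have e2 : C * ((2 * k.+1%:R) ^+ k * ln z%:R ^+ k) <= C * (2 * k.+1%:R) ^+ k * z%:R ^+ k.
  by rewrite mulrA ler_wpM2l // mulr_ge0 // exprn_ge0 // mulr_ge0.
have e3 : 3 <= 3 * z%:R ^+ k :> R by rewrite ler_peMr // exprn_ege1 // ler1n (leq_trans _ z3).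
have : (z ^ k.+1)%:R <= D * z%:R ^+ k :> R.
  by rewrite mulrDl; apply: le_trans e1 _; apply: lerD e3; apply: le_trans up e2.
by rewrite natrX exprS ler_pM2r ?exprn_gt0 // leNgt zD.
Qed.

End Asymptotic.

Theorem theorem31 (R : realType) (V : finSemigroupType -> Prop)
    (hV : pseudovariety V) :
  [/\ efficient_compression R V <->
        [/\ ~ contains V LRB, ~ contains V RRB & ~ contains V Tnil],
      [/\ ~ contains V LRB, ~ contains V RRB & ~ contains V Tnil] <->
        compression_bounds R V
    & compression_bounds R V ->
        in_bigO (CVR R None V) (fun N => logR R N ^+ 2)].
Proof.
have eff : compression_bounds R V -> efficient_compression R V.
  by move/log_squared => H; exists 2%N.
split; last exact: log_squared.
- by split; [exact: efficient_excludes | by move/(upper_bounds R hV)/eff].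
- by split; [exact: upper_bounds | move/eff/efficient_excludes].
Qed.
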